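(* Let $\mathfrak{g}=\mathfrak{sl}_3(\mathbb{C})$, with Weyl group $W=\{1,s,t,st,ts,w_0\}$, $w_0=sts=tst$, and let $\mathcal{T}(0)$ be the category of tilting modules in the principal block of category $\mathcal{O}$. For a suitable (compatible) choice of the homomorphisms $$u_1:T(w_0)\to T(st),\quad u_2:T(w_0)\to T(ts),\quad u_3:T(st)\to T(s),\quad u_4:T(st)\to T(t),$$ $$u_5:T(ts)\to T(s),\quad u_6:T(ts)\to T(t),\quad u_7:T(s)\to T(1),\quad u_8:T(t)\to T(1)$$ described in the context, with $d_i$ the dual of $u_i$ and $e_w$ the identity of $T(w)$, the morphisms in the category $\mathcal{T}(0)$ are generated by the set $$\{e_w\mid w\in W\}\cup\{u_i\mid i=1,\dots,8\}\cup\{d_i\mid i=1,\dots,8\}$$ subject to the following relations: (1) $u_3u_1=u_5u_2$, $u_4u_1=u_6u_2$, $u_7u_3=u_8u_4$, $u_8u_6=u_7u_5$; (2) $d_1d_3=d_2d_5$, $d_1d_4=d_2d_6$, $d_3d_7=d_4d_8$, $d_6d_8=d_5d_7$; (3) $d_1u_1=0$, $d_2u_2=0$, $d_4u_4=0$, $d_5u_5=0$; (4) $d_3u_3=a\,u_1d_1$, $d_6u_6=a\,u_2d_2$, $d_6u_4=-a\,u_2d_1$, $d_3u_5=-a\,u_1d_2$, $d_4u_6=-a\,u_1d_2$, $d_5u_3=-a\,u_2d_1$ for some $a\in\mathbb{C}^\times$; (5) $d_7u_7=b\,u_5d_5$, $d_8u_8=b\,u_4d_4$, $d_8u_7=b\,u_4d_3+b\,u_6d_5+r\,u_6u_2d_1d_3$,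 $d_7u_8=b\,u_3d_4+b\,u_5d_6+r\,u_3u_1d_2d_6$ for some $b\in\mathbb{C}^\times$, $r\in\mathbb{C}$.
   Context: $s,t$ are the simple reflections of $W$; $\cdot$ is the dot action. For $w\in W$, $\Delta(w)$ is the Verma module with highest weight $w\cdot0$ and $T(w)$ the indecomposable tilting module in $\mathcal{O}$ with highest weight $w\cdot0$; $\mathcal{T}(0)$ is the additive category whose indecomposable objects are the $T(w)$. For $\mathfrak{sl}_3$ all multiplicities $(T(y):\Delta(x))=\dim\mathrm{Hom}_{\mathcal{O}}(\Delta(x),T(y))$ are at most $1$. For $x\geq y$ (Bruhat order), $\bar g^x(y)\in\mathrm{Hom}_{\mathcal{O}}(T(x),T(y))$ denotes an extension along $\Delta(x)\subset T(x)$ of the unique up to scalar nonzero element of $\mathrm{Hom}_{\mathcal{O}}(\Delta(x),T(y))$. Then $u_1=\bar g^{w_0}(st)$, $u_2=\bar g^{w_0}(ts)$, $u_3=\bar g^{st}(s)$, $u_4=\bar g^{st}(t)$, $u_5=\bar g^{ts}(s)$, $u_6=\bar g^{ts}(t)$, $u_7=\bar g^{s}(1)$, $u_8=\bar g^{t}(1)$. Compatible choice: the lifts are chosen so that, for $x\geq y$, $\bar g^x(y)$ is the composite of the chosen lifts along any chain of neighbors from $x$ to $y$ in the Bruhat graph. Duals: with $M\mapsto M^\vee$ the standard duality on $\mathcal{O}$ and chosen symmetric isomorphisms $\phi_w:T(w)\to T(w)^\vee$, the dual of $f:T(x)\to T(y)$ is $f^\dagger=\phi_x^{-1}\circ f^\vee\circ\phi_y:T(y)\to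 T(x)$. Products denote composition of maps. ''Generated subject to the relations'' means that the morphisms between the $T(w)$ are presented, as a $\mathbb{C}$-linear category with objects $T(w)$, $w\in W$, by these generators and relations; general morphisms in $\mathcal{T}(0)$ are obtained by taking direct sums. *)

(* Defs.v *)
From HB Require Import structures.
From mathcomp Require Import all_boot all_order all_algebra all_fingroup.
From mathcomp Require Import boolp functions.

Set Implicit Arguments.
Unset Strict Implicit.
Unset Printing Implicit Defensive.

Import GRing.Theory.
Local Open Scope ring_scope.

(** * Representations of sl_3 *)

Definition traceless (K : fieldType) : {pred 'M[K]_3} := fun X => \tr X == 0.

Fact traceless_submod_closed (K : fieldType) : submod_closed (@traceless K).
Proof.
split=> [|a X Y /eqP trX /eqP trY]; first by rewrite unfold_in mxtrace0.
by rewrite unfold_in mxtraceD mxtraceZ trX trY mulr0 addr0.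
Qed.

HB.instance Definition _ (K : fieldType) :=
  GRing.isSubmodClosed.Build K 'M[K]_3 (@traceless K)
    (@traceless_submod_closed K).

Record sl3 (K : fieldType) : Type :=
  Sl3 { sl3_mx :> 'M[K]_3; _ : sl3_mx \in @traceless K }.

HB.instance Definition _ (K : fieldType) := [isSub for @sl3_mx K].
HB.instance Definition _ (K : fieldType) := [Choice of sl3 K by <:].
HB.instance Definition _ (K : fieldType) :=
  [SubChoice_isSubLmodule of sl3 K by <:].

Fact lie_traceless (K : fieldType) (x y : sl3 K) :
  (x : 'M[K]_3) *m y - (y : 'M[K]_3) *m x \in @traceless K.
Proof. by rewrite unfold_in raddfB /= mxtrace_mulC subrr. Qed.

Definition lie (K : fieldType) (x y : sl3 K) : sl3 K := Sl3 (lie_traceless x y).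

Fact sl3_tr_traceless (K : fieldType) (x : sl3 K) :
  (x : 'M[K]_3)^T \in @traceless K.
Proof. by case: x => X trX; rewrite unfold_in mxtrace_tr. Qed.

(* The anti-involution of sl_3 used to define the duality on category O. *)
Definition sl3_tr (K : fieldType) (x : sl3 K) : sl3 K := Sl3 (sl3_tr_traceless x).

Record sl3_module (K : fieldType) : Type := Sl3Module {
  carrier :> lmodType K;
  act : sl3 K -> carrier -> carrier;
  act_linearl : forall v, linear (fun x => act x v);
  act_linearr : forall x, linear (act x);
  act_lie : forall x y v,
    act (lie x y) v = act x (act y v) - act y (act x v) }.

Definition is_hom (K : fieldType) (M N : sl3_module K) : {pred M -> N} :=
  fun f => `[< linear f /\ forall x v, f (act x v) = act x (f v) >].

Section ModuleTheory.

Variable K : fieldType.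
Implicit Types M N P A B : sl3_module K.

Lemma actD M (x : sl3 K) (u v : M) : act x (u + v) = act x u + act x v.
Proof. by have := act_linearr x 1 u v; rewrite !scale1r. Qed.

Lemma act0 M (x : sl3 K) : act x (0 : M) = 0.
Proof. by apply: (addrI (act x 0)); rewrite -actD !addr0. Qed.

Lemma actZ M (x : sl3 K) a (v : M) : act x (a *: v) = a *: act x v.
Proof. by have := act_linearr x a v 0; rewrite act0 !addr0. Qed.

Lemma actDl M (x y : sl3 K) (v : M) : act (x + y) v = act x v + act y v.
Proof. by have := act_linearl v 1 x y; rewrite !scale1r. Qed.

Lemma act0l M (v : M) : act (0 : sl3 K) v = 0.
Proof. by apply: (addrI (act 0 v)); rewrite -actDl !addr0. Qed.

Lemma actZl M a (x : sl3 K) (v : M) : act (a *: x) v = a *: act x v.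
Proof. by have := act_linearl v a x 0; rewrite act0l !addr0. Qed.

Fact is_hom_submod_closed M N : submod_closed (@is_hom K M N).
Proof.
split=> [|a f g /asboolP[lf ef] /asboolP[lg eg]]; apply/asboolP.
  split=> [b u v|x v]; first by rewrite /GRing.zero /= scaler0 addr0.
  by rewrite /GRing.zero /= act0.
split=> [b u v|x v]; last by rewrite !fctE ef eg actD actZ.
rewrite !fctE lf lg !scalerDr !scalerA [a * b]mulrC -!addrA; congr (_ + _).
by rewrite addrCA.
Qed.

End ModuleTheory.

HB.instance Definition _ (K : fieldType) (M N : sl3_module K) :=
  GRing.isSubmodClosed.Build K (M -> N) (@is_hom K M N)
    (@is_hom_submod_closed K M N).

(* Hom_{sl_3}(M, N); this is Hom_O(M, N) when M and N are in O. *)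
Record sl3_hom (K : fieldType) (M N : sl3_module K) : Type :=
  Sl3Hom { hom_fun :> M -> N; hom_proof : hom_fun \in @is_hom K M N }.

HB.instance Definition _ (K : fieldType) (M N : sl3_module K) :=
  [isSub for @hom_fun K M N].
HB.instance Definition _ (K : fieldType) (M N : sl3_module K) :=
  [Choice of sl3_hom M N by <:].
HB.instance Definition _ (K : fieldType) (M N : sl3_module K) :=
  [SubChoice_isSubLmodule of sl3_hom M N by <:].

Section Homs.

Variable K : fieldType.
Implicit Types M N P : sl3_module K.

Lemma hom_linear M N (f : sl3_hom M N) : linear f.
Proof. by have /asboolP[] := hom_proof f. Qed.

Lemma hom_act M N (f : sl3_hom M N) x v : f (act x v) = act x (f v).
Proof. by have /asboolP[] := hom_proof f. Qed.

Lemma hom0 M N (f : sl3_hom M N) : f 0 = 0.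
Proof.
by have := hom_linear f (-1) 0 0; rewrite !scaleN1r oppr0 addr0 addNr.
Qed.

Lemma homZ M N (f : sl3_hom M N) a v : f (a *: v) = a *: f v.
Proof. by have := hom_linear f a v 0; rewrite hom0 !addr0. Qed.

Fact idhom_proof M : (fun v : M => v) \in @is_hom K M M.
Proof. by apply/asboolP; split. Qed.

Definition idhom M : sl3_hom M M := Sl3Hom (idhom_proof M).

Fact hcomp_proof M N P (g : sl3_hom N P) (f : sl3_hom M N) :
  (fun v => g (f v)) \in @is_hom K M P.
Proof.
apply/asboolP; split=> [a u v|x v]; first by rewrite !hom_linear.
by rewrite !hom_act.
Qed.

Definition hcomp M N P (g : sl3_hom N P) (f : sl3_hom M N) : sl3_hom M P :=
  Sl3Hom (hcomp_proof g f).

Record sl3_iso M N : Type := Sl3Iso {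
  iso_hom : sl3_hom M N;
  iso_inv : sl3_hom N M;
  iso_homK : cancel iso_hom iso_inv;
  iso_invK : cancel iso_inv iso_hom }.

End Homs.

Notation "g \oh f" := (hcomp g f) (at level 40, left associativity).

(** * Weights and category O *)

(* A weight is given by a row lam, standing for the functional
   diag(h_0, h_1, h_2) |-> \sum_i lam_i h_i on traceless diagonal matrices;
   rows that differ by a constant row stand for the same weight.  The Borel
   subalgebra is that of upper triangular matrices. *)

Section CategoryO.

Variable K : fieldType.
Implicit Types (M N : sl3_module K) (lam mu : 'rV[K]_3).

Definition weight_eval lam (h : sl3 K) : K := \sum_i lam 0 i * h i i.

Definition weight_vector lam M (v : M) : Prop :=
  forall h : sl3 K, is_diag_mx h -> act h v = weight_eval lam h *: v.

Definition strictly_upper (x : sl3 K) : Prop :=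
  forall i j : 'I_3, (j <= i)%N -> x i j = 0.

Definition singular_vector lam M (v : M) : Prop :=
  weight_vector lam v /\ (forall x, strictly_upper x -> act x v = 0).

Definition submodule M (A : M -> Prop) : Prop :=
  [/\ A 0, forall a u v, A u -> A v -> A (a *: u + v) &
      forall x v, A v -> A (act x v)].

Definition in_span M n (b : 'I_n -> M) (v : M) : Prop :=
  exists c : 'I_n -> K, v = \sum_i c i *: b i.

Definition finitely_generated M : Prop :=
  exists s : seq M, forall A, submodule A ->
    (forall v, v \in s -> A v) -> forall v, A v.

Definition weight_module M : Prop :=
  forall v : M, exists n (b : 'I_n -> M),
    (forall i, exists lam, weight_vector lam (b i)) /\ v = \sum_i b i.

(* U(n^+) v is finite-dimensional for every v. *)
Definition locally_finite M : Prop :=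
  forall v : M, exists n (b : 'I_n -> M), in_span b v /\
    forall x, strictly_upper x -> forall i, in_span b (act x (b i)).

Definition in_O M : Prop :=
  [/\ finitely_generated M, weight_module M & locally_finite M].

(* M = U(g) \otimes_{U(b)} K_lam, through the universal property of the
   induced module: homomorphisms M -> N correspond to b-homomorphisms
   K_lam -> N, i.e. to singular vectors of weight lam in N. *)
Definition is_verma lam M : Prop :=
  exists2 v : M, singular_vector lam v &
    forall N (w : N), singular_vector lam w ->
      exists! f : sl3_hom M N, f v = w.

(** ** The duality M |-> M^\vee *)

Definition diag_part_mx (x : sl3 K) : 'M[K]_3 := diag_mx (\row_i x i i).

Fact diag_part_traceless (x : sl3 K) : diag_part_mx x \in @traceless K.
Proof.
have := valP x; rewrite !unfold_in /diag_part_mx mxtrace_diag.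
by under [X in _ -> is_true (X == _)]eq_bigr do rewrite mxE.
Qed.

Definition diag_part (x : sl3 K) : sl3 K := Sl3 (diag_part_traceless x).

Fact root_elt_traceless (i j : 'I_3) :
  (if i == j then 0 else delta_mx i j) \in @traceless K.
Proof.
rewrite unfold_in; case: (eqVneq i j) => [_|nij]; first by rewrite mxtrace0.
by rewrite /mxtrace big1 // => k _; rewrite mxE; case: eqP => //= ->;
  rewrite (negPf nij).
Qed.

Definition root_elt (i j : 'I_3) : sl3 K := Sl3 (root_elt_traceless i j).
Definition sl3_root (i j : 'I_3) : 'rV[K]_3 := delta_mx 0 i - delta_mx 0 j.

(* Linear functionals on M that vanish on all but finitely many weight
   spaces; for M in O these form the direct sum of the (M_lam)^*. *)
Definition is_dual M : {pred M -> K^o} := fun f =>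
  `[< linear f /\ exists s : seq 'rV[K]_3, forall lam (v : M),
        weight_vector lam v -> f v != 0 ->
        exists2 mu, mu \in s & weight_vector mu v >].

Fact is_dual_submod_closed M : submod_closed (@is_dual M).
Proof.
split=> [|a f g /asboolP[lf [s hs]] /asboolP[lg [s' hs']]]; apply/asboolP.
  split=> [b u v|]; first by rewrite /GRing.zero /= scaler0 addr0.
  by exists [::] => lam v _; rewrite /GRing.zero /= eqxx.
split=> [b u v|].
  rewrite !fctE lf lg !scalerDr !scalerA [a * b]mulrC -!addrA; congr (_ + _).
  by rewrite addrCA.
exists (s ++ s') => lam v wv; rewrite !fctE => nz.
have [fz|fnz] := eqVneq (f v) 0.
  have gnz : g v != 0 by move: nz; rewrite fz scaler0 add0r.
  by have [mu mus wmu] := hs' _ _ wv gnz; exists mu; rewrite ?mem_cat ?mus ?orbT.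
by have [mu mus wmu] := hs _ _ wv fnz; exists mu; rewrite ?mem_cat ?mus.
Qed.

Lemma sl3_mx_sum (I : Type) (r : seq I) (p : pred I) (F : I -> sl3 K) :
  sl3_mx (\sum_(i <- r | p i) F i) = \sum_(i <- r | p i) sl3_mx (F i).
Proof. by apply: (@big_morph _ _ (@sl3_mx K) 0 +%R 0 +%R). Qed.

Lemma sl3_decomp (x : sl3 K) :
  x = diag_part x + \sum_i \sum_(j | j != i) (x i j : K) *: root_elt i j.
Proof.
apply: val_inj => /=; rewrite sl3_mx_sum; apply/matrixP => k l.
rewrite mxE mxE summxE.
under eq_bigr => i _ do rewrite sl3_mx_sum summxE.
have E i j : (x i j *: root_elt i j : sl3 K) k l =
    if (i != j) && (k == i) && (l == j) then x i j else 0.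
  rewrite /= mxE; case: (eqVneq i j) => [_|_]; first by rewrite mxE mulr0.
  by rewrite mxE /=; case: (_ && _); rewrite ?mulr1 ?mulr0.
under eq_bigr => i _ do under eq_bigr => j _ do rewrite E.
rewrite (bigD1 k) //= [X in _ + (_ + X)]big1 ?addr0 => [|i nik]; last first.
  by apply: big1 => j _; rewrite eq_sym in nik; rewrite (negPf nik) andbF.
have [<-|nkl] := eqVneq k l.
  rewrite mulr1n mxE big1 ?addr0 // => j njk.
  by rewrite (eq_sym k j) (negPf njk) andbF.
rewrite mulr0n add0r (bigD1 l) /=; last by rewrite eq_sym.
rewrite nkl !eqxx /= big1 ?addr0 //.
by move=> j /andP[_ njl]; rewrite (eq_sym l j) (negPf njl) andbF.
Qed.

Lemma diag_part_diag (x : sl3 K) : is_diag_mx (diag_part x).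
Proof. exact: diag_mx_is_diag. Qed.

Lemma lie_root_elt (h : sl3 K) i j : is_diag_mx h ->
  lie h (root_elt i j) = (h i i - h j j) *: root_elt i j.
Proof.
move=> /is_diag_mxP hd; apply: val_inj; rewrite [RHS]linearZ /=.
have [_|nij] := eqVneq i j; first by rewrite mulmx0 mul0mx subrr scaler0.
apply/matrixP => k l; rewrite !mxE.
rewrite (bigD1 k) //= big1 ?addr0 => [|m nmk]; last first.
  by rewrite hd ?mul0r // eq_sym.
rewrite (bigD1 l) //= big1 ?addr0 => [|m nml]; last by rewrite hd ?mulr0.
rewrite mxE; case: (eqVneq k i) => [->|_]; case: (eqVneq l j) => [->|_] /=;
by rewrite ?mulr1 ?mul1r ?mulr0 ?mul0r ?subrr.
Qed.

Lemma weight_evalD lam mu h :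
  weight_eval (lam + mu) h = weight_eval lam h + weight_eval mu h.
Proof. by rewrite -big_split; apply: eq_bigr => i _; rewrite mxE mulrDl. Qed.

Lemma weight_evalN lam h : weight_eval (- lam) h = - weight_eval lam h.
Proof. by rewrite -sumrN; apply: eq_bigr => i _; rewrite mxE mulNr. Qed.

Lemma weight_eval_root i j h : weight_eval (sl3_root i j) h = h i i - h j j.
Proof.
rewrite weight_evalD weight_evalN /weight_eval.
by rewrite (bigD1 i) //= (bigD1 (F := fun k => delta_mx 0 j 0 k * h k k) j) //=
  !big1 ?mxE ?eqxx ?addr0 ?mul1r // => k nk; rewrite mxE (negPf nk) mul0r.
Qed.

Lemma weight_root_elt lam M (v : M) i j : weight_vector lam v ->
  weight_vector (lam + sl3_root i j) (act (root_elt i j) v).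
Proof.
move=> wv h hd; have := act_lie h (root_elt i j) v.
rewrite lie_root_elt // actZl (wv h hd) actZ => /eqP; rewrite eq_sym subr_eq => /eqP->.
by rewrite weight_evalD weight_eval_root [RHS]scalerDl [RHS]addrC.
Qed.

Lemma weight_unique lam mu M (v : M) : v != 0 ->
  weight_vector lam v -> weight_vector mu v ->
  forall h : sl3 K, is_diag_mx h -> weight_eval lam h = weight_eval mu h.
Proof.
move=> nz wl wm h hd; apply/eqP; rewrite -subr_eq0.
have := wl h hd; rewrite (wm h hd) => /eqP; rewrite eq_sym -subr_eq0 -scalerBl.
by rewrite scaler_eq0 (negPf nz) orbF.
Qed.

Section LinearFunctionals.

Variables (M : sl3_module K) (f : M -> K^o) (lf : linear f).

Lemma functD u v : f (u + v) = f u + f v.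
Proof. by have := lf 1 u v; rewrite !scale1r. Qed.

Lemma funct0 : f 0 = 0.
Proof. by apply: (addrI (f 0)); rewrite -functD !addr0. Qed.

Lemma functZ a v : f (a *: v) = a * f v.
Proof. by have := lf a v 0; rewrite funct0 !addr0. Qed.

Lemma funct_sum (I : Type) (r : seq I) (p : pred I) (F : I -> M) :
  f (\sum_(i <- r | p i) F i) = \sum_(i <- r | p i) f (F i).
Proof. by apply: (big_morph f functD funct0). Qed.

End LinearFunctionals.

Lemma act_suml M (I : Type) (r : seq I) (p : pred I) (F : I -> sl3 K) (v : M) :
  act (\sum_(i <- r | p i) F i) v = \sum_(i <- r | p i) act (F i) v.
Proof. by apply: (big_morph (fun x => act x v)) => [x y|]; rewrite ?actDl ?act0l. Qed.

Fact dual_act_proof M (x : sl3 K) (f : M -> K^o) :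
  f \in @is_dual M -> (fun v => f (act (sl3_tr x) v)) \in @is_dual M.
Proof.
move=> /asboolP[lf [s hs]]; apply/asboolP.
split=> [a u v|]; first by rewrite actD actZ lf.
exists (s ++ [seq mu - sl3_root p.1 p.2 | mu <- s, p <- enum {: 'I_3 * 'I_3}]) => lam v wv nz.
set y := sl3_tr x in nz.
have [fv0|fvn0] := eqVneq (f v) 0; last first.
  by have [mu mus wmu] := hs _ _ wv fvn0; exists mu; rewrite ?mem_cat ?mus.
suff /existsP[[i j] /= fE] : [exists p : 'I_3 * 'I_3, f (act (root_elt p.1 p.2) v) != 0].
  have [mu mus wmu] := hs _ _ (weight_root_elt i j wv) fE.
  exists (mu - sl3_root i j).
    by rewrite mem_cat; apply/orP; right; apply/allpairsP; exists (mu, (i, j));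
      split; rewrite ?mem_enum.
  have Enz : act (root_elt i j) v != 0.
    by apply: contra fE => /eqP->; rewrite funct0.
  move=> h hd; rewrite (wv h hd); congr (_ *: _).
  rewrite weight_evalD weight_evalN.
  by rewrite -(weight_unique Enz (weight_root_elt i j wv) wmu) // weight_evalD addrK.
apply: contraNT nz; rewrite negb_exists => /forallP fE0; apply/eqP.
rewrite [y]sl3_decomp actDl functD // wv ?functZ ?fv0 ?mulr0 ?add0r //; last first.
  exact: diag_part_diag.
rewrite act_suml funct_sum // big1 // => i _; rewrite act_suml funct_sum //.
rewrite big1 // => j _; rewrite actZl functZ //.
by have := fE0 (i, j); rewrite negbK => /eqP->; rewrite mulr0.
Qed.

End CategoryO.

Record dual_space (K : fieldType) (M : sl3_module K) : Type :=
  DualSpace { dual_fun :> M -> K^o; dual_proof : dual_fun \in @is_dual K M }.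

HB.instance Definition _ (K : fieldType) (M : sl3_module K) :=
  GRing.isSubmodClosed.Build K (M -> K^o) (@is_dual K M)
    (@is_dual_submod_closed K M).
HB.instance Definition _ (K : fieldType) (M : sl3_module K) :=
  [isSub for @dual_fun K M].
HB.instance Definition _ (K : fieldType) (M : sl3_module K) :=
  [Choice of dual_space M by <:].
HB.instance Definition _ (K : fieldType) (M : sl3_module K) :=
  [SubChoice_isSubLmodule of dual_space M by <:].

Section Duality.

Variable K : fieldType.
Implicit Types M N : sl3_module K.

Lemma dual_linear M (xi : dual_space M) : linear xi.
Proof. by have /asboolP[] := dual_proof xi. Qed.

Definition dual_act M (x : sl3 K) (xi : dual_space M) : dual_space M :=
  DualSpace (dual_act_proof x (dual_proof xi)).

Fact dual_act_linearl M (xi : dual_space M) : linear (fun x => dual_act x xi).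
Proof.
move=> a x y; apply: val_inj; apply/funext => v.
have trE : sl3_tr (a *: x + y) = a *: sl3_tr x + sl3_tr y.
  by apply: val_inj; rewrite /= linearP.
by rewrite /= trE actDl actZl dual_linear.
Qed.

Fact dual_act_linearr M x : linear (@dual_act M x).
Proof. by move=> a xi eta; apply: val_inj. Qed.

Fact dual_act_lie M x y (xi : dual_space M) :
  dual_act (lie x y) xi =
  dual_act x (dual_act y xi) - dual_act y (dual_act x xi).
Proof.
apply: val_inj; apply/funext => v.
have trE : sl3_tr (lie x y) = lie (sl3_tr y) (sl3_tr x).
  by apply: val_inj; rewrite /= raddfB /= !trmx_mul.
rewrite /= trE act_lie (functD (dual_linear xi)) -scaleN1r.
by rewrite (functZ (dual_linear xi)) mulN1r.
Qed.

Definition dual_module M : sl3_module K :=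
  Sl3Module (@dual_act_linearl M) (@dual_act_linearr M) (@dual_act_lie M).

Fact dual_hom_fun_proof M N (f : sl3_hom M N) (xi : dual_space N) :
  (fun v => xi (f v)) \in @is_dual K M.
Proof.
have /asboolP[lxi [s hs]] := dual_proof xi.
apply/asboolP; split=> [a u v|]; first by rewrite hom_linear lxi.
exists s => lam v wv nz.
have wf : weight_vector lam (f v).
  by move=> h hd; rewrite -hom_act (wv h hd) homZ.
have [mu mus wmu] := hs _ _ wf nz; exists mu => // h hd.
rewrite (wv h hd) (weight_unique _ wf wmu) //.
by apply: contra nz => /eqP->; rewrite funct0.
Qed.

Definition dual_hom_fun M N (f : sl3_hom M N) (xi : dual_module N) :
  dual_module M := DualSpace (dual_hom_fun_proof f xi).

Fact dual_hom_proof M N (f : sl3_hom M N) :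
  dual_hom_fun f \in @is_hom K (dual_module N) (dual_module M).
Proof.
apply/asboolP; split=> [a xi eta|x xi]; apply: val_inj => //=.
by apply/funext => v; rewrite hom_act.
Qed.

Definition dual_hom M N (f : sl3_hom M N) :
  sl3_hom (dual_module N) (dual_module M) := Sl3Hom (dual_hom_proof f).

(* phi agrees with its dual under the identification M = M^\vee^\vee. *)
Definition symmetric_iso M (phi : sl3_iso M (dual_module M)) : Prop :=
  forall v w : M,
    (iso_hom phi v : dual_space M) w = (iso_hom phi w : dual_space M) v.

Definition dagger M N (phiM : sl3_iso M (dual_module M))
    (phiN : sl3_iso N (dual_module N)) (f : sl3_hom M N) : sl3_hom N M :=
  iso_inv phiM \oh dual_hom f \oh iso_hom phiN.

(** ** Tilting modules *)

Definition is_dual_verma lam M : Prop :=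
  exists V, is_verma lam V /\ inhabited (sl3_iso M (dual_module V)).

Inductive has_flag (P : sl3_module K -> Prop) : sl3_module K -> Prop :=
| flag0 M : (forall v : M, v = 0) -> has_flag P M
| flagS A M B (i : sl3_hom A M) (p : sl3_hom M B) :
    injective i -> (forall b, exists v, p v = b) ->
    (forall v, p v = 0 <-> exists a, i a = v) ->
    has_flag P A -> P B -> has_flag P M.

Definition tilting M : Prop :=
  [/\ in_O M, has_flag (fun N => exists lam, is_verma lam N) M &
      has_flag (fun N => exists lam, is_dual_verma lam N) M].

Definition indecomposable M : Prop :=
  (exists v : M, v != 0) /\
  forall A B : M -> Prop, submodule A -> submodule B ->
    (forall v, A v -> B v -> v = 0) ->
    (forall v, exists a b, [/\ A a, B b & v = a + b]) ->
    (forall v, A v -> v = 0) \/ (forall v, B v -> v = 0).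

(* lam is a weight of M, and every weight of M lies in lam - N alpha - N beta
   for the simple roots alpha, beta. *)
Definition has_highest_weight (lam : 'rV[K]_3) M : Prop :=
  (exists2 v : M, v != 0 & weight_vector lam v) /\
  forall mu (v : M), v != 0 -> weight_vector mu v -> exists m n : nat,
    weight_vector (lam - sl3_root K 0 1 *+ m - sl3_root K 1 2 *+ n) v.

Definition indecomposable_tilting (lam : 'rV[K]_3) M : Prop :=
  [/\ tilting M, indecomposable M & has_highest_weight lam M].

End Duality.

(** * The Weyl group *)

(* W acts on weights on the left by (w lam)_i = lam_(w i); with the product
   (v * w) i = w (v i) of 'S_3, v * w acts as v after w. *)

Notation W := 'S_3.
Definition rs : W := tperm 0 1.
Definition rt : W := tperm 1 2.
Definition wst : W := (rs * rt)%g.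
Definition wts : W := (rt * rs)%g.
Definition w0 : W := (rs * rt * rs)%g.
Definition w1 : W := 1%g.

Section DotAction.

Variable K : fieldType.

Definition weyl_act (w : W) (lam : 'rV[K]_3) : 'rV[K]_3 :=
  \row_i lam 0 (w i).

Definition rho : 'rV[K]_3 := \row_i (1 - (i : nat)%:R).

Definition dot (w : W) (lam : 'rV[K]_3) : 'rV[K]_3 :=
  weyl_act w (lam + rho) - rho.

End DotAction.

Definition weyl_length (w : W) : nat :=
  #|[set p : 'I_3 * 'I_3 | (p.1 < p.2)%N && (w p.2 < w p.1)%N]|.

(* The edges of the Bruhat graph, oriented downwards. *)
Definition bruhat_down : rel W := fun x y =>
  [exists p : 'I_3 * 'I_3, (p.1 != p.2) && (y == x * tperm p.1 p.2)%g]
  && (weyl_length y < weyl_length x)%N.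

Definition bruhat_ge (x y : W) : bool := connect bruhat_down x y.

(** * Presentations of linear categories *)

Section Presentation.

Variables (K : fieldType) (I : Type) (gen : I -> I -> Type).

(* Formal K-linear combinations of formal compositions of generators. *)
Inductive term : I -> I -> Type :=
| Id x : term x x
| Gen x y : gen x y -> term x y
| Comp x y z : term y z -> term x y -> term x z
| Zero x y : term x y
| Add x y : term x y -> term x y -> term x y
| Scale x y : K -> term x y -> term x y.

(* The congruence of K-linear categories generated by the relations rel:
   terms modulo this congruence are the morphisms of the K-linear category
   presented by gen and rel. *)
Inductive term_eq (rel : forall x y, term x y -> term x y -> Prop) :
    forall x y, term x y -> term x y -> Prop :=
| te_rel x y (p q : term x y) : rel x y p q -> term_eq rel p q
| te_refl x y (p : term x y) : term_eq rel p p
| te_sym x y (p q : term x y) : term_eq rel p q -> term_eq rel q p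
| te_trans x y (p q r : term x y) :
    term_eq rel p q -> term_eq rel q r -> term_eq rel p r
| te_comp x y z (p p' : term y z) (q q' : term x y) :
    term_eq rel p p' -> term_eq rel q q' -> term_eq rel (Comp p q) (Comp p' q')
| te_add x y (p p' q q' : term x y) :
    term_eq rel p p' -> term_eq rel q q' -> term_eq rel (Add p q) (Add p' q')
| te_scale x y a (p p' : term x y) :
    term_eq rel p p' -> term_eq rel (Scale a p) (Scale a p')
| te_idl x y (p : term x y) : term_eq rel (Comp (Id y) p) p
| te_idr x y (p : term x y) : term_eq rel (Comp p (Id x)) p
| te_compA x y z t (p : term z t) (q : term y z) (r : term x y) :
    term_eq rel (Comp p (Comp q r)) (Comp (Comp p q) r)
| te_addA x y (p q r : term x y) :
    term_eq rel (Add p (Add q r)) (Add (Add p q) r)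
| te_addC x y (p q : term x y) : term_eq rel (Add p q) (Add q p)
| te_add0 x y (p : term x y) : term_eq rel (Add (Zero x y) p) p
| te_scale0 x y (p : term x y) : term_eq rel (Scale 0 p) (Zero x y)
| te_scale1 x y (p : term x y) : term_eq rel (Scale 1 p) p
| te_scaleA x y a b (p : term x y) :
    term_eq rel (Scale a (Scale b p)) (Scale (a * b) p)
| te_scaleDl x y a b (p : term x y) :
    term_eq rel (Scale (a + b) p) (Add (Scale a p) (Scale b p))
| te_scaleDr x y a (p q : term x y) :
    term_eq rel (Scale a (Add p q)) (Add (Scale a p) (Scale a q))
| te_compDl x y z (p p' : term y z) (q : term x y) :
    term_eq rel (Comp (Add p p') q) (Add (Comp p q) (Comp p' q))
| te_compDr x y z (p : term y z) (q q' : term x y) :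
    term_eq rel (Comp p (Add q q')) (Add (Comp p q) (Comp p q'))
| te_compZl x y z a (p : term y z) (q : term x y) :
    term_eq rel (Comp (Scale a p) q) (Scale a (Comp p q))
| te_compZr x y z a (p : term y z) (q : term x y) :
    term_eq rel (Comp p (Scale a q)) (Scale a (Comp p q)).

Variable (T : I -> sl3_module K).

Fixpoint eval (ev : forall x y, gen x y -> sl3_hom (T x) (T y))
    x y (p : term x y) : sl3_hom (T x) (T y) :=
  match p with
  | Id x => idhom (T x)
  | Gen _ _ g => ev _ _ g
  | Comp _ _ _ p q => eval ev p \oh eval ev q
  | Zero _ _ => 0
  | Add _ _ p q => eval ev p + eval ev q
  | Scale _ _ a p => a *: eval ev p
  end.

(* The full subcategory on the modules T x is generated by the images of the
   generators, subject to the relations rel. *)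
Definition presented_by (ev : forall x y, gen x y -> sl3_hom (T x) (T y))
    (rel : forall x y, term x y -> term x y -> Prop) : Prop :=
  (forall x y (f : sl3_hom (T x) (T y)), exists p : term x y, eval ev p = f) /\
  (forall x y (p q : term x y), eval ev p = eval ev q <-> term_eq rel p q).

End Presentation.

Arguments Id {K I gen} x.
Arguments Zero {K I gen x y}.
Arguments Gen {K I gen x y} _.

(** * The quiver with relations *)

Inductive up : W -> W -> Type :=
| up1 : up w0 wst
| up2 : up w0 wts
| up3 : up wst rs
| up4 : up wst rt
| up5 : up wts rs
| up6 : up wts rt
| up7 : up rs w1
| up8 : up rt w1.

Inductive arrow (x y : W) : Type :=
| Up of up x y
| Down of up y x.

Section Relations.

Variables (K : fieldType) (a b r : K).

Local Notation tm := (term K arrow).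
Local Notation u i := (Gen (Up i)).
Local Notation d i := (Gen (Down i)).
Local Notation "p * q" := (Comp p q).
Local Notation "p + q" := (Add p q).
Local Notation "c *: p" := (Scale c p).
Reserved Notation "p =~ q" (at level 70, no associativity).

Inductive relation : forall x y : W, tm x y -> tm x y -> Prop :=
| rel_1a : u up3 * u up1 =~ u up5 * u up2
| rel_1b : u up4 * u up1 =~ u up6 * u up2
| rel_1c : u up7 * u up3 =~ u up8 * u up4
| rel_1d : u up8 * u up6 =~ u up7 * u up5
| rel_2a : d up1 * d up3 =~ d up2 * d up5
| rel_2b : d up1 * d up4 =~ d up2 * d up6
| rel_2c : d up3 * d up7 =~ d up4 * d up8
| rel_2d : d up6 * d up8 =~ d up5 * d up7
| rel_3a : d up1 * u up1 =~ Zero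
| rel_3b : d up2 * u up2 =~ Zero
| rel_3c : d up4 * u up4 =~ Zero
| rel_3d : d up5 * u up5 =~ Zero
| rel_4a : d up3 * u up3 =~ a *: (u up1 * d up1)
| rel_4b : d up6 * u up6 =~ a *: (u up2 * d up2)
| rel_4c : d up6 * u up4 =~ - a *: (u up2 * d up1)
| rel_4d : d up3 * u up5 =~ - a *: (u up1 * d up2)
| rel_4e : d up4 * u up6 =~ - a *: (u up1 * d up2)
| rel_4f : d up5 * u up3 =~ - a *: (u up2 * d up1)
| rel_5a : d up7 * u up7 =~ b *: (u up5 * d up5)
| rel_5b : d up8 * u up8 =~ b *: (u up4 * d up4)
| rel_5c : d up8 * u up7 =~
    b *: (u up4 * d up3) + b *: (u up6 * d up5)
    + r *: (u up6 * u up2 * d up1 * d up3)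
| rel_5d : d up7 * u up8 =~
    b *: (u up3 * d up4) + b *: (u up5 * d up6)
    + r *: (u up3 * u up1 * d up2 * d up6)
where "p =~ q" := (relation p q).

End Relations.

(** * Compatible lifts *)

Section Lifts.

Variables (K : fieldType) (Delta T : W -> sl3_module K).
Variable (iota : forall w, sl3_hom (Delta w) (T w)).
Variable (g : forall x y, sl3_hom (T x) (T y)).

(* f extends along iota the nonzero element of Hom(Delta(x), T(y)), which is
   unique up to scalar. *)
Definition is_lift x y (f : sl3_hom (T x) (T y)) : Prop :=
  f \oh iota x != 0 /\
  forall h : sl3_hom (Delta x) (T y), exists c, h = c *: (f \oh iota x).

(* h is the composite of the maps g along a descending chain of neighbours. *)
Inductive chain_composite (x : W) : forall y, sl3_hom (T x) (T y) -> Prop :=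
| chain_nil : chain_composite (idhom (T x))
| chain_cons y z (h : sl3_hom (T x) (T y)) : chain_composite h ->
    bruhat_down y z -> chain_composite (g y z \oh h).

(* Only the values g x y with x >= y matter. *)
Definition compatible_lifts : Prop :=
  (forall x y, bruhat_ge x y -> is_lift (g x y)) /\
  (forall x y (h : sl3_hom (T x) (T y)), chain_composite h -> g x y = h).

(* u_i is the lift g x y and d_i is its dual. *)
Definition arrow_map (phi : forall w, sl3_iso (T w) (dual_module (T w)))
    x y (m : arrow x y) : sl3_hom (T x) (T y) :=
  match m with
  | Up _ => g x y
  | Down _ => dagger (phi y) (phi x) (g y x)
  end.

End Lifts.

(* Main.v *)
From HB Require Import structures.
From Pilot Require Import Defs.
From mathcomp Require Import all_boot all_order all_algebra all_fingroup.
From mathcomp Require Import boolp functions.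
From mathcomp Require Import reals complex.
From mathcomp Require Import ring zify.
From mathcomp Require ssrcomplements mpoly.
Import (canonicals, coercions) mpoly.
Import Pilot.Defs.

Set Implicit Arguments.
Unset Strict Implicit.
Unset Printing Implicit Defensive.

Import Order.TTheory GRing.Theory Num.Theory.
Local Open Scope ring_scope.

(** * Linear identities in modules *)

(** Everything is transported into one explicit module, [big], a model of the antidominant
    projective, that is, of [T(1)]. Over U(n^-) it is free on six generators [vgen], of weights w.0.
    Its endomorphism algebra is Soergel's coinvariant algebra, generated by commuting X and Y with
    X^2 = XY - Y^2 and Y^3 = 0. To each w belongs a monomial c_w in X and Y ([chom]), and [T(w)]
    turns out to be the quotient of [big] by the kernel of c_w, hence isomorphic to c_w [big]. If y
    <= x then c_x is a multiple of c_y, by a factor [gam]. The map [T(x) -> T(y)] is the inclusion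
    of c_x [big] in c_y [big], and its dual is multiplication by that factor. Compatibility of the
    lifts is then transitivity of inclusion, and the relations become identities in the coinvariant
    algebra, which hold with a = -1, b = 1, r = 0 ([relation_sound]).

    The passage from the abstract [T(w)] to [big] rests on three facts. A dual Verma flag makes
    H^1(n^+, T) vanish ([acyclic_flag]), so that a singular vector of weight w.0 extends to a
    homomorphism from [big] ([singular_hom]). The isomorphism [phi w] is a nondegenerate symmetric
    contravariant form on [T(w)]. The form pulled back from [T(1)] to [big], called B, is
    nondegenerate, because its radical would otherwise meet the simple antidominant Verma module
    ([big_nondegenerate]); every contravariant form on [big] is then B(c p, q) with c in the
    coinvariant algebra ([forms_span]). For the form pulled back from [T(w)], c is c_w times a unit,
    and dividing by a square root of the unit turns c into c_w ([form_normal]). The image of [big]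
    in [T(w)] has an orthogonal complement, so indecomposability gives surjectivity
    ([tilting_quotient]). This normalisation is what makes the dual of an inclusion exactly the
    multiplication map ([up_down_adjoint]).

    For completeness of the relations, [Hom(T(x), T(y))] has a basis indexed by the z above both x
    and y ([hom_span], [hom_free]). The relations alone rewrite every word as a combination of paths
    that go by d's to such a z and then by u's to y ([spanned_all]). A spanning family that
    evaluates to a basis gives a presentation ([presentation_criterion]). *)

Section LinearExpressions.

Variables (K : fieldType) (V : lmodType K).

Inductive lexp :=
| LVar of nat
| LZero
| LAdd of lexp & lexp
| LOpp of lexp
| LScale of K & lexp
| LMuln of lexp & nat.

Fixpoint ldenote (env : seq V) (e : lexp) : V :=
  match e with
  | LVar i => nth 0 env i
  | LZero => 0
  | LAdd a b => ldenote env a + ldenote env b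
  | LOpp a => - ldenote env a
  | LScale c a => c *: ldenote env a
  | LMuln a n => ldenote env a *+ n
  end.

Fixpoint lcoef (e : lexp) (i : nat) : K :=
  match e with
  | LVar j => if eqn i j then 1 else 0
  | LZero => 0
  | LAdd a b => lcoef a i + lcoef b i
  | LOpp a => - lcoef a i
  | LScale c a => c * lcoef a i
  | LMuln a n => lcoef a i *+ n
  end.

Fixpoint lcoef_eq (e e' : lexp) (n : nat) : Prop :=
  if n is m.+1 then lcoef e m = lcoef e' m /\ lcoef_eq e e' m else True.

Lemma ldenoteE env e :
  ldenote env e = \sum_(i < size env) lcoef e i *: nth 0 env i.
Proof.
elim: e => /= [j||a IHa b IHb|a IHa|c a IHa|a IHa n].
- have [ltj|gej] := ltnP j (size env); last first.
    rewrite nth_default // big1 // => i _.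
    case: (@eqnP i j) => [eij|_]; last by rewrite scale0r.
    by rewrite -eij leqNgt ltn_ord in gej.
  rewrite (bigD1 (Ordinal ltj)) //= -[eqn _ _]/(_ == _) eqxx scale1r big1 ?addr0 // => i nij.
  case: (@eqnP i j) => [eij|]; last by rewrite scale0r.
  by case/eqP: nij; apply: val_inj.
- by rewrite big1 // => i _; rewrite scale0r.
- by rewrite IHa IHb -big_split; apply: eq_bigr => i _; rewrite scalerDl.
- by rewrite IHa -sumrN; apply: eq_bigr => i _; rewrite scaleNr.
- by rewrite IHa scaler_sumr; apply: eq_bigr => i _; rewrite scalerA.
- by rewrite IHa -sumrMnl; apply: eq_bigr => i _; rewrite scalerMnl.
Qed.

(** The atoms in [env] are treated as independent, so comparing coefficients is sufficient.
    [lcoef_eq] computes to a conjunction of identities in [K], one for each atom, which are left to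
    [ring]. *)
Lemma lcoef_eqP env e e' :
  lcoef_eq e e' (size env) -> ldenote env e = ldenote env e'.
Proof.
move=> eq_ee'; rewrite !ldenoteE; apply: eq_bigr => i _; congr (_ *: _).
have [i' ltin ->] : exists2 i', (i' < size env)%N & nat_of_ord i = i'.
  by exists i.
elim: (size env) eq_ee' ltin => // n IHn /= [eqn eqs].
by rewrite ltnS leq_eqVlt => /predU1P[->|/(IHn eqs)].
Qed.

End LinearExpressions.

Ltac lmod_index a env :=
  lazymatch env with
  | a :: _ => constr:(O)
  | _ :: ?env' => let n := lmod_index a env' in constr:(S n)
  end.

Ltac lmod_mem a env :=
  lazymatch env with
  | a :: _ => constr:(true)
  | _ :: ?env' => lmod_mem a env'
  | _ => constr:(false)
  end.

Ltac lmod_atoms env t :=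
  lazymatch t with
  | (?a + ?b)%R => let env := lmod_atoms env a in lmod_atoms env b
  | (- ?a)%R => lmod_atoms env a
  | (_ *: ?a)%R => lmod_atoms env a
  | (?a *+ _)%R => lmod_atoms env a
  | 0%R => env
  | _ => lazymatch lmod_mem t env with
         | true => env
         | false => constr:(t :: env)
         end
  end.

Ltac lmod_reify env t :=
  lazymatch t with
  | (?a + ?b)%R => let a := lmod_reify env a in
                   let b := lmod_reify env b in open_constr:(LAdd a b)
  | (- ?a)%R => let a := lmod_reify env a in open_constr:(LOpp a)
  | (?c *: ?a)%R => let a := lmod_reify env a in open_constr:(LScale c a)
  | (?a *+ ?n)%R => let a := lmod_reify env a in open_constr:(LMuln a n)
  | 0%R => open_constr:(LZero _)
  | _ => let n := lmod_index t env in open_constr:(LVar _ n)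
  end.

Ltac lmod :=
  lazymatch goal with
  | |- @eq ?T ?s ?t =>
    let env := lmod_atoms (@nil T) s in
    let env := lmod_atoms env t in
    let s' := lmod_reify env s in
    let t' := lmod_reify env t in
    refine (@lcoef_eqP _ _ env s' t' _);
    lazy [lcoef lcoef_eq size eqn]; repeat split; try ring
  end.

Example lmod_test (K : fieldType) (V : lmodType K) (c d : K) (u v w : V) :
  c *: (u + v) - d *: (w *+ 2) = - (d *: w) + c *: u - d *: w + c *: v.
Proof. lmod. Qed.
Example lmod_test2 (K : fieldType) (V : sl3_module K) (c d : K) (u v w : V) :
  c *: (u + v) - d *: (w *+ 2) +0= - (d *: w) + c *: u - d *: w + c *: v.
Proof. lmod. Qed.

(** * Modules from Chevalley generators *)

HB.lock Definition brk (V : zmodType) (f g : V -> V) (v : V) : V := f (g v) - g (f v).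

Fact brk_linear (K : fieldType) (V : lmodType K) (f g : {linear V -> V}) :
  linear (brk f g).
Proof. by move=> c u v; rewrite brk.unlock !linearP /=; lmod. Qed.

HB.instance Definition _ (K : fieldType) (V : lmodType K)
    (f g : {linear V -> V}) :=
  GRing.isLinear.Build K V V *:%R (brk f g) (brk_linear f g).

Record chevalley (K : fieldType) (V : lmodType K)
    (e1 e2 f1 f2 h1 h2 : V -> V) : Prop := Chevalley {
  ch_h1h2 : forall v, h1 (h2 v) = h2 (h1 v);
  ch_h1e1 : forall v, h1 (e1 v) = e1 (h1 v) + 2%:R *: e1 v;
  ch_h1e2 : forall v, h1 (e2 v) = e2 (h1 v) - e2 v;
  ch_h2e1 : forall v, h2 (e1 v) = e1 (h2 v) - e1 v;
  ch_h2e2 : forall v, h2 (e2 v) = e2 (h2 v) + 2%:R *: e2 v;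
  ch_h1f1 : forall v, h1 (f1 v) = f1 (h1 v) - 2%:R *: f1 v;
  ch_h1f2 : forall v, h1 (f2 v) = f2 (h1 v) + f2 v;
  ch_h2f1 : forall v, h2 (f1 v) = f1 (h2 v) + f1 v;
  ch_h2f2 : forall v, h2 (f2 v) = f2 (h2 v) - 2%:R *: f2 v;
  ch_e1f1 : forall v, e1 (f1 v) = f1 (e1 v) + h1 v;
  ch_e1f2 : forall v, e1 (f2 v) = f2 (e1 v);
  ch_e2f1 : forall v, e2 (f1 v) = f1 (e2 v);
  ch_e2f2 : forall v, e2 (f2 v) = f2 (e2 v) + h2 v }.

Definition serre (K : fieldType) (V : lmodType K) (e1 e2 : V -> V) (v : V) : V :=
  e1 (e1 (e2 v)) - 2%:R *: e1 (e2 (e1 v)) + e2 (e1 (e1 v)).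

Lemma sl3_22 (K : fieldType) (x : sl3 K) : x 2%:R 2%:R = - x 0 0 - x 1 1.
Proof.
have := valP x; rewrite unfold_in /mxtrace !big_ord_recl big_ord0 addr0 => /eqP.
have -> : ord0 = 0 :> 'I_3 by [].
have -> : lift ord0 ord0 = 1 :> 'I_3 by apply: val_inj.
have -> : lift ord0 (lift ord0 ord0) = 2%:R :> 'I_3 by apply: val_inj.
by move/eqP; rewrite addrA addr_eq0 => /eqP/esym; rewrite -opprD => <-; rewrite opprK.
Qed.

Lemma sum_I3 (A : nmodType) (F : 'I_3 -> A) : \sum_i F i = F 0 + F 1 + F 2%:R.
Proof.
rewrite !big_ord_recl big_ord0 addr0 addrA; do 2?congr (_ + _); congr F;
  exact: val_inj.
Qed.

Lemma lieE (K : fieldType) (x y : sl3 K) i j :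
  lie x y i j = x i 0 * y 0 j + x i 1 * y 1 j + x i 2%:R * y 2%:R j
    - (y i 0 * x 0 j + y i 1 * x 1 j + y i 2%:R * x 2%:R j).
Proof. by rewrite !mxE !sum_I3. Qed.

Section LinearMaps.

Variables (K : fieldType) (V V' : lmodType K) (f : {linear V -> V'}).

(* Unlike those of the library, these do not see [f] as an additive map. *)
Lemma linfD u v : f (u + v) = f u + f v. Proof. exact: linearD. Qed.
Lemma linfB u v : f (u - v) = f u - f v. Proof. exact: linearB. Qed.
Lemma linfN u : f (- u) = - f u. Proof. exact: linearN. Qed.
Lemma linfZ c u : f (c *: u) = c *: f u. Proof. exact: linearZ_LR. Qed.
Lemma linf0 : f 0 = 0. Proof. exact: linear0. Qed.

Definition linfE := (linfD, linfB, linfN, linfZ, linf0).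

End LinearMaps.

(* Sealed, so that unification never unfolds the action on a concrete module. *)
HB.lock Definition chevalley_act (K : fieldType) (V : lmodType K)
    (e1 e2 f1 f2 h1 h2 : V -> V) (x : sl3 K) (v : V) : V :=
  x 0 0 *: h1 v + (x 0 0 + x 1 1) *: h2 v + x 0 1 *: e1 v + x 1 2%:R *: e2 v
  + x 0 2%:R *: brk e1 e2 v + x 1 0 *: f1 v + x 2%:R 1 *: f2 v
  + x 2%:R 0 *: brk f2 f1 v.

Section ChevalleyModule.

Variables (K : fieldType) (V : lmodType K).
Variables (e1 e2 f1 f2 h1 h2 : {linear V -> V}).
Hypothesis ch : chevalley e1 e2 f1 f2 h1 h2.

Lemma chevalley_h1e1 v : e1 (h1 v) = h1 (e1 v) - 2%:R *: e1 v.
Proof. by rewrite (ch_h1e1 ch) addrK. Qed.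
Lemma chevalley_h1e2 v : e2 (h1 v) = h1 (e2 v) + e2 v.
Proof. by rewrite (ch_h1e2 ch) subrK. Qed.
Lemma chevalley_h2e1 v : e1 (h2 v) = h2 (e1 v) + e1 v.
Proof. by rewrite (ch_h2e1 ch) subrK. Qed.
Lemma chevalley_h2e2 v : e2 (h2 v) = h2 (e2 v) - 2%:R *: e2 v.
Proof. by rewrite (ch_h2e2 ch) addrK. Qed.

Definition chevalley_normal :=
  (ch_h1f1 ch, ch_h1f2 ch, ch_h2f1 ch, ch_h2f2 ch, ch_e1f1 ch, ch_e1f2 ch,
   ch_e2f1 ch, ch_e2f2 ch, chevalley_h1e1, chevalley_h1e2, chevalley_h2e1,
   chevalley_h2e2).

Hypothesis serre_e1 : forall v, serre e1 e2 v = 0.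
Hypothesis serre_e2 : forall v, serre e2 e1 v = 0.
Hypothesis serre_f1 : forall v, serre f1 f2 v = 0.
Hypothesis serre_f2 : forall v, serre f2 f1 v = 0.

Local Notation e3 := (brk e1 e2).
Local Notation f3 := (brk f2 f1).

Let brkP (a b : V -> V) v : a (b v) = b (a v) + brk a b v.
Proof. by rewrite brk.unlock addrC subrK. Qed.

Let lin := (linfE e1, linfE e2, linfE f1, linfE f2, linfE h1, linfE h2,
  linfE e3, linfE f3).

(** A Serre relation says exactly that the bracket of the two generators commutes with one of them;
    the next three facts have the same origin. *)
Let e3e1 v : e3 (e1 v) = e1 (e3 v).
Proof.
by apply/eqP; rewrite -subr_eq0 -oppr_eq0 -(serre_e1 v) /serre brk.unlock !lin;
  apply/eqP; lmod.
Qed.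

Let e3e2 v : e3 (e2 v) = e2 (e3 v).
Proof.
by apply/eqP; rewrite -subr_eq0 -(serre_e2 v) /serre brk.unlock !lin; apply/eqP; lmod.
Qed.

Let f3f1 v : f3 (f1 v) = f1 (f3 v).
Proof.
by apply/eqP; rewrite -subr_eq0 -(serre_f1 v) /serre brk.unlock !lin; apply/eqP; lmod.
Qed.

Let f3f2 v : f3 (f2 v) = f2 (f3 v).
Proof.
by apply/eqP; rewrite -subr_eq0 -oppr_eq0 -(serre_f2 v) /serre brk.unlock !lin;
  apply/eqP; lmod.
Qed.

Let h1f3 v : h1 (f3 v) = f3 (h1 v) - f3 v.
Proof. by rewrite brk.unlock; rewrite ?lin ?chevalley_normal ?lin ?chevalley_normal ?lin; lmod. Qed.
Let h2f3 v : h2 (f3 v) = f3 (h2 v) - f3 v.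
Proof. by rewrite brk.unlock; rewrite ?lin ?chevalley_normal ?lin ?chevalley_normal ?lin; lmod. Qed.
Let h1e3 v : e3 (h1 v) = h1 (e3 v) - e3 v.
Proof. by rewrite brk.unlock; rewrite ?lin ?chevalley_normal ?lin ?chevalley_normal ?lin; lmod. Qed.
Let h2e3 v : e3 (h2 v) = h2 (e3 v) - e3 v.
Proof. by rewrite brk.unlock; rewrite ?lin ?chevalley_normal ?lin ?chevalley_normal ?lin; lmod. Qed.
Let e1f3 v : e1 (f3 v) = f3 (e1 v) - f2 v.
Proof. by rewrite brk.unlock; rewrite ?lin ?chevalley_normal ?lin ?chevalley_normal ?lin; lmod. Qed.
Let e2f3 v : e2 (f3 v) = f3 (e2 v) + f1 v.
Proof. by rewrite brk.unlock; rewrite ?lin ?chevalley_normal ?lin ?chevalley_normal ?lin; lmod. Qed.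
Let e3f1 v : e3 (f1 v) = f1 (e3 v) - e2 v.
Proof. by rewrite brk.unlock; rewrite ?lin ?chevalley_normal ?lin ?chevalley_normal ?lin; lmod. Qed.
Let e3f2 v : e3 (f2 v) = f2 (e3 v) + e1 v.
Proof. by rewrite brk.unlock; rewrite ?lin ?chevalley_normal ?lin ?chevalley_normal ?lin; lmod. Qed.
Let e3f3 v : e3 (f3 v) = f3 (e3 v) + h1 v + h2 v.
Proof. by rewrite brk.unlock; rewrite ?lin ?chevalley_normal ?lin ?chevalley_normal ?lin; lmod. Qed.
Let e2e1 v : e2 (e1 v) = e1 (e2 v) - e3 v.
Proof. by rewrite (brkP e1 e2) addrK. Qed.
Let f2f1 v : f2 (f1 v) = f1 (f2 v) + f3 v.
Proof. exact: brkP. Qed.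

Let comb (a1 a2 p1 p2 p3 q1 q2 q3 : K) (v : V) : V :=
  a1 *: h1 v + a2 *: h2 v + p1 *: e1 v + p2 *: e2 v + p3 *: e3 v
  + q1 *: f1 v + q2 *: f2 v + q3 *: f3 v.

Section Brackets.

Variables (a1 a2 p1 p2 p3 q1 q2 q3 : K) (v : V).
Let c := comb a1 a2 p1 p2 p3 q1 q2 q3.

Let normal := (chevalley_normal, ch_h1h2 ch, e3e1, e3e2, f3f1, f3f2, h1f3, h2f3,
  h1e3, h2e3, e1f3, e2f3, e3f1, e3f2, e3f3, e2e1, f2f1).

Let brk_h1 : h1 (c v) = c (h1 v)
  + comb 0 0 (2%:R * p1) (- p2) p3 (- 2%:R * q1) q2 (- q3) v.
Proof. by rewrite /c /comb ?lin /= ?normal ?lin /=; lmod. Qed.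

Let brk_h2 : h2 (c v) = c (h2 v)
  + comb 0 0 (- p1) (2%:R * p2) p3 q1 (- 2%:R * q2) (- q3) v.
Proof. by rewrite /c /comb ?lin /= ?normal ?lin /=; lmod. Qed.

Let brk_e1 : e1 (c v) = c (e1 v)
  + comb q1 0 (a2 - 2%:R * a1) 0 p2 0 (- q3) 0 v.
Proof. by rewrite /c /comb ?lin /= ?normal ?lin /=; lmod. Qed.

Let brk_e2 : e2 (c v) = c (e2 v)
  + comb 0 q2 0 (a1 - 2%:R * a2) (- p1) q3 0 0 v.
Proof. by rewrite /c /comb ?lin /= ?normal ?lin /=; lmod. Qed.

Let brk_e3 : e3 (c v) = c (e3 v)
  + comb q3 q3 q2 (- q1) (- a1 - a2) 0 0 0 v.
Proof. by rewrite /c /comb ?lin /= ?normal ?lin /=; lmod. Qed.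

Let brk_f1 : f1 (c v) = c (f1 v)
  + comb (- p1) 0 0 p3 0 (2%:R * a1 - a2) 0 (- q2) v.
Proof. by rewrite /c /comb ?lin /= ?normal ?lin /=; lmod. Qed.

Let brk_f2 : f2 (c v) = c (f2 v)
  + comb 0 (- p2) (- p3) 0 0 0 (2%:R * a2 - a1) q1 v.
Proof. by rewrite /c /comb ?lin /= ?normal ?lin /=; lmod. Qed.

Let brk_f3 : f3 (c v) = c (f3 v)
  + comb (- p3) (- p3) 0 0 0 (- p2) p1 (a1 + a2) v.
Proof. by rewrite /c /comb ?lin /= ?normal ?lin /=; lmod. Qed.

(** All structure constants of sl_3 at once: each of the eight basis elements is moved past the
    general combination [c], and the correction terms are the coordinates of the commutator.
    Comparison with [lieE] yields the Lie identity of the action. *)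
Lemma chevalley_comb b1 b2 r1 r2 r3 s1 s2 s3 :
  comb b1 b2 r1 r2 r3 s1 s2 s3 (c v) = c (comb b1 b2 r1 r2 r3 s1 s2 s3 v)
  + comb (r1 * q1 + r3 * q3 - s1 * p1 - s3 * p3)
      (r2 * q2 + r3 * q3 - s2 * p2 - s3 * p3)
      (b1 * 2%:R * p1 - b2 * p1 + r1 * (a2 - 2%:R * a1) + r3 * q2 - s2 * p3)
      (b2 * 2%:R * p2 - b1 * p2 + r2 * (a1 - 2%:R * a2) - r3 * q1 + s1 * p3)
      (b1 * p3 + b2 * p3 + r1 * p2 - r2 * p1 - r3 * (a1 + a2))
      (- b1 * 2%:R * q1 + b2 * q1 + r2 * q3 + s1 * (2%:R * a1 - a2) - s3 * p2)
      (b1 * q2 - b2 * 2%:R * q2 - r1 * q3 + s2 * (2%:R * a2 - a1) + s3 * p1)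
      (- b1 * q3 - b2 * q3 - s1 * q2 + s2 * q1 + s3 * (a1 + a2)) v.
Proof.
have linc : linear c by move=> d u w; rewrite /c /comb !linearP /=; lmod.
have cZ d u : c (d *: u) = d *: c u.
  by have := linc d u 0; rewrite addr0 => ->; rewrite /c /comb !linear0; lmod.
have cD u w : c (u + w) = c u + c w by rewrite -{1}[u]scale1r linc scale1r.
rewrite [LHS]/comb brk_h1 brk_h2 brk_e1 brk_e2 brk_e3 brk_f1 brk_f2 brk_f3.
by rewrite {9}/comb !cD !cZ /comb; lmod.
Qed.

End Brackets.

Local Notation chevalley_act := (chevalley_act e1 e2 f1 f2 h1 h2).

Fact chevalley_act_linearl v : linear (fun x => chevalley_act x v).
Proof. by move=> c x y; rewrite chevalley_act.unlock !mxE; lmod. Qed.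

Fact chevalley_act_linearr x : linear (chevalley_act x).
Proof. by move=> c u v; rewrite chevalley_act.unlock brk.unlock !linearP /=; lmod. Qed.

Fact chevalley_act_lie x y v : chevalley_act (lie x y) v =
  chevalley_act x (chevalley_act y v) - chevalley_act y (chevalley_act x v).
Proof.
have actE z w : chevalley_act z w = comb (z 0 0) (z 0 0 + z 1 1) (z 0 1) (z 1 2%:R)
    (z 0 2%:R) (z 1 0) (z 2%:R 1) (z 2%:R 0) w by rewrite chevalley_act.unlock.
rewrite !actE [X in X - _]chevalley_comb [X in X - _]addrC addrK.
rewrite !lieE !sl3_22; congr comb; ring.
Qed.

Definition chevalley_module : sl3_module K :=
  Sl3Module chevalley_act_linearl chevalley_act_linearr chevalley_act_lie.

End ChevalleyModule.

(** * Chevalley generators of sl_3 *)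

(* Sealed, so that unification never compares two of them by computation. *)
HB.lock Definition xe1 (K : fieldType) : sl3 K := root_elt K 0 1.
HB.lock Definition xe2 (K : fieldType) : sl3 K := root_elt K 1 2%:R.
HB.lock Definition xf1 (K : fieldType) : sl3 K := root_elt K 1 0.
HB.lock Definition xf2 (K : fieldType) : sl3 K := root_elt K 2%:R 1.
HB.lock Definition xh1 (K : fieldType) : sl3 K := lie (xe1 K) (xf1 K).
HB.lock Definition xh2 (K : fieldType) : sl3 K := lie (xe2 K) (xf2 K).

Arguments xe1.body {K}. Arguments xe2.body {K}. Arguments xf1.body {K}.
Arguments xf2.body {K}. Arguments xh1.body {K}. Arguments xh2.body {K}.

Section Generators.

Variable K : fieldType.

Lemma xh1_lie : xh1 = lie xe1 xf1 :> sl3 K.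
Proof. by rewrite xh1.unlock. Qed.
Lemma xh2_lie : xh2 = lie xe2 xf2 :> sl3 K.
Proof. by rewrite xh2.unlock. Qed.

Lemma I3P (i : 'I_3) : [\/ i = 0, i = 1 | i = 2%:R].
Proof.
by case: i => [[|[|[|//]]] lti]; [constructor 1|constructor 2|constructor 3];
  apply: val_inj.
Qed.

Lemma sl3_eqP (x y : sl3 K) :
  [/\ x 0 0 = y 0 0, x 1 1 = y 1 1, x 0 1 = y 0 1, x 0 2%:R = y 0 2%:R
    & x 1 2%:R = y 1 2%:R] ->
  [/\ x 1 0 = y 1 0, x 2%:R 0 = y 2%:R 0 & x 2%:R 1 = y 2%:R 1] -> x = y.
Proof.
move=> [? ? ? ? ?] [? ? ?]; apply/val_inj/matrixP => i j.
by case: (I3P i) => ->; case: (I3P j) => -> //=; rewrite !sl3_22; congr (- _ - _).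
Qed.

Lemma xe1E i j : (xe1 : sl3 K) i j = ((i == 0) && (j == 1))%:R.
Proof. by rewrite xe1.unlock mxE. Qed.
Lemma xe2E i j : (xe2 : sl3 K) i j = ((i == 1) && (j == 2%:R))%:R.
Proof. by rewrite xe2.unlock mxE. Qed.
Lemma xf1E i j : (xf1 : sl3 K) i j = ((i == 1) && (j == 0))%:R.
Proof. by rewrite xf1.unlock mxE. Qed.
Lemma xf2E i j : (xf2 : sl3 K) i j = ((i == 2%:R) && (j == 1))%:R.
Proof. by rewrite xf2.unlock mxE. Qed.

Definition genE := (xe1E, xe2E, xf1E, xf2E).

Lemma sl3_addE (x y : sl3 K) i j : (x + y) i j = x i j + y i j.
Proof. by rewrite mxE. Qed.
Lemma sl3_oppE (x : sl3 K) i j : (- x) i j = - x i j.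
Proof. by rewrite mxE. Qed.
Lemma sl3_scaleE c (x : sl3 K) i j : (c *: x) i j = c * x i j.
Proof. by rewrite mxE. Qed.
Lemma sl3_zeroE i j : (0 : sl3 K) i j = 0.
Proof. by rewrite mxE. Qed.
Lemma sl3_natE (x : sl3 K) n i j : (x *+ n) i j = x i j *+ n.
Proof. by elim: n => [|n IHn]; rewrite ?mulr0n ?sl3_zeroE // !mulrS sl3_addE IHn. Qed.

Definition sl3E := (sl3_addE, sl3_oppE, sl3_scaleE, sl3_zeroE, lieE, xh1_lie, xh2_lie, genE).

Lemma sl3_basis (x : sl3 K) :
  x = x 0 0 *: xh1 + (x 0 0 + x 1 1) *: xh2 + x 0 1 *: xe1 + x 1 2%:R *: xe2
      + x 0 2%:R *: lie (xe1 : sl3 K) xe2 + x 1 0 *: xf1 + x 2%:R 1 *: xf2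
      + x 2%:R 0 *: lie (xf2 : sl3 K) xf1.
Proof. apply: sl3_eqP; split; rewrite !sl3E /=; ring. Qed.

Ltac lie_mx := apply: val_inj;
  rewrite ?xh1_lie ?xh2_lie ?xe1.unlock ?xe2.unlock ?xf1.unlock ?xf2.unlock /= ?(mulmxBl, mulmxBr, mul_delta_mx_cond) /=
    ?(mulr0n, mulr1n, subr0, sub0r, mulmx0, mul0mx, mulmxN, mulNmx, opprK)
    ?mul_delta_mx_cond /=;
  apply/matrixP => i j; rewrite !mxE; ring.

Lemma lie_gens :
  [/\ lie (xe1 : sl3 K) xf2 = 0, lie (xe2 : sl3 K) xf1 = 0, lie (xe1 : sl3 K) (lie (xe1 : sl3 K) xe2) = 0
    & lie (xe2 : sl3 K) (lie (xe1 : sl3 K) xe2) = 0] /\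
  [/\ lie (xh1 : sl3 K) xh2 = 0, lie (xf1 : sl3 K) (lie (xf2 : sl3 K) xf1) = 0 & lie (xf2 : sl3 K) (lie (xf2 : sl3 K) xf1) = 0].
Proof. by split; split; lie_mx. Qed.

Lemma lie_h_gens :
  [/\ lie (xh1 : sl3 K) xe1 = 2%:R *: xe1, lie (xh1 : sl3 K) xe2 = - xe2, lie (xh2 : sl3 K) xe1 = - xe1
    & lie (xh2 : sl3 K) xe2 = 2%:R *: xe2] /\
  [/\ lie (xh1 : sl3 K) xf1 = - (2%:R *: xf1), lie (xh1 : sl3 K) xf2 = xf2, lie (xh2 : sl3 K) xf1 = xf1
    & lie (xh2 : sl3 K) xf2 = - (2%:R *: xf2)].
Proof. by split; split; lie_mx. Qed.

Lemma sl3_tr_gens : [/\ sl3_tr (xe1 : sl3 K) = xf1, sl3_tr (xe2 : sl3 K) = xf2, sl3_tr (xf1 : sl3 K) = xe1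
  & sl3_tr (xf2 : sl3 K) = xe2] /\ (sl3_tr (xh1 : sl3 K) = xh1 /\ sl3_tr (xh2 : sl3 K) = xh2).
Proof.
by do 2?split; apply: sl3_eqP; split; rewrite mxE !sl3E /=; ring.
Qed.

End Generators.

HB.instance Definition _ (K : fieldType) (M : sl3_module K) (x : sl3 K) :=
  GRing.isLinear.Build K M M *:%R (act x) (act_linearr x).

HB.instance Definition _ (K : fieldType) (M N : sl3_module K)
    (f : sl3_hom M N) :=
  GRing.isLinear.Build K M N *:%R (hom_fun f) (hom_linear f).

Section ActionOfGenerators.

Variables (K : fieldType).
Implicit Types M N : sl3_module K.

Lemma actN M (x : sl3 K) (v : M) : act x (- v) = - act x v.
Proof. exact: linearN. Qed.
Lemma actB M (x : sl3 K) (u v : M) : act x (u - v) = act x u - act x v.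
Proof. exact: linearB. Qed.
Lemma actNl M (x : sl3 K) (v : M) : act (- x) v = - act x v.
Proof. by rewrite -[- x]scaleN1r actZl scaleN1r. Qed.
Lemma act_comm M x y (v : M) : act x (act y v) = act y (act x v) + act (lie x y) v.
Proof. by rewrite act_lie addrC subrK. Qed.

Definition actE M :=
  (@actD K M, @actB M, @actN M, @actZ K M, @act0 K M).

Lemma act_chevalley M :
  @chevalley K M (act xe1) (act xe2) (act xf1) (act xf2) (act xh1) (act xh2).
Proof.
have [[ef1 ef2 _ _] [hh _ _]] := lie_gens K.
have [[h1e1 h1e2 h2e1 h2e2] [h1f1 h1f2 h2f1 h2f2]] := lie_h_gens K.
by split=> v; rewrite [LHS]act_comm -?xh1_lie -?xh2_lie ?ef1 ?ef2 ?hh ?h1e1 ?h1e2 ?h2e1 ?h2e2 ?h1f1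
  ?h1f2 ?h2f1 ?h2f2 ?actNl ?actNl ?act0l ?actZl ?addr0.
Qed.

Lemma act_serre M (v : M) :
  [/\ serre (act xe1) (act xe2) v = 0, serre (act xe2) (act xe1) v = 0,
      serre (act xf1) (act xf2) v = 0 & serre (act xf2) (act xf1) v = 0].
Proof.
have [[_ _ e13 e23] [_ f13 f23]] := lie_gens K.
have ll x y w : act (lie x (lie x y)) w = serre (act x) (act y) w :> M.
  by rewrite !act_lie !actB /serre; lmod.
have lr x y w : act (lie y (lie x y)) w = - serre (act y) (act x) w :> M.
  by rewrite !act_lie !actB /serre; lmod.
split; first by rewrite -ll e13 act0l.
- by apply: oppr_inj; rewrite -lr e23 act0l oppr0.
- by apply: oppr_inj; rewrite -lr f13 act0l oppr0.
- by rewrite -ll f23 act0l.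
Qed.

Lemma act_basis M (x : sl3 K) (v : M) :
  act x v = x 0 0 *: act xh1 v + (x 0 0 + x 1 1) *: act xh2 v + x 0 1 *: act xe1 v
      + x 1 2%:R *: act xe2 v + x 0 2%:R *: act (lie xe1 xe2) v
      + x 1 0 *: act xf1 v + x 2%:R 1 *: act xf2 v + x 2%:R 0 *: act (lie xf2 xf1) v.
Proof. by rewrite {1}(sl3_basis x) !actDl !actZl. Qed.

End ActionOfGenerators.

(** * Weights *)

Section Weights.

Variable K : fieldType.
Implicit Types (M N : sl3_module K) (lam mu nu : 'rV[K]_3).

Definition wt1 lam : K := lam 0 0 - lam 0 1.
Definition wt2 lam : K := lam 0 1 - lam 0 2%:R.

Lemma wt1D lam mu : wt1 (lam + mu) = wt1 lam + wt1 mu.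
Proof. by rewrite /wt1 !mxE; ring. Qed.
Lemma wt2D lam mu : wt2 (lam + mu) = wt2 lam + wt2 mu.
Proof. by rewrite /wt2 !mxE; ring. Qed.
Lemma wt1N lam : wt1 (- lam) = - wt1 lam.
Proof. by rewrite /wt1 !mxE; ring. Qed.
Lemma wt2N lam : wt2 (- lam) = - wt2 lam.
Proof. by rewrite /wt2 !mxE; ring. Qed.
Lemma wt1Mn lam n : wt1 (lam *+ n) = wt1 lam *+ n.
Proof. by rewrite /wt1 !mulmxnE mulrnBl. Qed.
Lemma wt2Mn lam n : wt2 (lam *+ n) = wt2 lam *+ n.
Proof. by rewrite /wt2 !mulmxnE mulrnBl. Qed.
Lemma wt_root01 : wt1 (sl3_root K 0 1) = 2%:R /\ wt2 (sl3_root K 0 1) = -1.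
Proof. by split; rewrite /wt1 /wt2 /sl3_root !mxE /=; ring. Qed.
Lemma wt_root12 : wt1 (sl3_root K 1 2%:R) = -1 /\ wt2 (sl3_root K 1 2%:R) = 2%:R.
Proof. by split; rewrite /wt1 /wt2 /sl3_root !mxE /=; ring. Qed.

Lemma weight_eval_sl3 lam (h : sl3 K) :
  weight_eval lam h = h 0 0 * wt1 lam + (h 0 0 + h 1 1) * wt2 lam.
Proof. by rewrite /weight_eval sum_I3 sl3_22 /wt1 /wt2; ring. Qed.

Lemma xh_diag : is_diag_mx (xh1 : sl3 K) /\ is_diag_mx (xh2 : sl3 K).
Proof.
by split; apply/is_diag_mxP => i j; case: (I3P i) => ->; case: (I3P j) => -> // _;
  rewrite !sl3E /=; ring.
Qed.

Lemma weight_eval_h lam :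
  weight_eval lam (xh1 : sl3 K) = wt1 lam /\ weight_eval lam (xh2 : sl3 K) = wt2 lam.
Proof. by rewrite !weight_eval_sl3 !sl3E /=; split; ring. Qed.

Lemma act_diag M (h : sl3 K) (v : M) : is_diag_mx h ->
  act h v = h 0 0 *: act xh1 v + (h 0 0 + h 1 1) *: act xh2 v.
Proof.
move=> /is_diag_mxP hd; rewrite act_basis (hd 0 1) // (hd 1 2%:R) // (hd 0 2%:R) //.
by rewrite (hd 1 0) // (hd 2%:R 1) // (hd 2%:R 0) // !scale0r !addr0.
Qed.

Lemma weight_vectorP lam M (v : M) :
  weight_vector lam v <->
  act xh1 v = wt1 lam *: v /\ act xh2 v = wt2 lam *: v.
Proof.
have [d1 d2] := xh_diag; have [w1 w2] := weight_eval_h lam.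
split=> [wv|[e1 e2] h hd]; first by rewrite !wv // w1 w2.
by rewrite act_diag // e1 e2 weight_eval_sl3 !scalerA -scalerDl.
Qed.

Lemma singular_vectorP lam M (v : M) :
  singular_vector lam v <->
  weight_vector lam v /\ act xe1 v = 0 /\ act xe2 v = 0.
Proof.
split=> [[wv e0]|[wv [e1 e2]]]; split=> //.
  split; apply: e0 => i j; case: (I3P i) => ->; case: (I3P j) => -> //;
    by rewrite !sl3E.
move=> x ux; rewrite act_basis (ux 0 0) // (ux 1 1) // (ux 1 0) // (ux 2%:R 1) //
  (ux 2%:R 0) // e1 e2 act_lie e1 e2 !act0 subrr.
by rewrite addr0 !scale0r !scaler0 !addr0.
Qed.

Definition same_weight lam mu : bool := (wt1 lam == wt1 mu) && (wt2 lam == wt2 mu).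

Lemma same_weightxx lam : same_weight lam lam.
Proof. by rewrite /same_weight !eqxx. Qed.

Lemma same_weightC lam mu : same_weight lam mu = same_weight mu lam.
Proof. by rewrite /same_weight eq_sym [X in _ && X]eq_sym. Qed.

Lemma same_weight_trans lam mu nu :
  same_weight lam mu -> same_weight mu nu -> same_weight lam nu.
Proof. by case/andP=> /eqP e1 /eqP e2; rewrite /same_weight e1 e2. Qed.

Lemma same_weightD lam mu nu :
  same_weight (lam + nu) (mu + nu) = same_weight lam mu.
Proof. by rewrite /same_weight !wt1D !wt2D !(inj_eq (addIr _)). Qed.

Lemma same_weight_vector lam mu M (v : M) :
  same_weight lam mu -> weight_vector lam v -> weight_vector mu v.
Proof.
by case/andP=> /eqP e1 /eqP e2 /weight_vectorP; rewrite e1 e2 => /weight_vectorP.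
Qed.

Lemma weight_vector_same lam mu M (v : M) : v != 0 ->
  weight_vector lam v -> weight_vector mu v -> same_weight lam mu.
Proof.
move=> nz wl wm; have [d1 d2] := xh_diag.
have [[l1 l2] [m1 m2]] := (weight_eval_h lam, weight_eval_h mu).
by rewrite /same_weight -l1 -l2 -m1 -m2 !(weight_unique nz wl wm) ?eqxx.
Qed.

Lemma weight_vector0 lam M : weight_vector lam (0 : M).
Proof. by move=> h _; rewrite act0 scaler0. Qed.

Lemma weight_vectorD lam M (u v : M) :
  weight_vector lam u -> weight_vector lam v -> weight_vector lam (u + v).
Proof. by move=> wu wv h hd; rewrite actD wu ?wv // scalerDr. Qed.

Lemma weight_vectorZ lam M c (v : M) : weight_vector lam v -> weight_vector lam (c *: v).
Proof. by move=> wv h hd; rewrite actZ wv // !scalerA mulrC. Qed.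

Lemma weight_vectorN lam M (v : M) : weight_vector lam v -> weight_vector lam (- v).
Proof. by move=> wv; rewrite -scaleN1r; apply: weight_vectorZ. Qed.

Lemma weight_vector_hom lam M N (f : sl3_hom M N) (v : M) :
  weight_vector lam v -> weight_vector lam (f v).
Proof. by move=> wv h hd; rewrite -hom_act wv // homZ. Qed.

Lemma weight_vector_sum lam M (I : Type) (r : seq I) (p : pred I) (b : I -> M) :
  (forall i, p i -> weight_vector lam (b i)) ->
  weight_vector lam (\sum_(i <- r | p i) b i).
Proof.
by move=> wb; apply: big_ind => //; [exact: weight_vector0|exact: weight_vectorD].
Qed.

(* The component of weight mu, given that the weights that occur are in s. *)
Fixpoint weight_proj M mu (s : seq 'rV[K]_3) (v : M) : M :=
  if s is lam :: s' then
    let u := weight_proj mu s' v in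
    if wt1 lam != wt1 mu then
      (wt1 mu - wt1 lam)^-1 *: (act xh1 u - wt1 lam *: u)
    else if wt2 lam != wt2 mu then
      (wt2 mu - wt2 lam)^-1 *: (act xh2 u - wt2 lam *: u)
    else u
  else v.

Lemma weight_projD M mu s (u v : M) :
  weight_proj mu s (u + v) = weight_proj mu s u + weight_proj mu s v.
Proof.
elim: s => //= lam s ->; case: ifP => _; last case: ifP => _ //;
  by rewrite actD; lmod.
Qed.

Lemma weight_proj0 M mu s : weight_proj mu s (0 : M) = 0.
Proof. by apply: (addrI (weight_proj mu s 0)); rewrite -weight_projD !addr0. Qed.

Lemma weight_proj_same M mu s (v : M) : weight_vector mu v -> weight_proj mu s v = v.
Proof.
move/weight_vectorP=> [w1 w2]; elim: s => //= lam s ->.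
case: ifP => [n1|_]; last case: ifP => [n2|_] //.
  by rewrite w1 -scalerBl scalerA mulVf ?scale1r // subr_eq0 eq_sym.
by rewrite w2 -scalerBl scalerA mulVf ?scale1r // subr_eq0 eq_sym.
Qed.

Lemma weight_proj_other M mu nu s (v : M) : weight_vector nu v -> nu \in s ->
  ~~ same_weight nu mu -> weight_proj mu s v = 0.
Proof.
move=> wv; have wps t : weight_vector nu (weight_proj mu t v).
  elim: t => //= lam t IHt; case: ifP => _; last case: ifP => _ //;
    have [e1 e2] := (weight_vectorP nu (weight_proj mu t v)).1 IHt;
    by rewrite ?e1 ?e2 -scalerBl scalerA; apply: weight_vectorZ.
elim: s => //= lam s IHs; rewrite inE => /predU1P[<-|ins] nsame; last first.
  by rewrite IHs // !act0 !scaler0 subrr !scaler0; do 2?case: ifP.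
have [e1 e2] := (weight_vectorP nu (weight_proj mu s v)).1 (wps s).
move: nsame; rewrite /same_weight negb_and e1 e2 !subrr !scaler0.
by case: (wt1 nu =P _) => //= _ ->.
Qed.

(** The interpolation projector [weight_proj], built from all the weights that occur, fixes vectors
    of weight [mu] and kills the other weight vectors; apply it to both sides. *)
Lemma weight_component M mu (v : M) n (b : 'I_n -> M) (lam : 'I_n -> 'rV[K]_3) :
  weight_vector mu v -> (forall i, weight_vector (lam i) (b i)) ->
  v = \sum_i b i -> v = \sum_(i | same_weight (lam i) mu) b i.
Proof.
move=> wv wb vE; pose s := codom lam.
rewrite -{1}(weight_proj_same s wv) vE (big_morph _ (weight_projD mu s) (weight_proj0 _ mu s)).
rewrite [RHS]big_mkcond; apply: eq_bigr => i _; case: ifP => [same|/negbT nsame].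
  by rewrite weight_proj_same //; apply: same_weight_vector same (wb i).
by apply: weight_proj_other (wb i) _ nsame; apply: codom_f.
Qed.

(** The four generators generate sl_3 as a Lie algebra, and a linear map commuting with two elements
    commutes with their bracket. *)
Lemma is_hom_gens M N (f : M -> N) : linear f ->
  (forall v, f (act xe1 v) = act xe1 (f v)) ->
  (forall v, f (act xe2 v) = act xe2 (f v)) ->
  (forall v, f (act xf1 v) = act xf1 (f v)) ->
  (forall v, f (act xf2 v) = act xf2 (f v)) -> f \in @is_hom K M N.
Proof.
move=> lf fe1 fe2 ff1 ff2; apply/asboolP; split=> // x v.
have fD u w : f (u + w) = f u + f w by rewrite -[u in LHS]scale1r lf scale1r.
have f0 : f 0 = 0 by apply: (addrI (f 0)); rewrite -fD !addr0.
have fZ c u : f (c *: u) = c *: f u by rewrite -[c *: u]addr0 lf f0 addr0.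
have flie a b : (forall u, f (act a u) = act a (f u)) ->
    (forall u, f (act b u) = act b (f u)) ->
    forall u, f (act (lie a b) u) = act (lie a b) (f u).
  by move=> fa fb u; rewrite !act_lie -scaleN1r fD fZ !(fa, fb) scaleN1r.
have fh1 : forall u, f (act xh1 u) = act xh1 (f u) by rewrite xh1_lie; apply: flie.
have fh2 : forall u, f (act xh2 u) = act xh2 (f u) by rewrite xh2_lie; apply: flie.
have fe3 := flie _ _ fe1 fe2; have ff3 := flie _ _ ff2 ff1.
rewrite [in LHS]act_basis 7!fD 8!fZ [RHS]act_basis.
by rewrite fh1 fh2 fe1 fe2 fe3 ff1 ff2 ff3.
Qed.

Section ChevalleyModuleAction.

Variables (V : lmodType K) (e1 e2 f1 f2 h1 h2 : {linear V -> V}).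
Hypothesis ch : chevalley e1 e2 f1 f2 h1 h2.
Hypotheses (se1 : forall v, serre e1 e2 v = 0) (se2 : forall v, serre e2 e1 v = 0)
  (sf1 : forall v, serre f1 f2 v = 0) (sf2 : forall v, serre f2 f1 v = 0).
Let M : sl3_module K := chevalley_module ch se1 se2 sf1 sf2.

Lemma chevalley_module_act (v : V) :
  [/\ @act K M xe1 v = e1 v, @act K M xe2 v = e2 v, @act K M xf1 v = f1 v
    & @act K M xf2 v = f2 v] /\ (@act K M xh1 v = h1 v /\ @act K M xh2 v = h2 v).
Proof.
have aE x : @act K M x v = chevalley_act e1 e2 f1 f2 h1 h2 x v by [].
split; split; rewrite aE chevalley_act.unlock !sl3E /= ?(mulr0, mul0r, mulr1, mul1r)
  ?(subrr, addr0, add0r, subr0, sub0r) ?addrN ?addNr;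
  by rewrite ?(scale0r, scale1r, addr0, add0r).
Qed.

End ChevalleyModuleAction.

End Weights.

(** * The enveloping algebra of the lower triangular part *)

(* The monomial x^i z^j y^k stands for f_1^i f_3^j f_2^k, where f_3 = [f_2, f_1];
   left multiplication by f_1 is then p |-> x p, and left multiplication by f_2
   is p |-> y p + z dp/dx. *)
Notation U K := (mpoly.mpoly 3 K).

Section PolynomialModel.

Variable K : fieldType.
Implicit Types p q : U K.

Definition ux : U K := @mpoly.mpolyX 3 K (mpoly.mnm1 0).
Definition uy : U K := @mpoly.mpolyX 3 K (mpoly.mnm1 1).
Definition uz : U K := @mpoly.mpolyX 3 K (mpoly.mnm1 2%:R).
Definition dx p : U K := mpoly.mderiv 0 p.
Definition dy p : U K := mpoly.mderiv 1 p.
Definition dz p : U K := mpoly.mderiv 2%:R p.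

Lemma dxD p q : dx (p + q) = dx p + dx q. Proof. exact: mpoly.mderivD. Qed.
Lemma dyD p q : dy (p + q) = dy p + dy q. Proof. exact: mpoly.mderivD. Qed.
Lemma dzD p q : dz (p + q) = dz p + dz q. Proof. exact: mpoly.mderivD. Qed.
Lemma dxN p : dx (- p) = - dx p. Proof. exact: mpoly.mderivN. Qed.
Lemma dyN p : dy (- p) = - dy p. Proof. exact: mpoly.mderivN. Qed.
Lemma dzN p : dz (- p) = - dz p. Proof. exact: mpoly.mderivN. Qed.
Lemma dxZ c p : dx (c *: p) = c *: dx p. Proof. exact: mpoly.mderivZ. Qed.
Lemma dyZ c p : dy (c *: p) = c *: dy p. Proof. exact: mpoly.mderivZ. Qed.
Lemma dzZ c p : dz (c *: p) = c *: dz p. Proof. exact: mpoly.mderivZ. Qed.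
Lemma dxM p q : dx (p * q) = dx p * q + p * dx q. Proof. exact: mpoly.mderivM. Qed.
Lemma dyM p q : dy (p * q) = dy p * q + p * dy q. Proof. exact: mpoly.mderivM. Qed.
Lemma dzM p q : dz (p * q) = dz p * q + p * dz q. Proof. exact: mpoly.mderivM. Qed.

Let derivX (i j : 'I_3) :
  mpoly.mderiv i (@mpoly.mpolyX 3 K (mpoly.mnm1 j)) = (i == j)%:R.
Proof.
rewrite mpoly.mderivX mpoly.mnm1E eq_sym; case: eqP => [->|_]; last by rewrite scale0r.
by rewrite scale1r -[RHS]mpoly.mpolyX0; congr mpoly.mpolyX; apply/mpoly.mnmP => k;
  rewrite mpoly.mnmBE subnn mpoly.mnm0E.
Qed.

Lemma dxx : dx ux = 1. Proof. exact: derivX. Qed.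
Lemma dxy : dx uy = 0. Proof. exact: derivX. Qed.
Lemma dxz : dx uz = 0. Proof. exact: derivX. Qed.
Lemma dyx : dy ux = 0. Proof. exact: derivX. Qed.
Lemma dyy : dy uy = 1. Proof. exact: derivX. Qed.
Lemma dyz : dy uz = 0. Proof. exact: derivX. Qed.
Lemma dzx : dz ux = 0. Proof. exact: derivX. Qed.
Lemma dzy : dz uy = 0. Proof. exact: derivX. Qed.
Lemma dzz : dz uz = 1. Proof. exact: derivX. Qed.
Lemma dydx p : dy (dx p) = dx (dy p). Proof. exact: mpoly.mderiv_comm. Qed.
Lemma dzdx p : dz (dx p) = dx (dz p). Proof. exact: mpoly.mderiv_comm. Qed.
Lemma dzdy p : dz (dy p) = dy (dz p). Proof. exact: mpoly.mderiv_comm. Qed.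
Lemma dx1 : dx 1 = 0. Proof. exact: mpoly.mderivC. Qed.
Lemma dy1 : dy 1 = 0. Proof. exact: mpoly.mderivC. Qed.
Lemma dz1 : dz 1 = 0. Proof. exact: mpoly.mderivC. Qed.
Lemma dx0 : dx 0 = 0. Proof. exact: mpoly.mderiv0. Qed.
Lemma dy0 : dy 0 = 0. Proof. exact: mpoly.mderiv0. Qed.
Lemma dz0 : dz 0 = 0. Proof. exact: mpoly.mderiv0. Qed.

Lemma dxMn p n : dx (p *+ n) = dx p *+ n. Proof. exact: mpoly.mderivMn. Qed.
Lemma dyMn p n : dy (p *+ n) = dy p *+ n. Proof. exact: mpoly.mderivMn. Qed.
Lemma dzMn p n : dz (p *+ n) = dz p *+ n. Proof. exact: mpoly.mderivMn. Qed.

(* The order matters: the last rules are costly to try on other terms. *)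
Definition derivE := ((dx1, dy1, dz1, dx0, dy0, dz0),
  (dxx, dxy, dxz, dyx, dyy, dyz, dzx, dzy, dzz), (dydx, dzdx, dzdy),
  (dxMn, dyMn, dzMn, dxN, dyN, dzN, dxD, dyD, dzD, dxZ, dyZ, dzZ, dxM, dyM, dzM)).

Lemma scale_mpolyC c p : c *: p = mpoly.mpolyC 3 c * p.
Proof. by rewrite mpoly.mul_mpolyC. Qed.

Definition umon (i j k : nat) : U K := ux ^+ i * uz ^+ j * uy ^+ k.

Lemma mpolyX_umon (m : mpoly.multinom 3) :
  @mpoly.mpolyX 3 K m = umon (m 0) (m 2%:R) (m 1).
Proof.
rewrite mpoly.mpolyXE_id !big_ord_recl big_ord0 mulr1 mulrA [RHS]mulrAC.
have -> : ord0 = 0 :> 'I_3 by [].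
have -> : lift ord0 ord0 = 1 :> 'I_3 by apply: val_inj.
by have -> : lift ord0 (lift ord0 ord0) = 2%:R :> 'I_3 by apply: val_inj.
Qed.

Lemma umon_ind (P : U K -> Prop) :
  P 0 -> (forall c p q, P p -> P q -> P (c *: p + q)) ->
  (forall i j k, P (umon i j k)) -> forall p, P p.
Proof.
move=> P0 PD Pm p; rewrite (mpoly.mpolyE p).
by apply: big_ind => // [q q' Pq Pq'|m _]; [rewrite -[q]scale1r|
  rewrite -[_ *: _]addr0 mpolyX_umon]; apply: PD.
Qed.

Definition uf1 p : U K := ux * p.
Definition uf2 p : U K := uy * p + uz * dx p.

Lemma dxX n : dx (ux ^+ n.+1) = n.+1%:R * ux ^+ n.
Proof.
elim: n => [|n IHn]; first by rewrite expr1 expr0 dxx mulr1.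
by rewrite exprS dxM IHn dxx [in RHS]mulrSr exprS; ring.
Qed.

Lemma dxXy n : dx (uy ^+ n) = 0.
Proof. by elim: n => [|n IHn]; rewrite ?dx1 // exprS dxM IHn dxy mul0r mulr0 addr0. Qed.

Lemma dxXz n : dx (uz ^+ n) = 0.
Proof. by elim: n => [|n IHn]; rewrite ?dx1 // exprS dxM IHn dxz mul0r mulr0 addr0. Qed.

Lemma uf1_umon i j k : uf1 (umon i j k) = umon i.+1 j k.
Proof. by rewrite /uf1 /umon !exprS; ring. Qed.

Lemma uf2_umon0 j k : uf2 (umon 0 j k) = umon 0 j k.+1.
Proof.
by rewrite /uf2 /umon !dxM dxXz dxXy expr0 dx1 exprS; ring.
Qed.

Lemma uf2_umonS i j k :
  uf2 (umon i.+1 j k) = umon i.+1 j k.+1 + i.+1%:R *: umon i j.+1 k.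
Proof.
rewrite /uf2 /umon !dxM dxXz dxXy dxX [uy ^+ _.+1]exprS [uz ^+ _.+1]exprS.
by rewrite scaler_nat -mulr_natl; ring.
Qed.

(** Multiplication by z is the commutator of [uf2] and [uf1], so these two operators reach every
    ordered monomial from 1. *)
Lemma u_ind (P : U K -> Prop) :
  P 1 -> (forall c p q, P p -> P q -> P (c *: p + q)) ->
  (forall p, P p -> P (uf1 p)) -> (forall p, P p -> P (uf2 p)) -> forall p, P p.
Proof.
move=> P1 PD Pf1 Pf2; have P0 : P 0.
  by have := PD (-1) _ _ P1 P1; rewrite scaleN1r addNr.
have Pz p : P p -> P (uz * p).
  move=> Pp; have -> : uz * p = (-1) *: uf1 (uf2 p) + uf2 (uf1 p).
    by rewrite /uf1 /uf2 dxM dxx scaleN1r; ring.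
  by apply: PD; [apply/Pf1/Pf2|apply/Pf2/Pf1].
apply: umon_ind => // i j k.
have: P (umon 0 0 k).
  by elim: k => [|k IHk]; [rewrite /umon !expr0 !mulr1|rewrite -uf2_umon0; apply: Pf2].
have: P (umon 0 0 k) -> P (umon 0 j k).
  elim: j => // j IHj /IHj/Pz; congr P; rewrite /umon exprS; ring.
move=> + P00 => /(_ P00) {P00}; elim: i => // i IHi /IHi/Pf1.
by rewrite uf1_umon.
Qed.

Section LinearExtension.

Variables (V : lmodType K) (F : nat -> nat -> nat -> V).

(** The arguments of [F] follow the order x, z, y of [umon], hence the indices 0, 2, 1. *)
Definition lext p : V :=
  \sum_(m <- mpoly.msupp p) mpoly.mcoeff m p *: F (m 0) (m 2%:R) (m 1).

Let lextwE p n : (mpoly.msize p <= n)%N ->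
  lext p = \sum_(m : mpoly.bmultinom 3 n) mpoly.mcoeff m p *: F (m 0) (m 2%:R) (m 1).
Proof.
move=> le_pn; rewrite /lext (ssrcomplements.big_mksub (mpoly.bmultinom 3 n)) /=; first last.
  by move=> m /mpoly.msize_mdeg_lt/leq_trans; apply.
  by rewrite mpoly.msupp_uniq.
by rewrite big_rmcond //= => m /mpoly.memN_msupp_eq0 ->; rewrite scale0r.
Qed.

Lemma lext_is_linear : linear lext.
Proof.
move=> c p q; pose n := maxn (mpoly.msize (c *: p + q))
  (maxn (mpoly.msize p) (mpoly.msize q)).
rewrite (@lextwE _ n) ?leq_maxl // (@lextwE p n) ?(@lextwE q n) ?leq_max ?leqnn ?orbT //.
rewrite scaler_sumr -big_split; apply: eq_bigr => m _ /=.
by rewrite mpoly.mcoeffD mpoly.mcoeffZ scalerDl scalerA.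
Qed.

HB.instance Definition _ := GRing.isLinear.Build K (U K) V *:%R lext lext_is_linear.

Lemma lext_umon i j k : lext (umon i j k) = F i j k.
Proof.
pose m : mpoly.multinom 3 := mpoly.mnm_add (mpoly.mnm_add
  (mpoly.mnm_muln (mpoly.mnm1 0) i) (mpoly.mnm_muln (mpoly.mnm1 2%:R) j))
  (mpoly.mnm_muln (mpoly.mnm1 1) k).
have -> : umon i j k = @mpoly.mpolyX 3 K m by rewrite !mpoly.mpolyXD -!mpoly.mpolyXn.
rewrite /lext mpoly.msuppX big_seq1 mpoly.mcoeffX eqxx scale1r.
by rewrite !mpoly.mnmDE !mpoly.mulmnE !mpoly.mnm1E /= !mul1n !mul0n !addn0.
Qed.

End LinearExtension.

End PolynomialModel.

(** * Modules free over the lower triangular part *)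

Section FreeModule.

Variables (K : fieldType) (I : finType).
Local Notation V := (I -> U K).
Implicit Types p q : V.

Lemma ffD p q i : (p + q) i = p i + q i. Proof. by []. Qed.
Lemma ffN p i : (- p) i = - p i. Proof. by []. Qed.
Lemma ffZ (c : K) p i : (c *: p) i = c *: p i. Proof. by []. Qed.
Lemma ff0 i : (0 : V) i = 0. Proof. by []. Qed.

Definition ffE := (ffD, ffN, ffZ, ff0).

Variables (a b : I -> K) (N1 N2 : {linear V -> V}).

Definition ff1 p : V := fun i => uf1 (p i).
Definition ff2 p : V := fun i => uf2 (p i).
Definition fh1 p : V := fun i =>
  a i *: p i - (ux K * dx (p i)) *+ 2 - uz K * dz (p i) + uy K * dy (p i).
Definition fh2 p : V := fun i =>
  b i *: p i - (uy K * dy (p i)) *+ 2 - uz K * dz (p i) + ux K * dx (p i).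
(** For u in U(n^-) and a generator v of weight (a, b), e_1 u v = [e_1, u] v + u e_1 v. The
    differential operator is the first term, as in a Verma module; [N1] is the second one, the
    U(n^-)-linear extension of the action of e_1 on the generators. *)
Definition fe1 p : V := fun i =>
  a i *: dx (p i) - ux K * dx (dx (p i)) - uz K * dz (dx (p i))
  + uy K * dy (dx (p i)) - uy K * dz (p i) + N1 p i.
Definition fe2 p : V := fun i =>
  b i *: dy (p i) - uy K * dy (dy (p i)) + ux K * dz (p i) + N2 p i.

Let unfoldE := (ff1, ff2, fh1, fh2, fe1, fe2).

Fact ff1_linear : linear ff1.
Proof. by move=> c p q; apply/funext => i; rewrite /ff1 /uf1 !ffE !scale_mpolyC; ring. Qed.
Fact ff2_linear : linear ff2.
Proof.
by move=> c p q; apply/funext => i;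
  rewrite /ff2 /uf2 !ffE !derivE !scale_mpolyC; ring.
Qed.
Fact fh1_linear : linear fh1.
Proof.
by move=> c p q; apply/funext => i; rewrite /fh1 !ffE !derivE !scale_mpolyC; ring.
Qed.
Fact fh2_linear : linear fh2.
Proof.
by move=> c p q; apply/funext => i; rewrite /fh2 !ffE !derivE !scale_mpolyC; ring.
Qed.
Fact fe1_linear : linear fe1.
Proof.
move=> c p q; apply/funext => i.
by rewrite /fe1 linfD linfZ !ffE !derivE !scale_mpolyC; ring.
Qed.
Fact fe2_linear : linear fe2.
Proof.
move=> c p q; apply/funext => i.
by rewrite /fe2 linfD linfZ !ffE !derivE !scale_mpolyC; ring.
Qed.

HB.instance Definition _ := GRing.isLinear.Build K V V *:%R ff1 ff1_linear.
HB.instance Definition _ := GRing.isLinear.Build K V V *:%R ff2 ff2_linear.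
HB.instance Definition _ := GRing.isLinear.Build K V V *:%R fh1 fh1_linear.
HB.instance Definition _ := GRing.isLinear.Build K V V *:%R fh2 fh2_linear.
HB.instance Definition _ := GRing.isLinear.Build K V V *:%R fe1 fe1_linear.
HB.instance Definition _ := GRing.isLinear.Build K V V *:%R fe2 fe2_linear.

(** [N1] and [N2] are U(n^-)-linear and of weight alpha_1 and alpha_2. The Chevalley relations then
    reduce to those of Verma modules, one generator at a time. *)
Record raising : Prop := Raising {
  ra_1f1 : forall p, N1 (ff1 p) = ff1 (N1 p);
  ra_1f2 : forall p, N1 (ff2 p) = ff2 (N1 p);
  ra_1h1 : forall p, fh1 (N1 p) = N1 (fh1 p) + 2%:R *: N1 p;
  ra_1h2 : forall p, fh2 (N1 p) = N1 (fh2 p) - N1 p;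
  ra_2f1 : forall p, N2 (ff1 p) = ff1 (N2 p);
  ra_2f2 : forall p, N2 (ff2 p) = ff2 (N2 p);
  ra_2h1 : forall p, fh1 (N2 p) = N2 (fh1 p) - N2 p;
  ra_2h2 : forall p, fh2 (N2 p) = N2 (fh2 p) + 2%:R *: N2 p }.

Hypothesis ra : raising.

Lemma free_chevalley : chevalley fe1 fe2 ff1 ff2 fh1 fh2.
Proof.
have at_i p q i : p = q -> p i = q i by move->.
split=> p; apply/funext => i; rewrite ?ffE.
- by rewrite /fh1 /fh2 !derivE !scale_mpolyC; ring.
- have N1h : N1 (fh1 p) i = fh1 (N1 p) i - 2%:R *: N1 p i.
    by rewrite (ra_1h1 ra) ffE addrK.
  by rewrite /fe1 N1h /fh1 !derivE !scale_mpolyC; ring.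
- have N2h : N2 (fh1 p) i = fh1 (N2 p) i + N2 p i by rewrite (ra_2h1 ra) !ffE subrK.
  by rewrite /fe2 N2h /fh1 !derivE !scale_mpolyC; ring.
- have N1h : N1 (fh2 p) i = fh2 (N1 p) i + N1 p i by rewrite (ra_1h2 ra) !ffE subrK.
  by rewrite /fe1 N1h /fh2 !derivE !scale_mpolyC; ring.
- have N2h : N2 (fh2 p) i = fh2 (N2 p) i - 2%:R *: N2 p i.
    by rewrite (ra_2h2 ra) ffE addrK.
  by rewrite /fe2 N2h /fh2 !derivE !scale_mpolyC; ring.
- by rewrite /fh1 /ff1 /uf1 !derivE !scale_mpolyC; ring.
- by rewrite /fh1 /ff2 /uf2 !derivE !scale_mpolyC; ring.
- by rewrite /fh2 /ff1 /uf1 !derivE !scale_mpolyC; ring.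
- by rewrite /fh2 /ff2 /uf2 !derivE !scale_mpolyC; ring.
- rewrite /fe1 (ra_1f1 ra) /ff1 /fh1 /uf1 !derivE !scale_mpolyC; ring.
- rewrite /fe1 (ra_1f2 ra) /ff2 /uf2 !derivE !scale_mpolyC; ring.
- rewrite /fe2 (ra_2f1 ra) /ff1 /uf1 !derivE !scale_mpolyC; ring.
- rewrite /fe2 (ra_2f2 ra) /ff2 /fh2 /uf2 !derivE !scale_mpolyC; ring.
Qed.

Lemma free_serre_f p : serre ff1 ff2 p = 0 /\ serre ff2 ff1 p = 0.
Proof.
by split; apply/funext => i; rewrite /serre !ffE /ff1 /ff2 /uf1 /uf2 !derivE
  !scale_mpolyC; ring.
Qed.

End FreeModule.

Lemma chevalley_sym (K : fieldType) (V : lmodType K) (e1 e2 f1 f2 h1 h2 : V -> V) :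
  chevalley e1 e2 f1 f2 h1 h2 -> chevalley e2 e1 f2 f1 h2 h1.
Proof. by case=> hh *; split=> // v; rewrite hh. Qed.

(** The raising Serre element commutes with the lowering operators already before the Serre
    relations are imposed. On a module generated by lowering operators it therefore vanishes once it
    kills the generators. *)
Lemma serre_lowering (K : fieldType) (V : lmodType K)
    (e1 e2 f1 f2 h1 h2 : {linear V -> V}) : chevalley e1 e2 f1 f2 h1 h2 ->
  forall v, serre e1 e2 (f1 v) = f1 (serre e1 e2 v) /\
            serre e1 e2 (f2 v) = f2 (serre e1 e2 v).
Proof.
move=> ch v; pose lin := (linfE e1, linfE e2, linfE f1, linfE f2).
by split; rewrite /serre ?lin ?(chevalley_normal ch) ?lin ?(chevalley_normal ch)
  ?lin ?(chevalley_normal ch) ?lin ?(chevalley_normal ch) ?lin; lmod.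
Qed.

Lemma serreP (K : fieldType) (V : lmodType K) (e1 e2 : {linear V -> V}) c u v :
  serre e1 e2 (c *: u + v) = c *: serre e1 e2 u + serre e1 e2 v.
Proof. by rewrite /serre !linearP /=; lmod. Qed.

Lemma serre0 (K : fieldType) (V : lmodType K) (e1 e2 : {linear V -> V}) :
  serre e1 e2 0 = 0.
Proof. by rewrite /serre !linear0; lmod. Qed.

(** * Serre relations on free modules and their universal property *)

Section FreeModuleTheory.

Variables (K : fieldType) (I : finType) (a b : I -> K).
Local Notation V := (I -> U K).
Variables N1 N2 : {linear V -> V}.
Implicit Types p q : V.

Definition fgen (i : I) : V := fun j => (j == i)%:R.

Definition fmono (i : I) (u : U K) : V := fun j => if j == i then u else 0.

Lemma fmono_sum p : p = \sum_i fmono i (p i).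
Proof.
apply/funext => j.
rewrite (big_morph (fun q : V => q j) (fun p q => ffD p q j) (ff0 _ j)).
rewrite (bigD1 j) //= big1 /fmono ?eqxx ?addr0 // => i nij.
by rewrite eq_sym (negPf nij).
Qed.

Lemma fmonoP i c u u' : fmono i (c *: u + u') = c *: fmono i u + fmono i u'.
Proof.
by apply/funext => j; rewrite !ffE /fmono; case: ifP; rewrite ?scaler0 ?addr0.
Qed.

Lemma fmono_f1 i u : fmono i (uf1 u) = ff1 (fmono i u).
Proof. by apply/funext => j; rewrite /fmono /ff1; case: ifP => // _; rewrite /uf1 mulr0. Qed.

Lemma fmono_f2 i u : fmono i (uf2 u) = ff2 (fmono i u).
Proof.
by apply/funext => j; rewrite /fmono /ff2; case: ifP => // _;
  rewrite /uf2 dx0 !mulr0 addr0.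
Qed.

Lemma fmono1 i : fmono i 1 = fgen i.
Proof. by apply/funext => j; rewrite /fmono /fgen; case: eqP. Qed.

Lemma free_ind (P : V -> Prop) :
  (forall c p q, P p -> P q -> P (c *: p + q)) -> (forall i, P (fgen i)) ->
  (forall p, P p -> P (ff1 p)) -> (forall p, P p -> P (ff2 p)) ->
  P 0 -> forall p, P p.
Proof.
move=> PD Pg Pf1 Pf2 P0 p; rewrite (fmono_sum p).
apply: big_ind => // [q q' Pq Pq'|i _]; first by rewrite -[q]scale1r; apply: PD.
elim/u_ind: (p i) => [|c u u' Pu Pu'|u Pu|u Pu].
- by rewrite fmono1.
- by rewrite fmonoP; apply: PD.
- by rewrite fmono_f1; apply: Pf1.
- by rewrite fmono_f2; apply: Pf2.
Qed.

Lemma fh_gen i :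
  fh1 a (fgen i) = a i *: fgen i /\ fh2 b (fgen i) = b i *: fgen i.
Proof.
by split; apply/funext => j; rewrite /fh1 /fh2 ffE /fgen; case: eqP => [->|_];
  rewrite ?derivE ?dx1 ?dy1 ?dz1 ?scaler0; ring.
Qed.

Lemma fe_gen i : fe1 a N1 (fgen i) = N1 (fgen i) /\ fe2 b N2 (fgen i) = N2 (fgen i).
Proof.
by split; apply/funext => j; rewrite /fe1 /fe2 /fgen; case: eqP => [->|_];
  rewrite ?derivE ?dx1 ?dy1 ?dz1 ?scaler0 ?dx0 ?dy0 ?dz0 ?scaler0; ring.
Qed.

Hypothesis ra : raising a b N1 N2.
Hypothesis se1 : forall i, serre (fe1 a N1) (fe2 b N2) (fgen i) = 0.
Hypothesis se2 : forall i, serre (fe2 b N2) (fe1 a N1) (fgen i) = 0.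

Let ch := free_chevalley ra.

Fact free_serre1 p : serre (fe1 a N1) (fe2 b N2) p = 0.
Proof.
elim/free_ind: p => [c p q Sp Sq|//|p Sp|p Sp|].
- by rewrite serreP Sp Sq scaler0 addr0.
- by rewrite (serre_lowering ch p).1 Sp linear0.
- by rewrite (serre_lowering ch p).2 Sp linear0.
- exact: serre0.
Qed.

Fact free_serre2 p : serre (fe2 b N2) (fe1 a N1) p = 0.
Proof.
elim/free_ind: p => [c p q Sp Sq|//|p Sp|p Sp|].
- by rewrite serreP Sp Sq scaler0 addr0.
- by rewrite (serre_lowering (chevalley_sym ch) p).2 Sp linear0.
- by rewrite (serre_lowering (chevalley_sym ch) p).1 Sp linear0.
- exact: serre0.
Qed.

Definition free_module : sl3_module K := chevalley_module ch free_serre1 free_serre2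
  (fun p => (free_serre_f p).1) (fun p => (free_serre_f p).2).

Lemma free_act p :
  [/\ @act K free_module xe1 p = fe1 a N1 p, @act K free_module xe2 p = fe2 b N2 p,
      @act K free_module xf1 p = ff1 p & @act K free_module xf2 p = ff2 p]
  /\ (@act K free_module xh1 p = fh1 a p /\ @act K free_module xh2 p = fh2 b p).
Proof. exact: chevalley_module_act. Qed.

Section Extension.

Variables (N : sl3_module K).

(** The map u |-> u n, written in the ordered basis f_1^i f_3^j f_2^k. *)
Definition uext (n : N) : U K -> N := lext (fun i j k =>
  iter i (act xf1) (iter j (act (lie xf2 xf1)) (iter k (act xf2) n))).

HB.instance Definition _ n := GRing.Linear.on (uext n).

Lemma uext1 n : uext n 1 = n.
Proof. by rewrite -[1]mulr1 -[1 * 1]mulr1 -{1}(expr0 (ux K)) -{1}(expr0 (uz K))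
  -(expr0 (uy K)) [LHS]lext_umon. Qed.

Lemma uext_f1 n u : uext n (uf1 u) = act xf1 (uext n u).
Proof.
elim/umon_ind: u => [|c u u' IHu IHu'|i j k].
- by rewrite /uf1 mulr0 !linear0.
- have -> : uf1 (c *: u + u') = c *: uf1 u + uf1 u'.
    by rewrite /uf1 !scale_mpolyC; ring.
  by rewrite !linearP /= IHu IHu'.
- by rewrite uf1_umon /uext !lext_umon.
Qed.

Lemma uext_f2 n u : uext n (uf2 u) = act xf2 (uext n u).
Proof.
elim/umon_ind: u => [|c u u' IHu IHu'|i j k].
- by rewrite /uf2 dx0 !mulr0 addr0 !linear0.
- have -> : uf2 (c *: u + u') = c *: uf2 u + uf2 u'.
    by rewrite /uf2 !derivE !scale_mpolyC; ring.
  by rewrite !linearP /= IHu IHu'.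
have [_ [_ f13 f23]] := lie_gens K.
set w := iter k (act xf2) n.
have f2f3 m : act xf2 (iter m (act (lie xf2 xf1)) w) =
    iter m (act (lie xf2 xf1)) (act xf2 w) :> N.
  by elim: m => //= m IHm; rewrite act_comm f23 act0l addr0 IHm.
case: i => [|i]; first by rewrite uf2_umon0 /uext !lext_umon /= f2f3.
(* Since f_3 commutes with f_1, f_2 f_1^(m+1) = f_1^(m+1) f_2 + (m+1) f_1^m f_3, which is the
   derivative term of [uf2]. *)
have f2f1 m (t : N) : act xf2 (iter m.+1 (act xf1) t) = iter m.+1 (act xf1) (act xf2 t)
    + m.+1%:R *: iter m (act xf1) (act (lie xf2 xf1) t).
  elim: m t => [|m IHm] t; first by rewrite /= act_comm scale1r.
  rewrite [iter m.+2 _ t]/= act_comm IHm actD actZ -addrA; congr (_ + _).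
  have f3f1 : act (lie xf2 xf1) (iter m.+1 (act xf1) t)
      = iter m.+1 (act xf1) (act (lie xf2 xf1) t).
    elim: m.+1 => //= l; rewrite act_comm => ->.
    have lieC : lie (lie xf2 xf1) xf1 = - lie xf1 (lie xf2 xf1) :> sl3 K.
      by apply: val_inj; rewrite /= opprB.
    by rewrite lieC f13 oppr0 act0l addr0.
  by rewrite f3f1 /= -[m.+2]addn1 natrD; lmod.
rewrite uf2_umonS linearD linearZ_LR /= /uext !lext_umon.
by rewrite f2f1 f2f3.
Qed.

Definition free_ext (n : I -> N) p : N := \sum_i uext (n i) (p i).

Fact free_ext_linear n : linear (free_ext n).
Proof.
move=> c p q; rewrite /free_ext scaler_sumr -big_split; apply: eq_bigr => i _.
exact: linearP.
Qed.

HB.instance Definition _ n :=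
  GRing.isLinear.Build K V N *:%R (free_ext n) (free_ext_linear n).

Lemma free_ext_gen n i : free_ext n (fgen i) = n i.
Proof.
rewrite /free_ext (bigD1 i) //= big1 => [|j nji]; first by rewrite /fgen eqxx uext1 addr0.
by rewrite /fgen (negPf nji) linear0.
Qed.

Lemma free_ext_f1 n p : free_ext n (ff1 p) = act xf1 (free_ext n p).
Proof. by rewrite linear_sum; apply: eq_bigr => i _; apply: uext_f1. Qed.

Lemma free_ext_f2 n p : free_ext n (ff2 p) = act xf2 (free_ext n p).
Proof. by rewrite linear_sum; apply: eq_bigr => i _; apply: uext_f2. Qed.

Section Equivariance.

Variable n : I -> N.
Hypothesis nh1 : forall i, act xh1 (n i) = a i *: n i.
Hypothesis nh2 : forall i, act xh2 (n i) = b i *: n i.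
Hypothesis ne1 : forall i, act xe1 (n i) = free_ext n (N1 (fgen i)).
Hypothesis ne2 : forall i, act xe2 (n i) = free_ext n (N2 (fgen i)).

Let nch := act_chevalley N.

Let ext_h1 p : free_ext n (fh1 a p) = act xh1 (free_ext n p).
Proof.
elim/free_ind: p => [c p q IHp IHq|i|p IHp|p IHp|]; last by rewrite !linear0.
- by rewrite !linearP /= IHp IHq.
- by rewrite (fh_gen i).1 linearZ_LR /= free_ext_gen nh1.
- rewrite (ch_h1f1 ch) linearB linearZ_LR /= !free_ext_f1 IHp.
  by rewrite (ch_h1f1 nch).
- rewrite (ch_h1f2 ch) linearD /= !free_ext_f2 IHp.
  by rewrite (ch_h1f2 nch).
Qed.

Let ext_h2 p : free_ext n (fh2 b p) = act xh2 (free_ext n p).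
Proof.
elim/free_ind: p => [c p q IHp IHq|i|p IHp|p IHp|]; last by rewrite !linear0.
- by rewrite !linearP /= IHp IHq.
- by rewrite (fh_gen i).2 linearZ_LR /= free_ext_gen nh2.
- rewrite (ch_h2f1 ch) linearD /= !free_ext_f1 IHp.
  by rewrite (ch_h2f1 nch).
- rewrite (ch_h2f2 ch) linearB linearZ_LR /= !free_ext_f2 IHp.
  by rewrite (ch_h2f2 nch).
Qed.

Let ext_e1 p : free_ext n (fe1 a N1 p) = act xe1 (free_ext n p).
Proof.
elim/free_ind: p => [c p q IHp IHq|i|p IHp|p IHp|]; last by rewrite !linear0.
- by rewrite !linearP /= IHp IHq.
- by rewrite (fe_gen i).1 free_ext_gen ne1.
- by rewrite (ch_e1f1 ch) linearD /= !free_ext_f1 IHp ext_h1 (ch_e1f1 nch).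
- by rewrite (ch_e1f2 ch) /= !free_ext_f2 IHp (ch_e1f2 nch).
Qed.

Let ext_e2 p : free_ext n (fe2 b N2 p) = act xe2 (free_ext n p).
Proof.
elim/free_ind: p => [c p q IHp IHq|i|p IHp|p IHp|]; last by rewrite !linear0.
- by rewrite !linearP /= IHp IHq.
- by rewrite (fe_gen i).2 free_ext_gen ne2.
- by rewrite (ch_e2f1 ch) /= !free_ext_f1 IHp (ch_e2f1 nch).
- by rewrite (ch_e2f2 ch) linearD /= !free_ext_f2 IHp ext_h2 (ch_e2f2 nch).
Qed.

(** The extension commutes with f_1 and f_2 by construction. The relations imposed on the images of
    the generators give equivariance for h and e there, and the Chevalley relations propagate it
    along f_1 and f_2. *)
Lemma free_hom : exists f : sl3_hom free_module N, forall p, f p = free_ext n p.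
Proof.
suff P : (free_ext n : free_module -> N) \in @is_hom K free_module N.
  by exists (Sl3Hom P).
apply: is_hom_gens => [|v|v|v|v]; first exact: free_ext_linear.
- by have [[-> _ _ _] _] := free_act v; apply: ext_e1.
- by have [[_ -> _ _] _] := free_act v; apply: ext_e2.
- by have [[_ _ -> _] _] := free_act v; apply: free_ext_f1.
- by have [[_ _ _ ->] _] := free_act v; apply: free_ext_f2.
Qed.

End Equivariance.

Lemma free_hom_eq (f g : sl3_hom free_module N) :
  (forall i, f (fgen i) = g (fgen i)) -> forall p, f p = g p.
Proof.
move=> fg; elim/free_ind => [c p q IHp IHq|//|p IHp|p IHp|].
- by rewrite !hom_linear IHp IHq.
- by have [[_ _ <- _] _] := free_act p; rewrite !hom_act IHp.
- by have [[_ _ _ <-] _] := free_act p; rewrite !hom_act IHp.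
- by rewrite !hom0.
Qed.

End Extension.

End FreeModuleTheory.

(** * Verma modules and their duals *)

Section LoweredWeights.

Variable K : fieldType.
Implicit Types (M N : sl3_module K) (lam mu : 'rV[K]_3).

Definition lower lam (m n : nat) : 'rV[K]_3 :=
  lam - sl3_root K 0 1 *+ m - sl3_root K 1 2 *+ n.

Lemma wt1_lower lam m n : wt1 (lower lam m n) = wt1 lam - m%:R *+ 2 + n%:R.
Proof.
rewrite /lower !wt1D !wt1N !wt1Mn (wt_root01 K).1 (wt_root12 K).1.
by rewrite mulNrn opprK -mulrnA mulnC mulrnA.
Qed.

Lemma wt2_lower lam m n : wt2 (lower lam m n) = wt2 lam + m%:R - n%:R *+ 2.
Proof.
rewrite /lower !wt2D !wt2N !wt2Mn (wt_root01 K).2 (wt_root12 K).2.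
by rewrite mulNrn opprK -[2%:R *+ n]mulrnA mulnC mulrnA.
Qed.

Lemma weight_f1 lam m n M (v : M) : weight_vector (lower lam m n) v ->
  weight_vector (lower lam m.+1 n) (act xf1 v).
Proof.
move=> /weight_vectorP[w1 w2]; apply/weight_vectorP.
rewrite (ch_h1f1 (act_chevalley M)) (ch_h2f1 (act_chevalley M)) w1 w2 !actZ.
by rewrite !wt1_lower !wt2_lower; split; lmod.
Qed.

Lemma weight_f2 lam m n M (v : M) : weight_vector (lower lam m n) v ->
  weight_vector (lower lam m n.+1) (act xf2 v).
Proof.
move=> /weight_vectorP[w1 w2]; apply/weight_vectorP.
rewrite (ch_h1f2 (act_chevalley M)) (ch_h2f2 (act_chevalley M)) w1 w2 !actZ.
by rewrite !wt1_lower !wt2_lower; split; lmod.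
Qed.

Lemma weight_f3 lam m n M (v : M) : weight_vector (lower lam m n) v ->
  weight_vector (lower lam m.+1 n.+1) (act (lie xf2 xf1) v).
Proof.
move=> wv; rewrite act_lie -scaleN1r; apply: weight_vectorD.
  by apply/weight_f2/weight_f1.
by apply/weight_vectorZ/weight_f1/weight_f2.
Qed.

Lemma weight_e1 lam M (v : M) : weight_vector lam v ->
  weight_vector (lam + sl3_root K 0 1) (act xe1 v).
Proof. rewrite xe1.unlock; exact: weight_root_elt. Qed.

Lemma weight_e2 lam M (v : M) : weight_vector lam v ->
  weight_vector (lam + sl3_root K 1 2%:R) (act xe2 v).
Proof. rewrite xe2.unlock; exact: weight_root_elt. Qed.

Lemma lower00 lam : lower lam 0 0 = lam.
Proof. by rewrite /lower !mulr0n !subr0. Qed.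

Lemma weight_uext lam M (v : M) i j k : weight_vector lam v ->
  weight_vector (lower lam (i + j) (j + k)) (uext v (umon K i j k)).
Proof.
rewrite -{1}(lower00 lam) /uext lext_umon => wv.
have w2 : weight_vector (lower lam 0 k) (iter k (act xf2) v).
  by elim: k => //= k; apply: weight_f2.
have w3 : weight_vector (lower lam j (j + k))
    (iter j (act (lie xf2 xf1)) (iter k (act xf2) v)).
  by elim: j => //= j; rewrite addSn; apply: weight_f3.
by elim: i => //= i; rewrite addSn; apply: weight_f1.
Qed.

End LoweredWeights.

(** * Verma modules as free modules of rank one *)

Section Verma.

Variables (K : fieldType).
Implicit Types (lam : 'rV[K]_3) (M N : sl3_module K).

Local Notation V := (unit -> U K).
Local Notation zmap := (\0 : {linear V -> V}).

Fact verma_raising lam : raising (fun=> wt1 lam) (fun=> wt2 lam) zmap zmap.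
Proof.
by split=> p; rewrite /= ?linear0 ?scaler0 ?addr0 ?subr0.
Qed.

Fact verma_serre (a b : unit -> K) i :
  serre (fe1 a zmap) (fe2 b zmap) (fgen K i) = 0 /\
  serre (fe2 b zmap) (fe1 a zmap) (fgen K i) = 0.
Proof. by rewrite /serre !(fe_gen a b zmap zmap i).1 !(fe_gen a b zmap zmap i).2 /= !linear0; split; lmod. Qed.

Definition verma lam : sl3_module K := free_module (verma_raising lam)
  (fun i => (verma_serre _ _ i).1) (fun i => (verma_serre _ _ i).2).

Definition verma_gen lam : verma lam := fgen K tt.

Lemma verma_hom lam N (w : N) : singular_vector lam w ->
  exists f : sl3_hom (verma lam) N, forall p, f p = uext w (p tt).
Proof.
move=> /singular_vectorP[/weight_vectorP[w1 w2] [e1 e2]].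
have [|i|i|i|f fE] := @free_hom K unit _ _ _ _ (verma_raising lam)
  (fun i => (verma_serre _ _ i).1) (fun i => (verma_serre _ _ i).2) N (fun=> w) => //.
- by rewrite linear0.
- by rewrite linear0.
by exists f => p; rewrite fE /free_ext (big_pred1 tt) // => -[].
Qed.

Lemma verma_singular lam : singular_vector lam (verma_gen lam).
Proof.
have [[e1 e2 _ _] [h1 h2]] := free_act (verma_raising lam)
  (fun i => (verma_serre _ _ i).1) (fun i => (verma_serre _ _ i).2) (fgen K tt).
apply/singular_vectorP; split; first apply/weight_vectorP; split.
- exact: (etrans h1 (fh_gen (fun=> wt1 lam) (fun=> wt2 lam) tt).1).
- exact: (etrans h2 (fh_gen (fun=> wt1 lam) (fun=> wt2 lam) tt).2).
- exact: (etrans e1 (fe_gen (fun=> wt1 lam) (fun=> wt2 lam) zmap zmap tt).1).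
- exact: (etrans e2 (fe_gen (fun=> wt1 lam) (fun=> wt2 lam) zmap zmap tt).2).
Qed.

(** Uniqueness of universal objects; it allows computing in an abstract Verma module with
    polynomials. *)
Lemma is_verma_iso lam M (v : M) : singular_vector lam v ->
    (forall N (w : N), singular_vector lam w -> exists! f : sl3_hom M N, f v = w) ->
  exists (f : sl3_hom M (verma lam)) (g : sl3_hom (verma lam) M),
    [/\ f v = verma_gen lam, forall p, g p = uext v (p tt), cancel f g & cancel g f].
Proof.
move=> sv univ; have [f [fv _]] := univ _ _ (verma_singular lam).
have [g gE] := verma_hom sv; exists f, g.
have gv : g (verma_gen lam) = v by rewrite gE /verma_gen /fgen uext1.
split=> // [u|p].
  have [h [_ huniq]] := univ _ _ sv.
  have := huniq (hcomp g f); rewrite /= fv => /(_ gv) h1.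
  have := huniq (idhom M) erefl; rewrite h1 => /(congr1 (fun k : sl3_hom M M => k u)) /= ->.
  by [].
rewrite -[RHS]/(idhom _ p) -[LHS]/(hcomp f g p).
by apply: free_hom_eq => -[]; rewrite /= -[fgen _ _]/(verma_gen lam) gv.
Qed.

End Verma.

(** * Lifting along the raising operators *)

Section Lifting.

Variable K : fieldType.
Implicit Types (lam mu : 'rV[K]_3) (M N A B : sl3_module K).

(* These are the cocycle conditions of n^+ at the two Serre relations, so that
   the property below says that H^1(n^+, N) vanishes. *)
Definition compatible N (n1 n2 : N) : Prop :=
  act xe1 (act xe1 n2) - 2%:R *: act xe1 (act xe2 n1) + act xe2 (act xe1 n1) = 0 /\
  act xe2 (act xe2 n1) - 2%:R *: act xe2 (act xe1 n2) + act xe1 (act xe2 n2) = 0.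

Definition acyclic N : Prop := forall n1 n2 : N, compatible n1 n2 ->
  exists n, act xe1 n = n1 /\ act xe2 n = n2.

Section DualVerma.

Variables (a b : nat -> nat -> nat -> K).

(* The value on x^i z^j y^k of a functional whose composites with f_1 and f_2
   are a and b, in view of z = f_2 x - x y. *)
Definition primitive (i j k : nat) : K^o :=
  if i is i'.+1 then a i' j k else
  if k is k'.+1 then b 0 j k' else
  if j is j'.+1 then b 1 j' 0 - a 0 j' 1 else 0.

End DualVerma.

(** By transposition, a functional is wanted whose composites with f_1 and f_2 are prescribed. As
    [M] is free of rank one over U(n^-), its values on nonconstant monomials are forced, its value
    on the generator is free, and the cocycle conditions make the forced values consistent. *)
Lemma acyclic_dual_verma M lam : is_verma lam M -> acyclic (dual_module M).
Proof.
move=> [v sv univ] xi1 xi2 [c1 c2].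
have [f [g [fv gE fK gK]]] := is_verma_iso sv univ.
have [tr_gens _] := sl3_tr_gens K.
have actd x (xi : dual_module M) u : (act x xi : dual_space M) u = xi (act (sl3_tr x) u).
  by [].
have vD := functD (dual_linear _); have vZ := functZ (dual_linear _).
have {}c1 u : xi2 (act xf1 (act xf1 u)) - 2%:R * xi1 (act xf2 (act xf1 u))
    + xi1 (act xf1 (act xf2 u)) = 0.
  have [t1 t2 _ _] := tr_gens.
  by move/(congr1 (fun xi : dual_space M => xi u)): c1 => /=; rewrite /= t1 t2.
have {}c2 u : xi1 (act xf2 (act xf2 u)) - 2%:R * xi2 (act xf1 (act xf2 u))
    + xi2 (act xf2 (act xf1 u)) = 0.
  have [t1 t2 _ _] := tr_gens.
  by move/(congr1 (fun xi : dual_space M => xi u)): c2 => /=; rewrite /= t1 t2.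
pose m i j k : M := uext v (umon K i j k).
pose F := primitive (fun i j k => xi1 (m i j k)) (fun i j k => xi2 (m i j k)).
pose xi (u : M) : K^o := lext F (f u tt).
have mf1 i j k : act xf1 (m i j k) = m i.+1 j k by rewrite -uext_f1 uf1_umon.
have mf20 j k : act xf2 (m 0 j k) = m 0 j k.+1 by rewrite -uext_f2 uf2_umon0.
have mf2S i j k : act xf2 (m i.+1 j k) = m i.+1 j k.+1 + i.+1%:R *: m i j.+1 k.
  by rewrite -uext_f2 uf2_umonS linearD linearZ_LR.
have x1D := functD (dual_linear xi1); have x1Z := functZ (dual_linear xi1).
have x2D := functD (dual_linear xi2); have x2Z := functZ (dual_linear xi2).
have x10 := funct0 (dual_linear xi1); have x20 := funct0 (dual_linear xi2).
have xi_f1 q : lext F (uf1 q) = xi1 (uext v q).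
  elim/umon_ind: q => [|c q q' IHq IHq'|i j k].
  - by rewrite /uf1 mulr0 !linear0 x10.
  - have -> : uf1 (c *: q + q') = c *: uf1 q + uf1 q'.
      by rewrite /uf1 !scale_mpolyC; ring.
    by rewrite !linearP /= IHq IHq' x1D x1Z.
  - by rewrite uf1_umon lext_umon.
have xi_f2 q : lext F (uf2 q) = xi2 (uext v q).
  elim/umon_ind: q => [|c q q' IHq IHq'|i j k].
  - by rewrite /uf2 dx0 !mulr0 addr0 !linear0 x20.
  - have -> : uf2 (c *: q + q') = c *: uf2 q + uf2 q'.
      by rewrite /uf2 !derivE !scale_mpolyC; ring.
    by rewrite !linearP /= IHq IHq' x2D x2Z.
  case: i => [|i]; first by rewrite uf2_umon0 lext_umon.
  rewrite uf2_umonS linearD linearZ_LR /= !lext_umon /F.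
  (* If the exponent of x is at least 2, the first cocycle condition applies. If it is 1, the case k
     > 0 uses the second one, and k = 0 is the definition of [primitive]. *)
  case: i => [|i]; last first.
    have f1f2 : act xf1 (act xf2 (m i j k)) = m i.+1 j k.+1 + i%:R *: m i j.+1 k.
      by case: i => [|i]; rewrite ?mf20 ?mf2S ?actD ?actZ !mf1 ?scale0r ?addr0.
    have /eqP := c1 (m i j k); rewrite f1f2 !mf1 mf2S !(x1D, x1Z) addrAC subr_eq0.
    rewrite -subr_eq0 => /eqP e; apply/esym/eqP; rewrite -subr_eq0 -[X in _ == X]e.
    by apply/eqP; rewrite /= -[_ *: _]/(_ * _) -[i.+2]addn1 -[i.+1]addn1 !natrD; ring.
  case: k => [|k]; first by rewrite /= scale1r addrC subrK.
  have /eqP := c2 (m 0 j k); rewrite !mf20 !mf1 mf2S !(x2D, x2Z) => /eqP e.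
  apply/esym/eqP; rewrite -subr_eq0 -[X in _ == X]oppr0 -e.
  by apply/eqP; rewrite /= -[_ *: _]/(_ * _); ring.
have fact (x : sl3 K) u (op : (unit -> U K) -> unit -> U K) :
    (forall p, @act K (verma lam) x p = op p) -> f (act x u) tt = op (f u) tt.
  by move=> opE; rewrite hom_act -opE.
have fa p := free_act (verma_raising lam)
  (fun i => (verma_serre _ _ i).1) (fun i => (verma_serre _ _ i).2) p.
have xi1E u : xi (act xf1 u) = xi1 u.
  rewrite /xi (fact _ _ (@ff1 K unit)) => [|p]; last by case: (fa p) => -[].
  by rewrite /ff1 xi_f1 -gE fK.
have xi2E u : xi (act xf2 u) = xi2 u.
  rewrite /xi (fact _ _ (@ff2 K unit)) => [|p]; last by case: (fa p) => -[].
  by rewrite /ff2 xi_f2 -gE fK.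
have xi_lin : linear xi by move=> c u w; rewrite /xi hom_linear ffE linearP.
suff xi_dual : xi \in @is_dual K M.
  exists (DualSpace xi_dual); have [t1 t2 _ _] := tr_gens.
  by split; apply: val_inj; apply/funext => u /=; rewrite ?t1 ?t2 ?xi1E ?xi2E.
have /asboolP[_ [s1 s1P]] := dual_proof xi1.
have /asboolP[_ [s2 s2P]] := dual_proof xi2.
apply/asboolP; split=> //.
(* The functional must live on finitely many weight spaces: a monomial on which it is nonzero has a
   weight of [xi1] lowered by alpha_1 or a weight of [xi2] lowered by alpha_2. *)
exists ([seq mu - sl3_root K 0 1 | mu <- s1] ++ [seq mu - sl3_root K 1 2%:R | mu <- s2]).
move=> mu u wu nz; set ss := _ ++ _.
have wm i j k : weight_vector (lower lam (i + j) (j + k)) (m i j k).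
  by case/singular_vectorP: sv => wv _; apply: weight_uext.
have xim i j k : xi (m i j k) = F i j k.
  rewrite /xi; have -> : m i j k = g (fun=> umon K i j k) by rewrite gE.
  by rewrite gK lext_umon.
have [i [j [k [same Fnz]]]] : exists i j k,
    same_weight (lower lam (i + j) (j + k)) mu /\ F i j k != 0.
  have : u = \sum_(l <- mpoly.msupp (f u tt)) mpoly.mcoeff l (f u tt) *:
      m (l 0) (l 2%:R) (l 1).
    rewrite -{1}(fK u) gE {1}(mpoly.mpolyE (f u tt)) linear_sum; apply: eq_bigr => l _.
    by rewrite linearZ_LR /= mpolyX_umon.
  rewrite big_tnth => uE.
  have := weight_component wu (fun l => weight_vectorZ _ (wm _ _ _)) uE.
  move/(congr1 xi); rewrite (funct_sum xi_lin) => xiE.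
  have /existsP[l /andP[same Fnz]] : [exists l, same_weight
      (lower lam ((tnth (in_tuple (mpoly.msupp (f u tt))) l) 0%R
        + (tnth (in_tuple (mpoly.msupp (f u tt))) l) 2%:R)
      ((tnth (in_tuple (mpoly.msupp (f u tt))) l) 2%:R
        + (tnth (in_tuple (mpoly.msupp (f u tt))) l) 1%R)) mu
      && (F ((tnth (in_tuple (mpoly.msupp (f u tt))) l) 0%R)
        ((tnth (in_tuple (mpoly.msupp (f u tt))) l) 2%:R)
        ((tnth (in_tuple (mpoly.msupp (f u tt))) l) 1%R) != 0)].
    apply: contraNT nz; rewrite negb_exists => /forallP Fz; rewrite xiE.
    rewrite big1 // => l same; have := Fz l; rewrite same /= negbK => /eqP Fl.
    by rewrite (functZ xi_lin) xim Fl mulr0.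
  by do 3 eexists; split; [exact: same|exact: Fnz].
have wt : weight_vector mu (m i j k) by apply: same_weight_vector same (wm i j k).
have mem1 i' j' k' : xi1 (m i' j' k') != 0 -> (i' + j').+1 = (i + j)%N ->
    (j' + k')%N = (j + k)%N -> exists2 nu, nu \in ss & weight_vector nu u.
  move=> nz1 e1 e2; have [nu nus wnu] := s1P _ _ (wm i' j' k') nz1.
  have mnz : m i' j' k' != 0 by apply: contraNneq nz1 => ->; rewrite x10.
  exists (nu - sl3_root K 0 1); first by rewrite mem_cat; apply/orP; left; apply/mapP; exists nu.
  have /andP[/eqP d1 /eqP d2] := weight_vector_same mnz (wm i' j' k') wnu.
  apply: same_weight_vector wu; rewrite same_weightC; apply: same_weight_trans same.
  rewrite /same_weight wt1D wt2D wt1N wt2N -d1 -d2 (wt_root01 K).1 (wt_root01 K).2.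
  rewrite !wt1_lower !wt2_lower -e1 e2 -[(i' + j').+1]addn1 !natrD; apply/andP; split; apply/eqP; ring.
have mem2 i' j' k' : xi2 (m i' j' k') != 0 -> (i' + j')%N = (i + j)%N ->
    (j' + k').+1 = (j + k)%N -> exists2 nu, nu \in ss & weight_vector nu u.
  move=> nz1 e1 e2; have [nu nus wnu] := s2P _ _ (wm i' j' k') nz1.
  have mnz : m i' j' k' != 0 by apply: contraNneq nz1 => ->; rewrite x20.
  exists (nu - sl3_root K 1 2%:R); first by rewrite mem_cat; apply/orP; right; apply/mapP; exists nu.
  have /andP[/eqP d1 /eqP d2] := weight_vector_same mnz (wm i' j' k') wnu.
  apply: same_weight_vector wu; rewrite same_weightC; apply: same_weight_trans same.
  rewrite /same_weight wt1D wt2D wt1N wt2N -d1 -d2 (wt_root12 K).1 (wt_root12 K).2.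
  rewrite !wt1_lower !wt2_lower e1 -e2 -[(j' + k').+1]addn1 !natrD; apply/andP; split; apply/eqP; ring.
move: Fnz; rewrite /F /primitive.
case: i mem1 mem2 {same wt} => [|i] mem1 mem2; last by move/mem1; apply.
case: k mem1 mem2 => [|k] mem1 mem2; last by move/mem2; apply; rewrite ?addnS.
case: j mem1 mem2 => [|j] mem1 mem2; first by rewrite eqxx.
have [->|nz2 _] := eqVneq (xi2 (m 1 j 0)) 0.
  by rewrite sub0r oppr_eq0 => /mem1; apply; rewrite ?addn1 ?addn0.
by apply: (mem2 _ _ _ nz2); rewrite ?addn0.
Qed.

Lemma compatible_hom M N (f : sl3_hom M N) n1 n2 :
  compatible n1 n2 -> compatible (f n1) (f n2).
Proof.
case=> c1 c2; split; [move/(congr1 f): c1|move/(congr1 f): c2];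
  by rewrite hom0 linearD linearB /= homZ !hom_act.
Qed.

Lemma acyclic_iso M N : sl3_iso M N -> acyclic N -> acyclic M.
Proof.
move=> [f g fK gK] aN n1 n2 /(compatible_hom f)/aN[n [e1 e2]].
by exists (g n); rewrite -!hom_act e1 e2 !fK.
Qed.

(** Vanishing of H^1 passes to extensions: solve in the quotient, lift the solution, and correct the
    error, which is again a cocycle, in the submodule. *)
Lemma acyclic_flag M : has_flag (fun N => exists lam, is_dual_verma lam N) M ->
  acyclic M.
Proof.
elim=> {M} [M M0|A M B i p inj_i surj_p exact_ip _ aA [lam [V [VV [iso]]]]] n1 n2 c.
  by exists 0; rewrite [n1]M0 [n2]M0 !act0.
have aB : acyclic B := acyclic_iso iso (acyclic_dual_verma VV).
have [b [b1 b2]] := aB _ _ (compatible_hom p c).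
have [m pm] := surj_p b.
have [a1 ia1] : exists a1, i a1 = n1 - act xe1 m.
  by apply/exact_ip; rewrite linearB /= hom_act pm b1 subrr.
have [a2 ia2] : exists a2, i a2 = n2 - act xe2 m.
  by apply/exact_ip; rewrite linearB /= hom_act pm b2 subrr.
have [|a [ea1 ea2]] := aA a1 a2.
  have [s1 s2 _ _] := act_serre m; case: c => c1 c2.
  split; apply: inj_i; rewrite hom0 linearD linearB /= homZ !hom_act ia1 ia2 !actB.
    by rewrite -[RHS](subrr 0) -{1}c1 -{1}s1 /serre; lmod.
  by rewrite -[RHS](subrr 0) -{1}c2 -{1}s2 /serre; lmod.
by exists (i a + m); rewrite !actD -!hom_act ea1 ea2 ia1 ia2 !subrK.
Qed.

(** The component of weight [mu] of any solution is again a solution, because e_1 and e_2 shift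
    weights by fixed roots. *)
Lemma acyclic_weight M mu (n1 n2 : M) : weight_module M -> acyclic M ->
    weight_vector (mu + sl3_root K 0 1) n1 ->
    weight_vector (mu + sl3_root K 1 2%:R) n2 -> compatible n1 n2 ->
  exists n, [/\ weight_vector mu n, act xe1 n = n1 & act xe2 n = n2].
Proof.
move=> wM aM w1 w2 /aM[n [en1 en2]].
have [l [b [/choice[lam wb] nE]]] := wM n.
have sumE x (i j : 'I_3) : x = root_elt K i j -> weight_vector (mu + sl3_root K i j) (act x n) ->
    act x (\sum_(k | same_weight (lam k) mu) b k) = act x n.
  move=> -> wn; rewrite linear_sum /=.
  have := weight_component wn (fun k => weight_root_elt i j (wb k)).
  rewrite -{1}linear_sum -nE => /(_ erefl) ->.
  by apply: eq_bigl => k; rewrite same_weightD.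
exists (\sum_(k | same_weight (lam k) mu) b k); split.
- by apply: weight_vector_sum => k same; apply: same_weight_vector same (wb k).
- by rewrite (sumE xe1 0 1) ?en1 // xe1.unlock.
- by rewrite (sumE xe2 1 2%:R) ?en2 // xe2.unlock.
Qed.

End Lifting.

(** * The big projective module *)

(** A copy of the Weyl group on which functions defined by [match] compute; [toW] is the bijection
    with permutations. *)
Inductive ix := I1 | Is | It | Ist | Its | Iw.

Definition ix_code (z : ix) : 'I_6 :=
  match z with
  | I1 => inord 0 | Is => inord 1 | It => inord 2
  | Ist => inord 3 | Its => inord 4 | Iw => inord 5
  end.

Definition ix_decode (i : 'I_6) : ix :=
  match val i with
  | 0 => I1 | 1 => Is | 2 => It | 3 => Ist | 4 => Its | _ => Iw
  end.

Lemma ix_codeK : cancel ix_code ix_decode.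
Proof. by case; rewrite /ix_decode /= inordK. Qed.

HB.instance Definition _ := Equality.copy ix (can_type ix_codeK).
HB.instance Definition _ := Choice.copy ix (can_type ix_codeK).
HB.instance Definition _ := Countable.copy ix (can_type ix_codeK).
HB.instance Definition _ := Finite.copy ix (can_type ix_codeK).

Definition ix_eqb (y z : ix) : bool :=
  match y, z with
  | I1, I1 | Is, Is | It, It | Ist, Ist | Its, Its | Iw, Iw => true
  | _, _ => false
  end.

Lemma ix_eqE (y z : ix) : (y == z) = ix_eqb y z.
Proof. by apply/eqP/idP => [->|]; case: y; case: z. Qed.

(* The Bruhat order: [ix_le y z] means y <= z. *)
Definition ix_le (y z : ix) : bool :=
  match y, z with
  | I1, _ | _, Iw => true
  | Is, (Is | Ist | Its) | It, (It | Ist | Its) | Ist, Ist | Its, Its => true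
  | _, _ => false
  end.

Section Families.

Variables (K : fieldType).

Definition ix_weight (z : ix) : 'rV[K]_3 :=
  match z with
  | I1 => lower 0 0 0 | Is => lower 0 1 0 | It => lower 0 0 1
  | Ist => lower 0 2 1 | Its => lower 0 1 2 | Iw => lower 0 2 2
  end.

Definition wta z : K := wt1 (ix_weight z).
Definition wtb z : K := wt2 (ix_weight z).

Let wt0 : wt1 (0 : 'rV[K]_3) = 0 /\ wt2 (0 : 'rV[K]_3) = 0.
Proof. by rewrite /wt1 /wt2 !mxE subrr. Qed.

Lemma wtaE z : wta z = match z with
  | I1 => 0 | Is => - 2%:R | It => 1 | Ist => - 3%:R | Its => 0 | Iw => - 2%:R end.
Proof. by rewrite /wta; case: z; rewrite wt1_lower wt0.1; ring. Qed.

Lemma wtbE z : wtb z = match z with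
  | I1 => 0 | Is => 1 | It => - 2%:R | Ist => 0 | Its => - 3%:R | Iw => - 2%:R end.
Proof. by rewrite /wtb; case: z; rewrite wt2_lower wt0.2; ring. Qed.

Section Theta.

Variables (V : lmodType K) (e1 e2 f1 f2 h1 h2 : V -> V).

(** The value of e_1 on the generator of weight st.0. The coefficients give e_1 [theta1] = 2 n_t and
    e_2 [theta1] = n_s, which makes ([theta1], 0) a cocycle; with the symmetric choice of [theta2],
    the pair (n_ts, n_st) is a cocycle as well. *)
Definition theta1 (n : ix -> V) : V :=
  2%:R *: f1 (n It) + f2 (n Is) - f1 (f2 (n I1)) - 2%:R *: f2 (f1 (n I1)).
Definition theta2 (n : ix -> V) : V :=
  2%:R *: f2 (n Is) + f1 (n It) - f2 (f1 (n I1)) - 2%:R *: f1 (f2 (n I1)).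

Definition raise1 (n : ix -> V) (z : ix) : V :=
  match z with Is => n I1 | Ist => theta1 n | Iw => n Its | _ => 0 end.
Definition raise2 (n : ix -> V) (z : ix) : V :=
  match z with It => n I1 | Its => theta2 n | Iw => n Ist | _ => 0 end.

(* The defining relations of the generators of the big projective module. *)
Definition family (n : ix -> V) (z : ix) : Prop :=
  [/\ h1 (n z) = wta z *: n z, h2 (n z) = wtb z *: n z,
      e1 (n z) = raise1 n z & e2 (n z) = raise2 n z].

End Theta.

Lemma family_theta (V : lmodType K) (e1 e2 f1 f2 h1 h2 : {linear V -> V}) n :
  chevalley e1 e2 f1 f2 h1 h2 ->
  family e1 e2 f1 f2 h1 h2 n I1 -> family e1 e2 f1 f2 h1 h2 n Is ->
  family e1 e2 f1 f2 h1 h2 n It ->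
  [/\ e1 (theta1 f1 f2 n) = 2%:R *: n It, e2 (theta1 f1 f2 n) = n Is,
      e1 (theta2 f1 f2 n) = n It & e2 (theta2 f1 f2 n) = 2%:R *: n Is].
Proof.
move=> ch [h11 h21 e11 e21] [h1s h2s e1s e2s] [h1t h2t e1t e2t].
pose lin := (linfE e1, linfE e2, linfE f1, linfE f2, linfE h1, linfE h2).
have rel := (h11, h21, e11, e21, h1s, h2s, e1s, e2s, h1t, h2t, e1t, e2t).
rewrite /theta1 /theta2; split;
  rewrite ?lin ?(chevalley_normal ch) ?lin ?(chevalley_normal ch) ?rel ?lin ?wtaE ?wtbE /=;
  rewrite ?lin; lmod.
Qed.

Lemma family_serre (V : lmodType K) (e1 e2 f1 f2 h1 h2 : {linear V -> V}) n :
  chevalley e1 e2 f1 f2 h1 h2 -> (forall z, family e1 e2 f1 f2 h1 h2 n z) ->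
  forall z, serre e1 e2 (n z) = 0 /\ serre e2 e1 (n z) = 0.
Proof.
move=> ch fam z; pose lin := (linfE e1, linfE e2).
have [t1 t2 t3 t4] := family_theta ch (fam I1) (fam Is) (fam It).
have [[_ _ e11 e21] [_ _ e1s e2s] [_ _ e1t e2t]] := And3 (fam I1) (fam Is) (fam It).
have [[_ _ e1st e2st] [_ _ e1ts e2ts] [_ _ e1w e2w]] := And3 (fam Ist) (fam Its) (fam Iw).
move: t1 t2 t3 t4 e11 e21 e1s e2s e1t e2t e1st e2st e1ts e2ts e1w e2w => /=.
move: (theta1 f1 f2 n) (theta2 f1 f2 n) => u v t1 t2 t3 t4 e11 e21 e1s e2s e1t e2t
  e1st e2st e1ts e2ts e1w e2w.
pose rel := (t1, t2, t3, t4, (e11, e21, e1s, e2s, e1t, e2t),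
  (e1st, e2st, e1ts, e2ts, e1w, e2w)).
by case: z; rewrite /serre; do 5?rewrite ?rel ?lin; split; lmod.
Qed.

Local Notation V := (ix -> U K).
Implicit Types p : V.

(* Right multiplication of x^i z^j y^k by f_1 and f_2. *)
Definition ur1 (u : U K) : U K := ux K * u + uz K * dy u.
Definition ur2 (u : U K) : U K := uy K * u.

(** The coefficient p_z of the generator v_z is multiplied on the right by the coefficients of e_1
    v_z; right multiplications commute with f_1 and f_2. *)
Definition big1 p : V := fun z =>
  match z with
  | I1 => p Is - ur2 (ur1 (p Ist)) - ur1 (ur2 (p Ist)) *+ 2
  | Is => ur2 (p Ist)
  | It => ur1 (p Ist) *+ 2
  | Its => p Iw
  | _ => 0
  end.

Definition big2 p : V := fun z =>
  match z with
  | I1 => p It - ur1 (ur2 (p Its)) - ur2 (ur1 (p Its)) *+ 2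
  | It => ur1 (p Its)
  | Is => ur2 (p Its) *+ 2
  | Ist => p Iw
  | _ => 0
  end.

Fact big1_linear : linear big1.
Proof.
by move=> c p q; apply/funext; case; rewrite /big1 /ur1 /ur2 /= !ffE ?derivE ?scale_mpolyC; ring.
Qed.
Fact big2_linear : linear big2.
Proof.
by move=> c p q; apply/funext; case; rewrite /big2 /ur1 /ur2 /= !ffE ?derivE ?scale_mpolyC; ring.
Qed.
HB.instance Definition _ := GRing.isLinear.Build K V V *:%R big1 big1_linear.
HB.instance Definition _ := GRing.isLinear.Build K V V *:%R big2 big2_linear.

Fact big_raising : raising wta wtb big1 big2.
Proof.
split=> p; apply/funext; case; rewrite ?ffE /fh1 /fh2 /ff1 /ff2 /big1 /big2 /=;
  rewrite ?ffE ?wtaE ?wtbE /uf1 /uf2 /ur1 /ur2 ?scaleNr ?scaler_nat ?scale1r ?scale0r;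
  rewrite ?derivE ?scale_mpolyC; ring.
Qed.

Lemma big_family z : family (fe1 wta big1) (fe2 wtb big2) (@ff1 K ix) (@ff2 K ix)
  (fh1 wta) (fh2 wtb) (@fgen K ix) z.
Proof.
split; [exact: (fh_gen wta wtb z).1|exact: (fh_gen wta wtb z).2| |];
  rewrite ?(fe_gen wta wtb big1 big2 z).1 ?(fe_gen wta wtb big1 big2 z).2;
  apply/funext; case: z; case; rewrite /raise1 /raise2 /theta1 /theta2 ?ffE
    /ff1 /ff2 /big1 /big2 /fgen /= ?ix_eqE /=
    /uf1 /uf2 /ur1 /ur2 ?scaler_nat ?derivE; ring.
Qed.

Definition big : sl3_module K := free_module big_raising
  (fun z => (family_serre (free_chevalley big_raising) big_family z).1)
  (fun z => (family_serre (free_chevalley big_raising) big_family z).2).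

Definition vgen (z : ix) : big := fgen K z.

Definition sl3_family (N : sl3_module K) (n : ix -> N) (z : ix) : Prop :=
  family (act xe1) (act xe2) (act xf1) (act xf2) (act xh1) (act xh2) n z.

Lemma big_act (p : big) :
  [/\ act xe1 p = fe1 wta big1 p, act xe2 p = fe2 wtb big2 p,
      act xf1 p = ff1 p & act xf2 p = ff2 p]
  /\ (act xh1 p = fh1 wta p /\ act xh2 p = fh2 wtb p).
Proof. exact: free_act. Qed.

Lemma big_sl3_family (n : ix -> big) z :
  family (fe1 wta big1) (fe2 wtb big2) (@ff1 K ix) (@ff2 K ix) (fh1 wta) (fh2 wtb) n z ->
  sl3_family n z.
Proof.
move=> [h1 h2 e1 e2].
have f1E (p : big) : act xf1 p = ff1 p by case: (big_act p) => -[].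
have f2E (p : big) : act xf2 p = ff2 p by case: (big_act p) => -[].
have [[E1 E2 _ _] [H1 H2]] := big_act (n z).
split; rewrite ?E1 ?E2 ?H1 ?H2 //.
- by apply: etrans e1 _; case: z {E1 E2 H1 H2 h1 h2 e2} => //; rewrite /raise1 /theta1 !f2E !f1E.
- by apply: etrans e2 _; case: z {E1 E2 H1 H2 h1 h2 e1} => //; rewrite /raise2 /theta2 !f2E !f1E.
Qed.

Lemma vgen_family z : sl3_family vgen z.
Proof. exact/big_sl3_family/big_family. Qed.

Lemma linear_comb4 (V V' : lmodType K) (f : {linear V -> V'}) u v w z :
  f (2%:R *: u + v - w - 2%:R *: z) = 2%:R *: f u + f v - f w - 2%:R *: f z.
Proof. by rewrite linfB linfB linfD !linfZ. Qed.

(* Universal property of the big projective module. *)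
Lemma big_hom (N : sl3_module K) (n : ix -> N) : (forall z, sl3_family n z) ->
  exists2 f : sl3_hom big N, (forall z, f (vgen z) = n z) &
    forall p, f p = \sum_z uext (n z) (p z).
Proof.
move=> fam; have rE1 z : free_ext n (raise1 (@ff1 K ix) (@ff2 K ix) (@fgen K ix) z)
    = raise1 (act xf1) (act xf2) n z.
  case: z => //=; rewrite ?linear0 ?free_ext_gen //; apply: etrans (linear_comb4 _ _ _ _ _) _.
  by rewrite /= !(free_ext_f1, free_ext_f2, free_ext_gen).
have rE2 z : free_ext n (raise2 (@ff1 K ix) (@ff2 K ix) (@fgen K ix) z)
    = raise2 (act xf1) (act xf2) n z.
  case: z => //=; rewrite ?linear0 ?free_ext_gen //; apply: etrans (linear_comb4 _ _ _ _ _) _.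
  by rewrite /= !(free_ext_f1, free_ext_f2, free_ext_gen).
have [|z|z|z|f fE] := @free_hom K ix wta wtb big1 big2 big_raising
  (fun z => (family_serre (free_chevalley big_raising) big_family z).1)
  (fun z => (family_serre (free_chevalley big_raising) big_family z).2) N n.
- by move=> z; case: (fam z).
- by case: (fam z).
- have [_ _ -> _] := fam z; rewrite -(fe_gen wta wtb big1 big2 z).1.
  by have [_ _ -> _] := big_family z; rewrite rE1.
- have [_ _ _ ->] := fam z; rewrite -(fe_gen wta wtb big1 big2 z).2.
  by have [_ _ _ ->] := big_family z; rewrite rE2.
by exists f => [z|p]; rewrite fE // free_ext_gen.
Qed.

Lemma big_hom_eq (N : sl3_module K) (f g : sl3_hom big N) :
  (forall z, f (vgen z) = g (vgen z)) -> f = g.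
Proof. by move=> fg; apply/val_inj/funext => p; apply: free_hom_eq. Qed.

End Families.

(** * Endomorphisms of the big projective module *)

Section Endomorphisms.

Variable K : fieldType.
Local Notation V := (ix -> U K).
Implicit Types p q : V.

Local Notation r1 := (@ur1 K).
Local Notation r2 := (@ur2 K).
Definition ur3 (u : U K) : U K := uz K * u.
Local Notation r3 := ur3.

(** The U(n^-)-linear map with the images [xgen] of the generators: it sends v_1 to 0 and v_s to f_1
    v_1, and the images of the higher generators are chosen so that the relations of [family]
    persist. Likewise [yop] sends v_t to f_2 v_1. *)
Definition xop p : V := fun z =>
  match z with
  | I1 => r1 (p Is) - r2 (r1 (r1 (p Ist))) - r3 (r1 (p Ist))
      - r2 (r2 (r1 (p Its))) *+ 2 - r2 (r3 (p Its)) *+ 3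
      - r3 (r3 (p Iw)) - r2 (r3 (r1 (p Iw)))
  | Is => r2 (r2 (p Its))
  | It => r1 (r1 (p Ist)) + r2 (r1 (p Its)) + r3 (p Its) *+ 2 + r3 (r1 (p Iw))
  | Ist => r2 (p Iw)
  | _ => 0
  end.

Definition yop p : V := fun z =>
  match z with
  | I1 => r2 (p It) - r2 (r1 (r1 (p Ist))) *+ 2 - r3 (r1 (p Ist))
      - r2 (r2 (r1 (p Its))) - r2 (r3 (p Its)) + r2 (r3 (r1 (p Iw)))
  | Is => r2 (r1 (p Ist)) - r3 (p Ist) + r2 (r2 (p Its)) - r2 (r3 (p Iw))
  | It => r1 (r1 (p Ist))
  | Its => r1 (p Iw)
  | _ => 0
  end.

Fact xop_linear : linear xop.
Proof.
by move=> c p q; apply/funext; case; rewrite /xop /yop ?ffE /= ?ffE /ur1 /ur2 /ur3 ?derivE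
  ?scale_mpolyC; ring.
Qed.
Fact yop_linear : linear yop.
Proof.
by move=> c p q; apply/funext; case; rewrite /xop /yop ?ffE /= ?ffE /ur1 /ur2 /ur3 ?derivE
  ?scale_mpolyC; ring.
Qed.
HB.instance Definition _ := GRing.isLinear.Build K V V *:%R xop xop_linear.
HB.instance Definition _ := GRing.isLinear.Build K V V *:%R yop yop_linear.

Lemma xop_f p : xop (ff1 p) = ff1 (xop p) /\ xop (ff2 p) = ff2 (xop p).
Proof.
by split; apply/funext; case; rewrite /= /ff1 /ff2 /= /uf1 /uf2 /ur1 /ur2 /ur3
  ?derivE; ring.
Qed.

Lemma yop_f p : yop (ff1 p) = ff1 (yop p) /\ yop (ff2 p) = ff2 (yop p).
Proof.
by split; apply/funext; case; rewrite /= /ff1 /ff2 /= /uf1 /uf2 /ur1 /ur2 /ur3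
  ?derivE; ring.
Qed.

Lemma big_op_hom (op : {linear V -> V}) :
  (forall p, op (ff1 p) = ff1 (op p) /\ op (ff2 p) = ff2 (op p)) ->
  (forall z, family (fe1 (@wta K) (@big1 K)) (fe2 (@wtb K) (@big2 K)) (@ff1 K ix) (@ff2 K ix)
     (fh1 (@wta K)) (fh2 (@wtb K)) (fun z => op (@fgen K ix z)) z) ->
  exists f : sl3_hom (big K) (big K), forall p, f p = op p.
Proof.
move=> opf fam; have [f fgen _] := big_hom (fun z => big_sl3_family (fam z)).
have f1E (p : big K) : act xf1 p = ff1 p by case: (big_act p) => -[].
have f2E (p : big K) : act xf2 p = ff2 p by case: (big_act p) => -[].
exists f; elim/free_ind => [c p q IHp IHq|z|p IHp|p IHp|].
- by rewrite hom_linear linearP IHp IHq.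
- exact: fgen.
- by rewrite (opf p).1 -IHp -!f1E hom_act.
- by rewrite (opf p).2 -IHp -!f2E hom_act.
- by rewrite hom0 linear0.
Qed.

Local Notation x := (ux K).
Local Notation y := (uy K).
Local Notation z := (uz K).

Definition xgen (i j : ix) : U K :=
  match i, j with
  | Is, I1 => x
  | Ist, It => x * x | Ist, I1 => - (x * x * y) - x * z
  | Its, Is => y * y | Its, It => x * y + z *+ 2
  | Its, I1 => - (x * y * y) *+ 2 - (z * y) *+ 3
  | Iw, Ist => y | Iw, It => x * z | Iw, I1 => - (z * z) - x * z * y
  | _, _ => 0
  end.

Definition ygen (i j : ix) : U K :=
  match i, j with
  | It, I1 => y
  | Ist, Is => x * y - z | Ist, It => x * x
  | Ist, I1 => - (x * x * y) *+ 2 - x * z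
  | Its, Is => y * y | Its, I1 => - (x * y * y) - z * y
  | Iw, Its => x | Iw, Is => - (z * y) | Iw, I1 => x * z * y
  | _, _ => 0
  end.

Lemma xop_gen i : xop (@fgen K ix i) = xgen i.
Proof.
by apply/funext; case: i; case; rewrite /= /fgen ?ix_eqE /= /ur1 /ur2 /ur3 ?derivE; ring.
Qed.

Lemma yop_gen i : yop (@fgen K ix i) = ygen i.
Proof.
by apply/funext; case: i; case; rewrite /= /fgen ?ix_eqE /= /ur1 /ur2 /ur3 ?derivE; ring.
Qed.

Lemma xgen_family i : family (fe1 (@wta K) (@big1 K)) (fe2 (@wtb K) (@big2 K)) (@ff1 K ix)
  (@ff2 K ix) (fh1 (@wta K)) (fh2 (@wtb K)) xgen i.
Proof.
by split; apply/funext; case: i; case; rewrite ?ffE /raise1 /raise2 /theta1 /theta2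
  ?ffE /fe1 /fe2 /fh1 /fh2 /ff1 /ff2 /= /uf1 /uf2 /ur1 /ur2 ?wtaE ?wtbE
  ?scaleNr ?scaler_nat ?scale0r ?scale1r ?derivE; ring.
Qed.

Lemma ygen_family i : family (fe1 (@wta K) (@big1 K)) (fe2 (@wtb K) (@big2 K)) (@ff1 K ix)
  (@ff2 K ix) (fh1 (@wta K)) (fh2 (@wtb K)) ygen i.
Proof.
by split; apply/funext; case: i; case; rewrite ?ffE /raise1 /raise2 /theta1 /theta2
  ?ffE /fe1 /fe2 /fh1 /fh2 /ff1 /ff2 /= /uf1 /uf2 /ur1 /ur2 ?wtaE ?wtbE
  ?scaleNr ?scaler_nat ?scale0r ?scale1r ?derivE; ring.
Qed.

End Endomorphisms.

(** * The coinvariant relations and the six basis endomorphisms *)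

Section EndomorphismTable.

Variable K : fieldType.
Local Notation V := (ix -> U K).
Implicit Types p q : V.
Local Notation r1 := (@ur1 K).
Local Notation r2 := (@ur2 K).
Local Notation r3 := (@ur3 K).

Lemma endX_exists : exists f : sl3_hom (big K) (big K), forall p, f p = xop p.
Proof.
have E : (fun i => xop (@fgen K ix i)) = @xgen K by apply/funext => i; apply: xop_gen.
by apply: big_op_hom => [|i]; [exact: (@xop_f K)|rewrite E; apply: xgen_family].
Qed.

Lemma endY_exists : exists f : sl3_hom (big K) (big K), forall p, f p = yop p.
Proof.
have E : (fun i => yop (@fgen K ix i)) = @ygen K by apply/funext => i; apply: yop_gen.
by apply: big_op_hom => [|i]; [exact: (@yop_f K)|rewrite E; apply: ygen_family].
Qed.

Lemma yop_xop p : yop (xop p) = xop (yop p).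
Proof.
by apply/funext; case; rewrite /= /ur1 /ur2 /ur3 ?derivE; ring.
Qed.

(** Together with [yop_xop] and [yop3], this is a presentation of the coinvariant algebra of S_3, of
    dimension six. *)
Lemma xop_xop p : xop (xop p) = xop (yop p) - yop (yop p).
Proof.
by apply/funext; case; rewrite ?ffE /= /ur1 /ur2 /ur3 ?derivE; ring.
Qed.

Lemma yop3 p : yop (yop (yop p)) = 0.
Proof.
by apply/funext; case; rewrite ?ffE /= /ur1 /ur2 /ur3 ?derivE; ring.
Qed.

Definition cop (i : ix) (p : V) : V :=
  match i with
  | I1 => p | Is => xop p | It => yop p | Ist => yop (yop p)
  | Its => xop (xop p) | Iw => xop (xop (yop p))
  end.

(** Right multiplication by the singular vector of weight i.0 in the dominant Verma module M(0), for
    instance f_1^2 f_2 for st: the embedding of M(i.0) in M(0). *)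
Definition shapovalov (i : ix) (u : U K) : U K :=
  match i with
  | I1 => u | Is => r1 u | It => r2 u | Ist => r2 (r1 (r1 u))
  | Its => r1 (r2 (r2 u)) | Iw => r1 (r2 (r2 (r1 u)))
  end.

(** On elements without components strictly above [i], the endomorphism sees only the component at
    [i] and embeds it in the copy of M(0) generated by v_1. *)
Lemma cop_top i p : (forall j, ix_le i j -> j != i -> p j = 0) ->
  cop i p = fmono I1 (shapovalov i (p i)).
Proof.
move=> p0; apply/funext => j.
have z1 : r1 0 = 0 by rewrite /ur1 dy0 !mulr0 addr0.
have z2 : r2 0 = 0 by rewrite /ur2 mulr0.
have z3 : r3 0 = 0 by rewrite /ur3 mulr0.
have -> : p = fun k => if ix_le i k && ~~ ix_eqb k i then 0 else p k.
  apply/funext => k; case: ifP => // /andP[le_ik nki].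
  by rewrite p0 // ix_eqE.
by case: i {p0}; case: j; rewrite /fmono ?ix_eqE /= ?z1 ?z2 ?z3 ?z1 ?z2 ?z3 ?z1 ?z2 ?z3;
  rewrite ?mul0rn ?addr0 ?add0r ?subr0 ?oppr0 ?addr0 ?z1 ?z2 ?z1 ?subr0 ?addr0.
Qed.

Lemma cop_gen_le i j : ~~ ix_le i j -> cop i (@fgen K ix j) = 0.
Proof.
case: i; case: j => // _; apply/funext; case;
  rewrite ?ffE /fgen /= ?ix_eqE /= /ur1 /ur2 /ur3 ?derivE; ring.
Qed.

End EndomorphismTable.

(** * Torsion-freeness and the antidominant Verma module *)

Section Lowering.

Variable K : numFieldType.
Implicit Types u v q : U K.

Local Notation x := (ux K).
Local Notation y := (uy K).
Local Notation z := (uz K).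

Lemma umonE i j k :
  umon K i j k = @mpoly.mpolyX 3 K (mpoly.mnm_add (mpoly.mnm_add
    (mpoly.mnm_muln (mpoly.mnm1 0) i) (mpoly.mnm_muln (mpoly.mnm1 2%:R) j))
    (mpoly.mnm_muln (mpoly.mnm1 1) k)).
Proof. by rewrite !mpoly.mpolyXD -!mpoly.mpolyXn. Qed.

Lemma ux_neq0 : x != 0.
Proof. by rewrite -mpoly.msupp_eq0 mpoly.msuppX. Qed.
Lemma uy_neq0 : y != 0.
Proof. by rewrite -mpoly.msupp_eq0 mpoly.msuppX. Qed.

Lemma dy_umon i j k : dy (umon K i j k) = k%:R *: umon K i j k.-1.
Proof.
have dX (w : U K) n : dy w = 0 -> dy (w ^+ n) = 0.
  by move=> dw; elim: n => [|n IHn]; rewrite ?dy1 // exprS dyM IHn dw mul0r mulr0 addr0.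
rewrite /umon !dyM (dX x _ (dyx K)) (dX z _ (dyz K)) mulr0 mul0r addr0 mul0r add0r.
case: k => [|k]; first by rewrite scale0r expr0 dy1 mulr0.
have -> : dy (y ^+ k.+1) = k.+1%:R * y ^+ k.
  elim: k => [|k IHk]; first by rewrite expr1 dyy mulr1.
  by rewrite exprS dyM IHk dyy [in RHS]mulrSr exprS; ring.
by rewrite scaler_nat -mulr_natl /=; ring.
Qed.

Lemma dx_umon i j k : dx (umon K i j k) = i%:R *: umon K i.-1 j k.
Proof.
rewrite /umon !dxM dxXz dxXy mulr0 !addr0 mulr0 addr0.
case: i => [|i]; first by rewrite expr0 dx1 scale0r !mul0r.
by rewrite dxX scaler_nat -mulr_natl /=; ring.
Qed.

Lemma dz_umon i j k : dz (umon K i j k) = j%:R *: umon K i j.-1 k.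
Proof.
have dX (w : U K) n : dz w = 0 -> dz (w ^+ n) = 0.
  by move=> dw; elim: n => [|n IHn]; rewrite ?dz1 // exprS dzM IHn dw mul0r mulr0 addr0.
rewrite /umon !dzM (dX x _ (dzx K)) (dX y _ (dzy K)) mulr0 addr0 mul0r add0r.
case: j => [|j]; first by rewrite scale0r expr0 dz1 mulr0 mul0r.
have -> : dz (z ^+ j.+1) = j.+1%:R * z ^+ j.
  elim: j => [|j IHj]; first by rewrite expr1 dzz mulr1.
  by rewrite exprS dzM IHj dzz [in RHS]mulrSr exprS; ring.
by rewrite scaler_nat -mulr_natl /=; ring.
Qed.

(** Left minus right multiplication by f_2. Likewise [nily] is right minus left multiplication by
    f_1; both are locally nilpotent because f_3 is central. *)
Definition nilx u : U K := z * dx u.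
Definition nily u : U K := z * dy u.

Lemma iter_linear (V : lmodType K) (D : V -> V) n : linear D -> linear (iter n D).
Proof. by move=> linD c u v; elim: n => //= n ->; rewrite linD. Qed.

Lemma iter_scale0 (V : lmodType K) (D : V -> V) n (c : K) (u : V) : linear D ->
  iter n D u = 0 -> iter n D (c *: u) = 0.
Proof.
move=> linD Du; have lin := iter_linear n linD.
have it0 : iter n D 0 = 0 by have := lin (-1) 0 0; rewrite scaleN1r addNr scaleN1r addNr.
by rewrite -[_ *: u]addr0 lin Du it0 scaler0 addr0.
Qed.

Lemma iter_eq0_le (V : lmodType K) (D : V -> V) n m (u : V) : linear D ->
  iter n D u = 0 -> iter (m + n) D u = 0.
Proof.
move=> linD Du; rewrite iterD Du; have := iter_linear m linD (-1) 0 0.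
by rewrite scaleN1r addNr scaleN1r addNr.
Qed.

Lemma locally_nilpotent (D : U K -> U K) : linear D ->
  (forall i j k, exists n, iter n D (umon K i j k) = 0) ->
  forall u, exists n, iter n D u = 0.
Proof.
move=> linD Dm; elim/umon_ind => [|c u v [n Dn] [m Dv]|//]; first by exists 0%N.
exists (n + m)%N; rewrite iter_linear //.
have -> : iter (n + m) D u = 0 by rewrite addnC; apply: iter_eq0_le.
by rewrite (iter_eq0_le n linD Dv) scaler0 addr0.
Qed.

Fact nilx_linear : linear nilx.
Proof. by move=> c u v; rewrite /nilx dxD dxZ !scale_mpolyC; ring. Qed.

Fact nily_linear : linear nily.
Proof. by move=> c u v; rewrite /nily dyD dyZ !scale_mpolyC; ring. Qed.

Lemma nilx_nilpotent u : exists n, iter n nilx u = 0.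
Proof.
move: u; apply: locally_nilpotent => [|i j k]; first exact: nilx_linear.
elim: i j => [|i IHi] j; first by exists 1%N; rewrite /= /nilx dx_umon scale0r mulr0.
have [n Dn] := IHi j.+1; exists n.+1; rewrite iterSr.
have -> : nilx (umon K i.+1 j k) = i.+1%:R *: umon K i j.+1 k.
  by rewrite /nilx dx_umon !scale_mpolyC /umon [z ^+ _.+1]exprS /=; ring.
by apply: iter_scale0 => //; apply: nilx_linear.
Qed.

Lemma nily_nilpotent u : exists n, iter n nily u = 0.
Proof.
move: u; apply: locally_nilpotent => [|i j k]; first exact: nily_linear.
elim: k j => [|k IHk] j; first by exists 1%N; rewrite /= /nily dy_umon scale0r mulr0.
have [n Dn] := IHk j.+1; exists n.+1; rewrite iterSr.
have -> : nily (umon K i j k.+1) = k.+1%:R *: umon K i j.+1 k.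
  by rewrite /nily dy_umon !scale_mpolyC /umon [z ^+ _.+1]exprS /=; ring.
by apply: iter_scale0 => //; apply: nily_linear.
Qed.

Lemma uf1_eq0 u : uf1 u = 0 -> u = 0.
Proof. by move/eqP; rewrite mulf_eq0 (negPf ux_neq0) => /eqP. Qed.

Lemma ur2_eq0 u : ur2 u = 0 -> u = 0.
Proof. by move/eqP; rewrite mulf_eq0 (negPf uy_neq0) => /eqP. Qed.

(** The hypothesis reads y u = - [nilx] u. Iterating, y^n u = (-1)^n [nilx]^n u, which is 0 for
    large n, and polynomials have no zero divisors. *)
Lemma uf2_eq0 u : uf2 u = 0 -> u = 0.
Proof.
move=> fu; have [n Dn] := nilx_nilpotent u.
have yD m : y ^+ m * u = (-1) ^+ m * iter m nilx u.
  elim: m => [|m IHm] /=; first by rewrite !expr0.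
  have yC w : y * nilx w = nilx (y * w) by rewrite /nilx dxM dxy; ring.
  have fE l : uf2 (iter l nilx u) = iter l nilx (uf2 u).
    elim: l => //= l <-; rewrite /uf2 /nilx !derivE; ring.
  rewrite exprS -mulrA IHm.
  have := fE m; rewrite fu [in RHS](_ : iter m nilx 0 = 0); last first.
    by have := iter_linear m nilx_linear (-1) 0 0; rewrite scaleN1r addNr scaleN1r addNr.
  rewrite /uf2 -/(nilx _) => /eqP; rewrite addr_eq0 => /eqP e.
  by rewrite mulrCA e exprS; ring.
have /eqP := yD n; rewrite Dn mulr0 mulf_eq0 expf_eq0 (negPf uy_neq0) andbF /=.
by move/eqP.
Qed.

Lemma ur1_eq0 u : ur1 u = 0 -> u = 0.
Proof.
move=> fu; have [n Dn] := nily_nilpotent u.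
have xD m : x ^+ m * u = (-1) ^+ m * iter m nily u.
  elim: m => [|m IHm] /=; first by rewrite !expr0.
  have fE l : ur1 (iter l nily u) = iter l nily (ur1 u).
    elim: l => //= l <-; rewrite /ur1 /nily !derivE; ring.
  rewrite exprS -mulrA IHm.
  have := fE m; rewrite fu [in RHS](_ : iter m nily 0 = 0); last first.
    by have := iter_linear m nily_linear (-1) 0 0; rewrite scaleN1r addNr scaleN1r addNr.
  rewrite /ur1 -/(nily _) => /eqP; rewrite addr_eq0 => /eqP e.
  by rewrite mulrCA e exprS; ring.
have /eqP := xD n; rewrite Dn mulr0 mulf_eq0 expf_eq0 (negPf ux_neq0) andbF /=.
by move/eqP.
Qed.

Lemma uf_ur u : [/\ uf1 (ur1 u) = ur1 (uf1 u), uf1 (ur2 u) = ur2 (uf1 u),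
  uf2 (ur1 u) = ur1 (uf2 u) & uf2 (ur2 u) = ur2 (uf2 u)].
Proof. by rewrite /uf1 /uf2 /ur1 /ur2; split; rewrite ?derivE; ring. Qed.

(* f_1 is ad-nilpotent, so that a high power of it moves across any u. *)
Lemma uf1_iter_ur1 u : exists n q, iter n (@uf1 K) u = ur1 q.
Proof.
have [n Dn] := nily_nilpotent u; exists n; elim: n u Dn => [|n IHn] u.
  by move=> /= ->; exists 0; rewrite /ur1 dy0 !mulr0 addr0.
rewrite iterSr => /IHn[q qE]; exists (iter n (@uf1 K) u - q).
have it m v w : iter m (@uf1 K) (v - w) = iter m (@uf1 K) v - iter m (@uf1 K) w.
  by elim: m => //= m ->; rewrite /uf1 mulrBr.
have comm m v : iter m (@uf1 K) (ur1 v) = ur1 (iter m (@uf1 K) v).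
  by elim: m => //= m ->; case: (uf_ur (iter m (@uf1 K) v)).
rewrite iterSr.
have -> : uf1 u = ur1 u - nily u by rewrite /uf1 /ur1 /nily addrK.
by rewrite it comm qE /ur1 dyD dyN; ring.
Qed.

Lemma uf2_iter_ur2 u : exists n q, iter n (@uf2 K) u = ur2 q.
Proof.
have [n Dn] := nilx_nilpotent u; exists n; elim: n u Dn => [|n IHn] u.
  by move=> /= ->; exists 0; rewrite /ur2 mulr0.
rewrite iterSr => /IHn[q qE]; exists (iter n (@uf2 K) u + q).
have it m v w : iter m (@uf2 K) (v + w) = iter m (@uf2 K) v + iter m (@uf2 K) w.
  by elim: m => //= m ->; rewrite /uf2 dxD; ring.
have comm m v : iter m (@uf2 K) (ur2 v) = ur2 (iter m (@uf2 K) v).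
  by elim: m => //= m ->; case: (uf_ur (iter m (@uf2 K) v)).
rewrite iterSr.
have -> : uf2 u = ur2 u + nilx u by [].
by rewrite it comm qE /ur2 mulrDr.
Qed.

End Lowering.

(** * The Casimir element and simplicity of the antidominant Verma module *)

Section Antidominant.

Variable K : numFieldType.
Implicit Types u v : U K.

Local Notation x := (ux K).
Local Notation y := (uy K).
Local Notation z := (uz K).

Definition ade1 u : U K :=
  - (dx u *+ 2) - x * dx (dx u) - z * dz (dx u) + y * dy (dx u) - y * dz u.
Definition ade2 u : U K := - (dy u *+ 2) - y * dy (dy u) + x * dz u.

Definition eul1 u : U K := x * dx u + z * dz u.
Definition eul2 u : U K := y * dy u + z * dz u.

Lemma scale_natU n u : (n%:R : K) *: u = n%:R * u.
Proof. by rewrite scaler_nat mulr_natl. Qed.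

Lemma eul1_umon i j k : eul1 (umon K i j k) = (i + j)%:R *: umon K i j k.
Proof.
rewrite /eul1 dx_umon dz_umon !scale_natU natrD /umon.
by case: i => [|i]; case: j => [|j] /=; rewrite ?exprS; ring.
Qed.

Lemma eul2_umon i j k : eul2 (umon K i j k) = (j + k)%:R *: umon K i j k.
Proof.
rewrite /eul2 dy_umon dz_umon !scale_natU natrD /umon.
by case: k => [|k]; case: j => [|j] /=; rewrite ?exprS; ring.
Qed.

Lemma diagonal_kernel (L : U K -> U K) (l : nat -> nat -> nat -> K) : linear L ->
  (forall i j k, L (umon K i j k) = l i j k *: umon K i j k) ->
  (forall i j k, l i j k = 0 -> [/\ i = 0, j = 0 & k = 0]%N) ->
  forall u, L u = 0 -> exists c, u = c *: 1.
Proof.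
move=> linL Lm l0 u Lu; exists (mpoly.mcoeff (mpoly.mnm0) u).
have coefL m : mpoly.mcoeff m (L u) = l (m 0) (m 2%:R) (m 1) * mpoly.mcoeff m u.
  elim/umon_ind: u {Lu} => [|c u v IHu IHv|i j k].
  - have := linL (-1) 0 0; rewrite scaleN1r addNr scaleN1r addNr => ->.
    by rewrite mpoly.mcoeff0 mulr0.
  - by rewrite linL !mpoly.mcoeffD !mpoly.mcoeffZ IHu IHv; ring.
  - rewrite Lm mpoly.mcoeffZ umonE mpoly.mcoeffX; case: eqP => [<-|_]; last by rewrite !mulr0.
    by rewrite !mpoly.mnmDE !mpoly.mulmnE !mpoly.mnm1E /= !mul1n !mul0n !addn0.
apply/mpoly.mpolyP => m; rewrite mpoly.mcoeffZ mpoly.mcoeff1.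
have [->|nm0] := eqVneq m mpoly.mnm0; first by rewrite mulr1.
have /esym/eqP := coefL m; rewrite Lu mpoly.mcoeff0 mulr0 mulf_eq0 => /orP[/eqP lm|/eqP//].
have [m0 m2 m1] := l0 _ _ _ lm; case/eqP: nm0; apply/mpoly.mnmP => i.
by rewrite mpoly.mnm0E; case: (I3P i) => ->.
Qed.

(* The Casimir element acts on M(-2 rho), shifted to vanish at the highest weight. *)
Lemma casimir u :
  x * ade1 u + uf2 (ade2 u) + z * (ade1 (ade2 u) - ade2 (ade1 u)) =
  - (eul1 (eul1 u) + eul2 (eul2 u) - eul1 (eul2 u) + eul1 u + eul2 u).
Proof. rewrite /uf2 /eul1 /eul2 /ade1 /ade2 !derivE. ring. Qed.

End Antidominant.

Section AntidominantSimple.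

Variable K : numFieldType.
Implicit Types u v : U K.

Local Notation x := (ux K).
Local Notation y := (uy K).
Local Notation z := (uz K).
Local Notation ade1 := (@ade1 K).
Local Notation ade2 := (@ade2 K).
Local Notation eul1 := (@eul1 K).
Local Notation eul2 := (@eul2 K).

Fact eul1_linear : linear eul1.
Proof. by move=> c u v; rewrite /eul1 !derivE !scale_mpolyC; ring. Qed.
Fact eul2_linear : linear eul2.
Proof. by move=> c u v; rewrite /eul2 !derivE !scale_mpolyC; ring. Qed.

HB.instance Definition _ := GRing.isLinear.Build K (U K) (U K) *:%R eul1 eul1_linear.
HB.instance Definition _ := GRing.isLinear.Build K (U K) (U K) *:%R eul2 eul2_linear.

Fact ade1_linear : linear ade1.
Proof. by move=> c u v; rewrite /ade1 !derivE !scale_mpolyC; ring. Qed.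
Fact ade2_linear : linear ade2.
Proof. by move=> c u v; rewrite /ade2 !derivE !scale_mpolyC; ring. Qed.
HB.instance Definition _ := GRing.isLinear.Build K (U K) (U K) *:%R ade1 ade1_linear.
HB.instance Definition _ := GRing.isLinear.Build K (U K) (U K) *:%R ade2 ade2_linear.

Lemma quadric_zero (m n : nat) :
  m%:R ^+ 2 + n%:R ^+ 2 - m%:R * n%:R + m%:R + n%:R = 0 :> K -> m = 0%N /\ n = 0%N.
Proof.
move=> E; have : (m * m + n * n + m + n == m * n)%N.
  rewrite -(eqr_nat K) !natrD !natrM -subr_eq0; apply/eqP; rewrite -[RHS]E; ring.
have [le_mn|/ltnW le_nm] := leqP m n; [have := leq_mul le_mn (leqnn n)|
  have := leq_mul (leqnn m) le_nm]; move=> ? /eqP ?; split; lia.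
Qed.

(** The shifted Casimir operator is diagonal on monomials, with eigenvalue -(m^2 + n^2 - mn + m + n)
    at weight -2 rho - m alpha_1 - n alpha_2. This vanishes only for m = n = 0, so singular vectors
    are constants. *)
Lemma ade_kernel u : ade1 u = 0 -> ade2 u = 0 -> exists c, u = c *: 1.
Proof.
move=> u1 u2; pose L u := eul1 (eul1 u) + eul2 (eul2 u) - eul1 (eul2 u) + eul1 u + eul2 u.
apply: (@diagonal_kernel K L (fun i j k => (i + j)%:R ^+ 2 + (j + k)%:R ^+ 2
    - (i + j)%:R * (j + k)%:R + (i + j)%:R + (j + k)%:R)).
- by move=> c v w; rewrite /L !linearP /=; lmod.
- move=> i j k; rewrite /L !(eul1_umon, eul2_umon) !linearZ_LR /= !(eul1_umon, eul2_umon).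
  by lmod.
- move=> i j k /quadric_zero[m0 n0]; split; lia.
- have := casimir u; rewrite u1 u2 !linear0 /uf2 dx0 !(mulr0, addr0, subrr) => /esym/eqP.
  by rewrite oppr_eq0 => /eqP.
Qed.

Definition height u : U K := eul1 u + eul2 u.

Fact height_linear : linear height.
Proof. by move=> c u v; rewrite /height !linearP /=; lmod. Qed.

HB.instance Definition _ := GRing.isLinear.Build K (U K) (U K) *:%R height height_linear.

Lemma height_ade u : height (ade1 u) = ade1 (height u) - ade1 u /\
  height (ade2 u) = ade2 (height u) - ade2 u.
Proof. by split; rewrite /height /eul1 /eul2 /ade1 /ade2 !derivE; ring. Qed.

(** The product of the operators [height] - k for s <= k < s + n. It kills every monomial whose
    height lies in this range, so it detects a bound on the heights in [u]. *)
Fixpoint height_prod (s n : nat) u : U K :=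
  if n is n'.+1 then height_prod s.+1 n' (height u - s%:R *: u) else u.

Fact height_prod_linear s n : linear (height_prod s n).
Proof.
elim: n s => [|n IHn] s c u v //=; rewrite -IHn; congr height_prod.
by rewrite !linearP /=; lmod.
Qed.
HB.instance Definition _ s n := GRing.isLinear.Build K (U K) (U K) *:%R
  (height_prod s n) (height_prod_linear s n).

Lemma height_prod_height s n u : height_prod s n (height u) = height (height_prod s n u).
Proof. elim: n s u => //= n IHn s u; rewrite -IHn; congr height_prod.
by rewrite [RHS]linearB [in RHS]linearZ_LR. Qed.

Lemma height_prod_shift (D : {linear U K -> U K}) :
  (forall u, height (D u) = D (height u) - D u) ->
  forall s n u, height_prod s n (D u) = D (height_prod s.+1 n u).
Proof.
move=> hD s n; elim: n s => //= n IHn s u; rewrite -IHn; congr height_prod.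
rewrite hD (linfB D) (linfZ D) -[s.+1]addn1 natrD scalerDl scale1r.
by rewrite opprD addrA addrAC.
Qed.

Lemma height_prod_ade s n u : height_prod s n (ade1 u) = ade1 (height_prod s.+1 n u) /\
  height_prod s n (ade2 u) = ade2 (height_prod s.+1 n u).
Proof.
by split; apply: (@height_prod_shift (_ : {linear _ -> _})) => v;
  case: (height_ade v).
Qed.

Lemma height_prodD s n m u :
  height_prod s (n + m) u = height_prod (s + n) m (height_prod s n u).
Proof.
elim: n s u => [|n IHn] s u; first by rewrite addn0.
by rewrite addSn /= IHn addSnnS.
Qed.

Lemma height_prod_umon s d i j k : (i + j + (j + k) = s + d)%N ->
  height_prod s d.+1 (umon K i j k) = 0.
Proof.
move=> hE; have hu : height (umon K i j k) = (s + d)%:R *: umon K i j k.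
  by rewrite /height eul1_umon eul2_umon -scalerDl -natrD hE.
elim: d s hE hu => [|d IHd] s hE hu.
  by rewrite /= hu addn0 subrr.
rewrite -[LHS]/(height_prod s.+1 d.+1 (height (umon K i j k) - s%:R *: umon K i j k)).
have e : height_prod s.+1 d.+1 (umon K i j k) = 0 by apply: IHd; rewrite addSnnS.
rewrite hu -scalerBl; apply: etrans (linearZ_LR (height_prod s.+1 d.+1) _ _) _.
exact: etrans (congr1 (fun w => _ *: w) e) (scaler0 _ _).
Qed.

Lemma height_prod_nilpotent u : exists n, height_prod 0 n u = 0.
Proof.
elim/umon_ind: u => [|c u v [n hu] [m hv]|i j k]; first by exists 0%N.
  exists (n + m)%N; rewrite linearP /=.
  have -> : height_prod 0 (n + m) u = 0 by rewrite height_prodD hu linear0.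
  have -> : height_prod 0 (n + m) v = 0 by rewrite addnC height_prodD hv linear0.
  by rewrite scaler0 addr0.
by exists (i + j + (j + k)).+1; apply: height_prod_umon.
Qed.

(* M(-2 rho) is simple. *)
Lemma antidominant_simple (S : U K -> Prop) u : u != 0 -> S u ->
  (forall v, S v -> S (ade1 v)) -> (forall v, S v -> S (ade2 v)) ->
  exists2 c, c != 0 & S (c *: 1).
Proof.
move=> + + S1 S2; have [n] := height_prod_nilpotent u.
elim: n u => [|n IHn] u /=; first by move=> ->; rewrite eqxx.
rewrite scale0r subr0 height_prod_height => hu unz Su.
(* This vector has height 0, so it is constant and is killed by e_1 and e_2. By the shift property,
   e_1 u and e_2 u are therefore killed by the shorter product, to which the induction hypothesis
   applies. *)
have [c cE] : exists c, height_prod 1 n u = c *: 1.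
  apply: (@diagonal_kernel K height (fun i j k => (i + j + (j + k))%:R)) hu.
  - exact: height_linear.
  - by move=> i j k; rewrite /height eul1_umon eul2_umon -scalerDl -natrD.
  - move=> i j k /eqP; rewrite pnatr_eq0 => /eqP; split; lia.
have [h1 h2] := height_prod_ade 0 n u.
have ade10 : ade1 (c *: 1) = 0.
  have e : ade1 1 = 0 by rewrite /ade1 !derivE; ring.
  by rewrite linearZ_LR /= e scaler0.
have ade20 : ade2 (c *: 1) = 0.
  have e : ade2 1 = 0 by rewrite /ade2 !derivE; ring.
  by rewrite linearZ_LR /= e scaler0.
have [u1|nz1] := eqVneq (ade1 u) 0; last by apply: IHn nz1 (S1 _ Su); rewrite h1 cE.
have [u2|nz2] := eqVneq (ade2 u) 0; last by apply: IHn nz2 (S2 _ Su); rewrite h2 cE.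
have [d dE] := ade_kernel u1 u2; exists d; last by rewrite -dE.
by apply: contraNneq unz => d0; rewrite dE d0 scale0r.
Qed.

End AntidominantSimple.

(** * Contravariant forms on the big projective module *)

Section ContravariantForms.

Variable K : numFieldType.
Implicit Types M N : sl3_module K.

Record contravariant M (F : M -> M -> K) : Prop := Contravariant {
  form_Dl : forall c u v w, F (c *: u + v) w = c * F u w + F v w;
  form_Dr : forall c u v w, F u (c *: v + w) = c * F u v + F u w;
  form_act : forall x u v, F (act x u) v = F u (act (sl3_tr x) v) }.

Section FormTheory.

Variables (M : sl3_module K) (F : M -> M -> K).
Hypothesis cF : contravariant F.

Lemma form_addl u v w : F (u + v) w = F u w + F v w.
Proof. by rewrite -[u]scale1r (form_Dl cF) mul1r scale1r. Qed.
Lemma form_addr u v w : F u (v + w) = F u v + F u w.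
Proof. by rewrite -[v]scale1r (form_Dr cF) mul1r scale1r. Qed.
Lemma form_0l v : F 0 v = 0.
Proof. by apply: (addrI (F 0 v)); rewrite -form_addl !addr0. Qed.
Lemma form_0r v : F v 0 = 0.
Proof. by apply: (addrI (F v 0)); rewrite -form_addr !addr0. Qed.
Lemma form_scalel c u v : F (c *: u) v = c * F u v.
Proof. by have := form_Dl cF c u 0 v; rewrite !addr0 form_0l addr0. Qed.
Lemma form_scaler c u v : F u (c *: v) = c * F u v.
Proof. by have := form_Dr cF c u v 0; rewrite !addr0 form_0r addr0. Qed.
Lemma form_oppl u v : F (- u) v = - F u v.
Proof. by rewrite -scaleN1r form_scalel mulN1r. Qed.
Lemma form_oppr u v : F u (- v) = - F u v.
Proof. by rewrite -scaleN1r form_scaler mulN1r. Qed.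

Lemma form_gens u v :
  [/\ F (act xe1 u) v = F u (act xf1 v), F (act xe2 u) v = F u (act xf2 v),
      F (act xf1 u) v = F u (act xe1 v) & F (act xf2 u) v = F u (act xe2 v)] /\
  (F (act xh1 u) v = F u (act xh1 v) /\ F (act xh2 u) v = F u (act xh2 v)).
Proof.
have [[t1 t2 t3 t4] [t5 t6]] := sl3_tr_gens K.
by split; split; rewrite (form_act cF) ?t1 ?t2 ?t3 ?t4 ?t5 ?t6.
Qed.

Lemma form_weight lam mu u v : weight_vector lam u -> weight_vector mu v ->
  ~~ same_weight lam mu -> F u v = 0.
Proof.
move=> /weight_vectorP[u1 u2] /weight_vectorP[v1 v2].
have [_ [H1 H2]] := form_gens u v.
rewrite u1 v1 form_scalel form_scaler in H1; rewrite u2 v2 form_scalel form_scaler in H2.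
rewrite negb_and => /orP[] neq; apply/eqP; move: neq; apply: contraNT => nz.
  by apply/eqP/(mulIf nz).
by apply/eqP/(mulIf nz).
Qed.

Lemma form_suml (I : Type) (r : seq I) (p : pred I) (u : I -> M) v :
  F (\sum_(i <- r | p i) u i) v = \sum_(i <- r | p i) F (u i) v.
Proof. by apply: (big_morph (F^~ v)) => [a b|]; rewrite ?form_addl ?form_0l. Qed.
Lemma form_sumr (I : Type) (r : seq I) (p : pred I) (u : I -> M) v :
  F v (\sum_(i <- r | p i) u i) = \sum_(i <- r | p i) F v (u i).
Proof. by apply: (big_morph (F v)) => [a b|]; rewrite ?form_addr ?form_0r. Qed.

End FormTheory.

Lemma contravariant_lin M (F G : M -> M -> K) c : contravariant F -> contravariant G ->
  contravariant (fun u v => F u v + c * G u v).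
Proof.
move=> [Fl Fr Fa] [Gl Gr Ga]; split=> [d u v w|d u v w|x u v].
- by rewrite Fl Gl; ring.
- by rewrite Fr Gr; ring.
- by rewrite Fa Ga.
Qed.

Lemma contravariant_hom M (P : sl3_module K) (F : P -> P -> K) (f : sl3_hom M P) (g : sl3_hom M P) :
  contravariant F -> contravariant (fun u v => F (f u) (g v)).
Proof.
move=> [Fl Fr Fa]; split=> [d u v w|d u v w|x u v].
- by rewrite hom_linear Fl.
- by rewrite hom_linear Fr.
- by rewrite !hom_act Fa.
Qed.

Definition wtz1 (i : ix) : int :=
  match i with I1 => 0 | Is => -2 | It => 1 | Ist => -3 | Its => 0 | Iw => -2 end.
Definition wtz2 (i : ix) : int :=
  match i with I1 => 0 | Is => 1 | It => -2 | Ist => 0 | Its => -3 | Iw => -2 end.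

Lemma ix_weight_inj i j : same_weight (ix_weight K i) (ix_weight K j) -> i = j.
Proof.
have E1 k : wt1 (ix_weight K k) = (wtz1 k)%:~R by rewrite -/(wta K k) wtaE; case: k.
have E2 k : wt2 (ix_weight K k) = (wtz2 k)%:~R by rewrite -/(wtb K k) wtbE; case: k.
rewrite /same_weight !E1 !E2 !eqr_int.
by case: i; case: j.
Qed.

Lemma vgen_weight i : weight_vector (ix_weight K i) (vgen K i).
Proof. by apply/weight_vectorP; case: (vgen_family K i). Qed.

Lemma big_ind_vgen (P : big K -> Prop) :
  (forall c p q, P p -> P q -> P (c *: p + q)) -> (forall i, P (vgen K i)) ->
  (forall p, P p -> P (act xf1 p)) -> (forall p, P p -> P (act xf2 p)) ->
  forall p, P p.
Proof.
move=> PD Pg Pf1 Pf2; elim/free_ind => [||p Pp|p Pp|] //.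
- by have [[_ _ <- _] _] := big_act p; apply: Pf1.
- by have [[_ _ _ <-] _] := big_act p; apply: Pf2.
- by have := PD (-1) _ _ (Pg I1) (Pg I1); rewrite scaleN1r addNr.
Qed.

(* A contravariant form is determined by its values on pairs of generators of equal weight. *)
Lemma form_diag (F : big K -> big K -> K) : contravariant F ->
  (forall i, F (vgen K i) (vgen K i) = 0) -> forall p q, F p q = 0.
Proof.
move=> cF F0.
(* Against f_1 p and f_2 p, v_i pairs through e_1 v_i and e_2 v_i; against the other generators it
   pairs to zero by weight, the weights w.0 being distinct. *)
have step i : (forall q, F (act xe1 (vgen K i)) q = 0) ->
    (forall q, F (act xe2 (vgen K i)) q = 0) -> forall q, F (vgen K i) q = 0.
  move=> e1 e2; elim/big_ind_vgen => [c p q Fp Fq|j|p Fp|p Fp].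
  - by rewrite (form_Dr cF) Fp Fq mulr0 addr0.
  - have [->|nij] := eqVneq i j; first exact: F0.
    apply: (form_weight cF (vgen_weight i) (vgen_weight j)).
    by apply: contra nij => /ix_weight_inj ->.
  - by have [[E _ _ _] _] := form_gens cF (vgen K i) p; rewrite -E e1.
  - by have [[_ E _ _] _] := form_gens cF (vgen K i) p; rewrite -E e2.
have fE u q : (forall q, F u q = 0) -> F (act xf1 u) q = 0 /\ F (act xf2 u) q = 0.
  by move=> Fu; have [[_ _ E1 E2] _] := form_gens cF u q; rewrite E1 E2 !Fu.
have z0 q : F 0 q = 0 := form_0l cF q.
have F1 q : F (vgen K I1) q = 0.
  by move: q; apply: step => q; have [_ _ E1 E2] := vgen_family K I1; rewrite ?E1 ?E2 /=.
have Fs q : F (vgen K Is) q = 0.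
  by move: q; apply: step => q; have [_ _ E1 E2] := vgen_family K Is; rewrite ?E1 ?E2 /=.
have Ft q : F (vgen K It) q = 0.
  by move: q; apply: step => q; have [_ _ E1 E2] := vgen_family K It; rewrite ?E1 ?E2 /=.
have Fth1 q : F (theta1 (act xf1) (act xf2) (vgen K)) q = 0.
  rewrite /theta1 !(form_addl cF, form_oppl cF, form_scalel cF).
  rewrite (fE _ _ Ft).1 (fE _ _ Fs).2 (fE _ _ (fun q => (fE _ q F1).2)).1.
  by rewrite (fE _ _ (fun q => (fE _ q F1).1)).2; ring.
have Fth2 q : F (theta2 (act xf1) (act xf2) (vgen K)) q = 0.
  rewrite /theta2 !(form_addl cF, form_oppl cF, form_scalel cF).
  rewrite (fE _ _ Ft).1 (fE _ _ Fs).2 (fE _ _ (fun q => (fE _ q F1).2)).1.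
  by rewrite (fE _ _ (fun q => (fE _ q F1).1)).2; ring.
have Fst q : F (vgen K Ist) q = 0.
  by move: q; apply: step => q; have [_ _ E1 E2] := vgen_family K Ist; rewrite ?E1 ?E2 /=.
have Fts q : F (vgen K Its) q = 0.
  by move: q; apply: step => q; have [_ _ E1 E2] := vgen_family K Its; rewrite ?E1 ?E2 /=.
have Fw q : F (vgen K Iw) q = 0.
  by move: q; apply: step => q; have [_ _ E1 E2] := vgen_family K Iw; rewrite ?E1 ?E2 /=.
elim/big_ind_vgen => [c p q Fp Fq r|[]|p Fp q|p Fp q] //.
- by rewrite (form_Dl cF) Fp Fq mulr0 addr0.
- by rewrite (fE _ q Fp).1.
- by rewrite (fE _ q Fp).2.
Qed.

End ContravariantForms.

Section EndomorphismHoms.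

Variable K : numFieldType.

Definition endX : sl3_hom (big K) (big K) := projT1 (cid (endX_exists K)).
Definition endY : sl3_hom (big K) (big K) := projT1 (cid (endY_exists K)).

Lemma endXE p : endX p = xop p. Proof. exact: (projT2 (cid (endX_exists K))). Qed.
Lemma endYE p : endY p = yop p. Proof. exact: (projT2 (cid (endY_exists K))). Qed.

Definition chom (i : ix) : sl3_hom (big K) (big K) :=
  match i with
  | I1 => idhom _ | Is => endX | It => endY | Ist => endY \oh endY
  | Its => endX \oh endX | Iw => endX \oh endX \oh endY
  end.

Lemma chomE i p : chom i p = cop i p.
Proof. by case: i; rewrite /= ?endXE ?endYE ?endXE ?endYE. Qed.

End EndomorphismHoms.

(** * Self-adjointness of endomorphisms and nondegeneracy of the form *)

Section Nondegeneracy.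

Variable K : numFieldType.
Variable B : big K -> big K -> K.
Hypothesis cB : contravariant B.
Hypothesis symB : forall p q, B p q = B q p.
Hypothesis B1 : B (vgen K I1) (vgen K I1) != 0.

Local Notation v_ := (vgen K).

(** The difference of the two sides is a contravariant form in p and q, and by symmetry of [B] it
    vanishes on each pair (v_i, v_i); [form_diag] applies. *)
Lemma end_selfadjoint (a : sl3_hom (big K) (big K)) p q : B (a p) q = B p (a q).
Proof.
apply/eqP; rewrite -subr_eq0 -mulN1r; apply/eqP.
pose F u v := B (a u) v + (-1) * B u (a v).
rewrite -[LHS]/(F p q); apply: form_diag => [|i]; last by rewrite /F symB mulN1r subrr.
apply: contravariant_lin.
  exact: (contravariant_hom a (idhom _) cB).
exact: (contravariant_hom (idhom _) a cB).
Qed.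

(** c_i v_i is a product of f's applied to v_1. Transposed to e's acting on v_i, that product gives
    back v_1 or 2 v_1, the factor 2 coming from the theta vectors. *)
Lemma chom_diag i : B (chom K i (v_ i)) (v_ i) != 0.
Proof.
have f1E (p : big K) : act xf1 p = ff1 p by case: (big_act p) => -[].
have f2E (p : big K) : act xf2 p = ff2 p by case: (big_act p) => -[].
have ctop : chom K i (v_ i) = fmono I1 (shapovalov i 1).
  have fg : (v_ i : ix -> U K) i = 1 by rewrite /vgen /fgen eqxx.
  by rewrite chomE cop_top ?fg // => j _ nji; rewrite /vgen /fgen (negPf nji).
rewrite ctop.
pose fam := vgen_family K.
have ch := act_chevalley (big K).
have [t1 t2 t3 t4] := @family_theta K (big K) (act xe1) (act xe2) (act xf1) (act xf2)
  (act xh1) (act xh2) v_ ch (fam I1) (fam Is) (fam It).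
have m1 : fmono I1 1 = v_ I1 by rewrite fmono1.
have gE p q := form_gens cB p q.
have Bf1 p q : B (act xf1 p) q = B p (act xe1 q) by case: (gE p q) => -[_ _ ->].
have Bf2 p q : B (act xf2 p) q = B p (act xe2 q) by case: (gE p q) => -[_ _ _ ->].
have B2 : 2%:R * B (v_ I1) (v_ I1) != 0 by rewrite mulf_neq0 // pnatr_eq0.
case: i {ctop} => /=.
- by rewrite m1.
- have -> : ur1 1 = uf1 1 :> U K by rewrite /ur1 /uf1 dy1; ring.
  by rewrite fmono_f1 m1 -f1E Bf1; have [_ _ -> _] := fam Is.
- have -> : ur2 1 = uf2 1 :> U K by rewrite /ur2 /uf2 dx1; ring.
  by rewrite fmono_f2 m1 -f2E Bf2; have [_ _ _ ->] := fam It.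
- have -> : ur2 (ur1 (ur1 1)) = uf1 (uf1 (uf2 1)) :> U K.
    by rewrite /ur1 /ur2 /uf1 /uf2 !derivE; ring.
  rewrite !fmono_f1 fmono_f2 m1 -f2E -!f1E !Bf1 Bf2.
  have [_ _ -> _] := fam Ist; rewrite t1 actZ; have [_ _ _ ->] := fam It.
  by rewrite (form_scaler cB).
- have -> : ur1 (ur2 (ur2 1)) = uf2 (uf2 (uf1 1)) :> U K.
    by rewrite /ur1 /ur2 /uf1 /uf2 !derivE; ring.
  rewrite !fmono_f2 fmono_f1 m1 -f1E -!f2E !Bf2 Bf1.
  have [_ _ _ ->] := fam Its; rewrite t4 actZ; have [_ _ -> _] := fam Is.
  by rewrite (form_scaler cB).
- have -> : ur1 (ur2 (ur2 (ur1 1))) = uf1 (uf2 (uf2 (uf1 1))) :> U K.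
    by rewrite /ur1 /ur2 /uf1 /uf2 !derivE; ring.
  rewrite fmono_f1 !fmono_f2 fmono_f1 m1 -f1E -!f2E -f1E !Bf1 !Bf2 Bf1.
  have [_ _ -> _] := fam Iw; have [_ _ _ ->] := fam Its.
  rewrite t4 actZ; have [_ _ -> _] := fam Is.
  by rewrite (form_scaler cB).
Qed.

(** The radical is stable under sl_3 and all endomorphisms. A nonzero element is moved by some c_i
    into U(n^-) v_1, and by lowering operators into c_w [big] for w = w_0, a copy of the simple
    Verma module M(-2 rho). Then c_w v_w lies in the radical, against [chom_diag]. *)
Lemma big_nondegenerate p : (forall q, B p q = 0) -> p = 0.
Proof.
have f1E (r : big K) : act xf1 r = ff1 r by case: (big_act r) => -[].
have f2E (r : big K) : act xf2 r = ff2 r by case: (big_act r) => -[].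
have e1E (r : big K) : act xe1 r = fe1 (@wta K) (@big1 K) r by case: (big_act r) => -[].
have e2E (r : big K) : act xe2 r = fe2 (@wtb K) (@big2 K) r by case: (big_act r) => -[].
pose rad (r : big K) := forall q, B r q = 0.
have rad_hom (a : sl3_hom (big K) (big K)) r : rad r -> rad (a r).
  by move=> Rr q; rewrite end_selfadjoint.
have rad_act x r : rad r -> rad (act x r) by move=> Rr q; rewrite (form_act cB).
move=> Rp; have [//|pnz] := eqVneq p 0; exfalso.
(* The components are tried from the top of the Bruhat order down, so the first nonzero one has only
   zeros above it. *)
have [i pi_nz p0] : exists2 i, p i != 0 & forall j, ix_le i j -> j != i -> p j = 0.
  have [w0|] := eqVneq (p Iw) 0; last by exists Iw => // -[]; rewrite ix_eqE.
  have [st0|] := eqVneq (p Ist) 0; last by exists Ist => // -[]; rewrite ix_eqE.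
  have [ts0|] := eqVneq (p Its) 0; last by exists Its => // -[]; rewrite ix_eqE.
  have [s0|] := eqVneq (p Is) 0; last by exists Is => // -[]; rewrite ix_eqE.
  have [t0|] := eqVneq (p It) 0; last by exists It => // -[]; rewrite ix_eqE.
  have [z0|] := eqVneq (p I1) 0; last by exists I1 => // -[]; rewrite ix_eqE.
  by case/eqP: pnz; apply/funext; case.
pose S u := rad (fmono I1 u).
have Sf1 n u : S u -> S (iter n (@uf1 K) u).
  move=> Su; elim: n => //= n; rewrite /S => IHn.
  by rewrite fmono_f1 -[ff1 _]f1E; apply: rad_act.
have Sf2 n u : S u -> S (iter n (@uf2 K) u).
  move=> Su; elim: n => //= n; rewrite /S => IHn.
  by rewrite fmono_f2 -[ff2 _]f2E; apply: rad_act.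
have [u unz Su] : exists2 u, u != 0 & S u.
  exists (shapovalov i (p i)).
    have nz1 (v : U K) : v != 0 -> ur1 v != 0 by move=> vnz; apply/eqP => /ur1_eq0 v0; rewrite v0 eqxx in vnz.
    have nz2 (v : U K) : v != 0 -> ur2 v != 0 by move=> vnz; apply/eqP => /ur2_eq0 v0; rewrite v0 eqxx in vnz.
    by case: i pi_nz {p0} => /=; auto.
  by rewrite /S -cop_top // -[cop _ _]chomE; apply: rad_hom.
have it1 n (v : U K) : v != 0 -> iter n (@uf1 K) v != 0.
  by move=> vnz; elim: n => //= n IHn; apply/eqP => /uf1_eq0 v0; rewrite v0 eqxx in IHn.
have it2 n (v : U K) : v != 0 -> iter n (@uf2 K) v != 0.
  by move=> vnz; elim: n => //= n IHn; apply/eqP => /uf2_eq0 v0; rewrite v0 eqxx in IHn.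
(* By the Ore property, suitable powers of f_1, f_2, f_2, f_1 applied on the left produce in turn
   the right factors of the singular vector f_1 f_2^2 f_1. *)
have [w wnz Sw] : exists2 w, w != 0 & S (shapovalov Iw w).
  have r0 : ur1 0 = 0 :> U K by rewrite /ur1 dy0 !mulr0 addr0.
  have r0' : ur2 0 = 0 :> U K by rewrite /ur2 mulr0.
  have c12 n q : iter n (@uf2 K) (ur1 q) = ur1 (iter n (@uf2 K) q).
    by elim: n => //= n ->; case: (uf_ur (iter n (@uf2 K) q)).
  have c22 n q : iter n (@uf2 K) (ur2 q) = ur2 (iter n (@uf2 K) q).
    by elim: n => //= n ->; case: (uf_ur (iter n (@uf2 K) q)).
  have c11 n q : iter n (@uf1 K) (ur1 q) = ur1 (iter n (@uf1 K) q).
    by elim: n => //= n ->; case: (uf_ur (iter n (@uf1 K) q)).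
  have c21 n q : iter n (@uf1 K) (ur2 q) = ur2 (iter n (@uf1 K) q).
    by elim: n => //= n ->; case: (uf_ur (iter n (@uf1 K) q)).
  have [n1 [q1 E1]] := uf1_iter_ur1 u.
  have q1nz : q1 != 0 by apply: contraNneq (it1 n1 _ unz) => q0; rewrite E1 q0 r0.
  have [n2 [q2 E2]] := uf2_iter_ur2 q1.
  have q2nz : q2 != 0 by apply: contraNneq (it2 n2 _ q1nz) => q0; rewrite E2 q0 r0'.
  have [n3 [q3 E3]] := uf2_iter_ur2 q2.
  have q3nz : q3 != 0 by apply: contraNneq (it2 n3 _ q2nz) => q0; rewrite E3 q0 r0'.
  have [n4 [q4 E4]] := uf1_iter_ur1 q3.
  have q4nz : q4 != 0 by apply: contraNneq (it1 n4 _ q3nz) => q0; rewrite E4 q0 r0.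
  exists q4 => //=; move/(Sf1 n1)/(Sf2 n2)/(Sf2 n3)/(Sf1 n4): Su.
  by rewrite E1 c12 E2 c12 c22 E3 c11 c21 c21 E4.
have cw (r : big K) : chom K Iw r = fmono I1 (shapovalov Iw (r Iw)).
  by rewrite chomE cop_top // => -[]; rewrite ix_eqE.
(* As c_w depends only on the component at w_0, sl_3 acts on its image through that component, on
   which e_1 and e_2 are [ade1] and [ade2]. *)
have step (x : sl3 K) (v v' : U K) : (act x (fmono Iw v : big K) : big K) Iw = v' ->
    S (shapovalov Iw v) -> S (shapovalov Iw v').
  move=> xE Sv.
  have E : chom K Iw (fmono Iw v) = fmono I1 (shapovalov Iw v).
    by rewrite cw; congr (fmono I1 (shapovalov Iw _)); rewrite /fmono eqxx.
  have : rad (act x (chom K Iw (fmono Iw v))) by apply: rad_act; rewrite E.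
  by rewrite -hom_act cw xE.
have [||c cnz Sc] := @antidominant_simple K (fun v => S (shapovalov Iw v)) w wnz Sw.
- move=> v; apply: (step xe1); rewrite e1E /fe1 /fmono eqxx /= /ade1 wtaE.
  by rewrite scaleNr scaler_nat addr0.
- move=> v; apply: (step xe2); rewrite e2E /fe2 /fmono eqxx /= /ade2 wtbE.
  by rewrite scaleNr scaler_nat addr0.
have := chom_diag Iw; rewrite cw /vgen /fgen eqxx => /eqP; apply.
have -> : fmono I1 (shapovalov Iw 1) = c^-1 *: (fmono I1 (shapovalov Iw (c *: 1)) : big K).
  have -> : shapovalov Iw (c *: 1) = c *: shapovalov Iw 1 :> U K.
    by rewrite /= /ur1 /ur2 !derivE !scale_mpolyC; ring.
  have := fmonoP I1 c (shapovalov Iw 1) (0 : U K); rewrite addr0.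
  have -> : fmono I1 0 = 0 :> (ix -> U K) by apply/funext => j; rewrite /fmono; case: ifP.
  by rewrite addr0 => ->; rewrite scalerA mulVf ?scale1r.
by rewrite (form_scalel cB) Sc mulr0.
Qed.

(** All endomorphisms are self-adjoint for a nondegenerate form, and the adjoint of ab is ba. *)
Lemma end_comm (a b : sl3_hom (big K) (big K)) p : a (b p) = b (a p).
Proof.
apply/eqP; rewrite -subr_eq0; apply/eqP/big_nondegenerate => q.
rewrite (form_addl cB) (form_oppl cB) -[a (b p)]/((a \oh b) p) end_selfadjoint /=.
by rewrite !end_selfadjoint subrr.
Qed.

End Nondegeneracy.

(** * Extending singular vectors *)

Section FamilyExtension.

Variable K : fieldType.

Definition covered (M : sl3_module K) (n : ix -> M) (z : ix) : Prop :=
  forall y, ix_le y z -> y != z -> sl3_family n y.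

Lemma family_theta_weight (V : lmodType K) (e1 e2 f1 f2 h1 h2 : {linear V -> V}) n :
  chevalley e1 e2 f1 f2 h1 h2 ->
  family e1 e2 f1 f2 h1 h2 n I1 -> family e1 e2 f1 f2 h1 h2 n Is ->
  family e1 e2 f1 f2 h1 h2 n It ->
  [/\ h1 (theta1 f1 f2 n) = - theta1 f1 f2 n, h2 (theta1 f1 f2 n) = - theta1 f1 f2 n,
      h1 (theta2 f1 f2 n) = - theta2 f1 f2 n & h2 (theta2 f1 f2 n) = - theta2 f1 f2 n].
Proof.
move=> ch [h11 h21 e11 e21] [h1s h2s e1s e2s] [h1t h2t e1t e2t].
pose lin := (linfE f1, linfE f2, linfE h1, linfE h2).
have rel := (h11, h21, h1s, h2s, h1t, h2t).
by rewrite /theta1 /theta2; split;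
  do 4!rewrite ?lin ?(chevalley_normal ch); rewrite ?rel ?lin ?wtaE ?wtbE /=; lmod.
Qed.

Let sl3_theta (M : sl3_module K) (n : ix -> M) z : covered n z -> ix_le Is z -> ix_le It z ->
  z != Is -> z != It ->
  [/\ act xe1 (theta1 (act xf1) (act xf2) n) = 2%:R *: n It,
      act xe2 (theta1 (act xf1) (act xf2) n) = n Is,
      act xe1 (theta2 (act xf1) (act xf2) n) = n It &
      act xe2 (theta2 (act xf1) (act xf2) n) = 2%:R *: n Is] /\
  [/\ act xh1 (theta1 (act xf1) (act xf2) n) = - theta1 (act xf1) (act xf2) n,
      act xh2 (theta1 (act xf1) (act xf2) n) = - theta1 (act xf1) (act xf2) n,
      act xh1 (theta2 (act xf1) (act xf2) n) = - theta2 (act xf1) (act xf2) n &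
      act xh2 (theta2 (act xf1) (act xf2) n) = - theta2 (act xf1) (act xf2) n].
Proof.
move=> cov ls lt ns nt; have l1 : ix_le I1 z by [].
have n1 : I1 != z by case: z {cov ns nt l1} ls lt; rewrite ?ix_eqE.
rewrite eq_sym in ns; rewrite eq_sym in nt.
have [f1 fs ft] := And3 (cov I1 l1 n1) (cov Is ls ns) (cov It lt nt).
have ch := act_chevalley M.
split; first exact: (@family_theta K M (act xe1) (act xe2) (act xf1) (act xf2)
  (act xh1) (act xh2) n ch f1 fs ft).
exact: (@family_theta_weight M (act xe1) (act xe2) (act xf1) (act xf2)
  (act xh1) (act xh2) n ch f1 fs ft).
Qed.

Lemma raise_weight (M : sl3_module K) (n : ix -> M) z : covered n z ->
  weight_vector (ix_weight K z + sl3_root K 0 1) (raise1 (act xf1) (act xf2) n z) /\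
  weight_vector (ix_weight K z + sl3_root K 1 2%:R) (raise2 (act xf1) (act xf2) n z).
Proof.
move=> cov.
have low y c d : ix_le y z -> y != z -> c = wta K y -> d = wtb K y ->
    act xh1 (n y) = c *: n y /\ act xh2 (n y) = d *: n y.
  by move=> le ny -> ->; case: (cov y le ny).
have neg (v : M) c : c = -1 -> c *: v = - v by move=> ->; rewrite scaleN1r.
split; apply/weight_vectorP;
  rewrite wt1D wt2D ?(wt_root01 K).1 ?(wt_root01 K).2 ?(wt_root12 K).1 ?(wt_root12 K).2;
  rewrite -/(wta K z) -/(wtb K z) wtaE wtbE; case: z cov low => cov low /=;
  rewrite ?act0 ?scaler0 //;
  try by apply: low; rewrite ?ix_eqE // ?wtaE ?wtbE; ring.
  have [|||| _ [-> -> _ _]] := sl3_theta cov; rewrite ?ix_eqE //.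
  by rewrite !neg //; ring.
have [|||| _ [_ _ -> ->]] := sl3_theta cov; rewrite ?ix_eqE //.
by rewrite !neg //; ring.
Qed.

(** The coefficients of [theta1] and [theta2] are chosen for this cocycle condition; with acyclicity
    it lets a family be extended one element at a time up the Bruhat order. *)
Lemma raise_compatible (M : sl3_module K) (n : ix -> M) z : covered n z ->
  compatible (raise1 (act xf1) (act xf2) n z) (raise2 (act xf1) (act xf2) n z).
Proof.
move=> cov.
have e1E y : ix_le y z -> y != z -> act xe1 (n y) = raise1 (act xf1) (act xf2) n y.
  by move=> le ny; case: (cov y le ny).
have e2E y : ix_le y z -> y != z -> act xe2 (n y) = raise2 (act xf1) (act xf2) n y.
  by move=> le ny; case: (cov y le ny).
have th := sl3_theta cov.
case: z cov e1E e2E th => cov e1E e2E th; rewrite /compatible /=.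
- by rewrite !act0; split; lmod.
- by rewrite !act0 (e1E I1) ?(e2E I1) ?ix_eqE //= !act0; split; lmod.
- by rewrite !act0 (e1E I1) ?(e2E I1) ?ix_eqE //= !act0; split; lmod.
- have [||||[t1 t2 _ _] _] := th; rewrite ?ix_eqE //.
  rewrite !act0 t1 t2 !actZ (e1E Is) ?(e2E Is) ?(e2E It) ?ix_eqE //=.
  by split; lmod.
- have [||||[_ _ t1 t2] _] := th; rewrite ?ix_eqE //.
  rewrite !act0 t1 t2 !actZ (e1E It) ?(e2E It) ?(e1E Is) ?ix_eqE //=.
  by split; lmod.
- have [||||[t1 t2 t3 t4] _] := th; rewrite ?ix_eqE //.
  rewrite (e1E Ist) ?(e2E Its) ?(e1E Its) ?(e2E Ist) ?ix_eqE //= !act0 t1 t2 t3 t4.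
  by split; lmod.
Qed.

Lemma family_step (M : sl3_module K) (n : ix -> M) z :
  weight_module M -> acyclic M -> covered n z ->
  exists v, [/\ act xh1 v = wta K z *: v, act xh2 v = wtb K z *: v,
    act xe1 v = raise1 (act xf1) (act xf2) n z & act xe2 v = raise2 (act xf1) (act xf2) n z].
Proof.
move=> wM aM cov; have [w1 w2] := raise_weight cov.
have [v [/weight_vectorP[h1 h2] e1 e2]] := acyclic_weight wM aM w1 w2 (raise_compatible cov).
by exists v.
Qed.

Lemma covered_ext (M : sl3_module K) (n n' : ix -> M) z :
  (forall y, ix_le y z -> n y = n' y) -> sl3_family n z -> sl3_family n' z.
Proof.
move=> nn' [h1 h2 e1 e2].
by case: z nn' h1 h2 e1 e2 => nn' h1 h2 e1 e2; split; rewrite -?nn' // ?e1 ?e2;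
  rewrite /raise1 /raise2 /theta1 /theta2 -?(nn' I1) -?(nn' Is) -?(nn' It) -?(nn' Ist)
    -?(nn' Its).
Qed.

Lemma ix_lexx z : ix_le z z. Proof. by case: z. Qed.

Lemma ix_le_trans y x z : ix_le x y -> ix_le y z -> ix_le x z.
Proof. by case: x; case: y => //; case: z. Qed.

Lemma ix_le_anti x y : ix_le x y -> ix_le y x -> x = y.
Proof. by case: x; case: y. Qed.

Lemma ix_order_ind (P : ix -> Prop) :
  (forall z, (forall y, ix_le y z -> y != z -> P y) -> P z) -> forall z, P z.
Proof.
move=> step; have P1 : P I1 by apply: step => -[]; rewrite ?ix_eqE.
have Ps : P Is by apply: step => -[]; rewrite ?ix_eqE.
have Pt : P It by apply: step => -[]; rewrite ?ix_eqE.
have Pst : P Ist by apply: step => -[]; rewrite ?ix_eqE.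
have Pts : P Its by apply: step => -[]; rewrite ?ix_eqE.
have Pw : P Iw by apply: step => -[]; rewrite ?ix_eqE.
by case.
Qed.

(* A singular vector of weight x.0 in an acyclic module is the image of the
   corresponding generator of the big projective module under a homomorphism. *)
Lemma singular_hom (M : sl3_module K) x (m : M) :
  weight_module M -> acyclic M -> singular_vector (ix_weight K x) m ->
  exists2 f : sl3_hom (big K) M, f (vgen K x) = m &
    forall z, ~~ ix_le x z -> f (vgen K z) = 0.
Proof.
move=> wM aM /singular_vectorP[/weight_vectorP[h1 h2] [e1 e2]].
pose good (n : ix -> M) z := [/\ sl3_family n z, z = x -> n z = m & ~~ ix_le x z -> n z = 0].
have step (n : ix -> M) z : (forall y, ix_le y z -> y != z -> good n y) ->
    exists v, forall n' : ix -> M, (forall y, ix_le y z -> y != z -> n' y = n y) ->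
      n' z = v -> good n' z.
  move=> gn.
  (* Unless z lies strictly above x, every vector below z is zero. So [m] itself may be taken at x,
     since it is singular, and 0 at the z not above x. *)
  have rz : ~~ (ix_le x z && (z != x)) -> raise1 (act xf1) (act xf2) n z = 0 /\
      raise2 (act xf1) (act xf2) n z = 0.
    move=> nxz.
    have n0 y : ix_le y z -> y != z -> n y = 0.
      move=> le ny; case: (gn y le ny) => _ _; apply; apply: contra nxz => le'.
      rewrite (ix_le_trans le' le) /=; apply: contraNneq ny => zx; apply/eqP/ix_le_anti => //.
      by rewrite zx.
    by case: z n0 {gn nxz} => n0 /=; rewrite /theta1 /theta2 ?(n0 I1) ?(n0 Is) ?(n0 It)
      ?(n0 Ist) ?(n0 Its) ?ix_eqE // !act0; split; lmod.
  have [v vP] : exists v, [/\ [/\ act xh1 v = wta K z *: v, act xh2 v = wtb K z *: v,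
      act xe1 v = raise1 (act xf1) (act xf2) n z & act xe2 v = raise2 (act xf1) (act xf2) n z],
      z = x -> v = m & ~~ ix_le x z -> v = 0].
    have [zx|nzx] := eqVneq z x.
      have [|r1 r2] := rz; first by rewrite zx eqxx andbF.
      by exists m; rewrite r1 r2 zx; split=> //; rewrite ix_lexx.
    have [le|nle] := boolP (ix_le x z); last first.
      have [|r1 r2] := rz; first by rewrite (negPf nle).
      by exists 0; rewrite r1 r2 !act0 !scaler0; split=> // /eqP; rewrite (negPf nzx).
    have [|v vP] := @family_step M n z wM aM; last first.
      by exists v; split=> // /eqP; rewrite (negPf nzx).
    by move=> y le' ny; case: (gn y le' ny).
  exists v => n' n'E n'z.
  have rE : raise1 (act xf1) (act xf2) n' z = raise1 (act xf1) (act xf2) n z /\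
      raise2 (act xf1) (act xf2) n' z = raise2 (act xf1) (act xf2) n z.
    by case: z n'E {gn rz vP n'z} => n'E /=; rewrite /theta1 /theta2 ?(n'E I1) ?(n'E Is)
      ?(n'E It) ?(n'E Ist) ?(n'E Its) ?ix_eqE.
  have [[a1 a2 a3 a4] a5 a6] := vP.
  by split; rewrite ?n'z //; split; rewrite n'z ?rE.1 ?rE.2.
have good_ext (n n' : ix -> M) z : (forall y, ix_le y z -> n y = n' y) ->
    good n z -> good n' z.
  move=> nn' [g1 g2 g3]; split; first exact: covered_ext nn' g1.
    by rewrite -nn' ?ix_lexx.
  by rewrite -nn' ?ix_lexx.
have grow (zs : seq ix) z : (forall y, ix_le y z -> y != z -> y \in zs) ->
    (forall y, y \in zs -> ~~ ix_le z y) -> (exists n, forall y, y \in zs -> good n y) ->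
    exists n, forall y, y \in z :: zs -> good n y.
  move=> below above [n gn]; have [|v vP] := step n z.
    by move=> y le ny; apply: gn; apply: below.
  exists (fun y => if y == z then v else n y) => y; rewrite inE => /predU1P[->|yzs].
    by apply: vP => [w _ /negPf->|]; rewrite ?eqxx.
  apply: good_ext (gn _ yzs) => w le; case: eqP => // wz.
  by have := above y yzs; rewrite -wz le.
have [n gn] : exists n, forall z, z \in [:: Iw; Its; Ist; It; Is; I1] -> good n z.
  (* Read from its tail, the list is a linear extension of the Bruhat order, so each new element has
     all lower ones already present and none above it. *)
  do 6!(apply: (grow); [by case; rewrite ?inE ?ix_eqE|by case; rewrite ?inE ?ix_eqE //=|]).
  by exists (fun=> 0) => y; rewrite in_nil.
have {}gn z : good n z by apply: gn; case: z; rewrite !inE ?eqxx ?orbT.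
have [f fn _] := big_hom (fun z => let: And3 g _ _ := gn z in g).
exists f => [|z nle]; first by rewrite fn; case: (gn x) => _ ->.
by rewrite fn; case: (gn z) => _ _ ->.
Qed.

End FamilyExtension.

(** * Linear algebra *)

(** A row that annihilates the kernel of a matrix belongs to its row space. *)
Lemma row_space_solution (K : fieldType) (J : finType) (G : J -> J -> K) (r : J -> K) :
  (forall k : J -> K, (forall i, \sum_j G i j * k j = 0) -> \sum_j r j * k j = 0) ->
  exists c : J -> K, forall j, \sum_i c i * G i j = r j.
Proof.
move=> ker; pose n := #|J|; pose ev (i : 'I_n) : J := enum_val i.
pose A : 'M[K]_n := \matrix_(i, j) G (ev i) (ev j).
pose b : 'rV[K]_n := \row_j r (ev j).
have re (F : J -> K) : \sum_i F i = \sum_(i < n) F (ev i).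
  by rewrite (reindex_onto (@enum_val J predT) enum_rank) /= => [|i _]; rewrite ?enum_rankK //;
    apply: eq_bigl => i; rewrite enum_valK eqxx.
have : (b <= A)%MS.
  rewrite submxE; apply/eqP/matrixP => o l; rewrite !mxE ord1.
  have := ker (fun j => cokermx A (enum_rank j) l); rewrite re => H.
  apply: (etrans _ (H _)) => [|i].
    by apply: eq_bigr => j _; rewrite !mxE enum_valK.
  have := mulmx_coker A => /matrixP/(_ (enum_rank i) l); rewrite !mxE => e.
  rewrite re; apply: etrans e; apply: eq_bigr => j _.
  by rewrite [A _ _]mxE /ev enum_valK enum_rankK.
case/submxP => D bE; exists (fun i => D 0 (enum_rank i)) => j.
have := congr1 (fun M : 'rV_n => M 0 (enum_rank j)) bE; rewrite !mxE re /ev enum_rankK => ->.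
by apply: eq_bigr => i _; rewrite [A _ _]mxE /ev enum_valK enum_rankK.
Qed.

(** * The algebra of endomorphisms of the big projective module *)

Section SquareRootSeries.

Variables (K : fieldType) (V : lmodType K) (s h : K).

Definition sqrt_series (a b c d : V) : V :=
  s^-1 *: (a - h *: b + (3%:R * h ^+ 3) *: c - (5%:R * h ^+ 4) *: d).

(** The binomial series 1 - n/2 + 3n^2/8 - 5n^3/16 of (1 + n)^(-1/2), cut at n^4 = 0, where [a],
    [b], [c], [d] stand for the successive images of a vector under n. *)
Lemma sqrt_seriesP (a b c d : V) : s != 0 -> 2%:R * h = 1 ->
  let T := sqrt_series in
  s ^+ 2 *: (T (T a b c d) (T b c d 0) (T c d 0 0) (T d 0 0 0) +
             T (T b c d 0) (T c d 0 0) (T d 0 0 0) (T 0 0 0 0)) = a.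
Proof.
move=> s0 h2 /=; rewrite /sqrt_series.
have s1 : s * s^-1 = 1 by rewrite divff.
move: (s^-1) s1 => r sr.
have -> : s ^+ 2 *: (r *: (r *: (a - h *: b + (3%:R * h ^+ 3) *: c - (5%:R * h ^+ 4) *: d)
  - h *: (r *: (b - h *: c + (3%:R * h ^+ 3) *: d - (5%:R * h ^+ 4) *: 0))
  + (3%:R * h ^+ 3) *: (r *: (c - h *: d + (3%:R * h ^+ 3) *: 0 - (5%:R * h ^+ 4) *: 0))
  - (5%:R * h ^+ 4) *: (r *: (d - h *: 0 + (3%:R * h ^+ 3) *: 0 - (5%:R * h ^+ 4) *: 0)))
  + r *: (r *: (b - h *: c + (3%:R * h ^+ 3) *: d - (5%:R * h ^+ 4) *: 0)
  - h *: (r *: (c - h *: d + (3%:R * h ^+ 3) *: 0 - (5%:R * h ^+ 4) *: 0))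
  + (3%:R * h ^+ 3) *: (r *: (d - h *: 0 + (3%:R * h ^+ 3) *: 0 - (5%:R * h ^+ 4) *: 0))
  - (5%:R * h ^+ 4) *: (r *: (0 - h *: 0 + (3%:R * h ^+ 3) *: 0 - (5%:R * h ^+ 4) *: 0))))
  = ((s * r) ^+ 2) *: (a + (1 - 2%:R * h) *: b + (h ^+ 2 - 2%:R * h + 6%:R * h ^+ 3) *: c
    + (h ^+ 2 + 6%:R * h ^+ 3 - 6%:R * h ^+ 4 - 10%:R * h ^+ 4) *: d) by lmod.
have -> : h ^+ 2 - 2%:R * h + 6%:R * h ^+ 3 = (2%:R * h - 1) * (3%:R * h ^+ 2 + 2%:R * h).
  by ring.
have -> : h ^+ 2 + 6%:R * h ^+ 3 - 6%:R * h ^+ 4 - 10%:R * h ^+ 4 =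
  (2%:R * h - 1) * (- 8%:R * h ^+ 3 - h ^+ 2) by ring.
by rewrite sr h2 subrr !mul0r !scale0r !addr0 expr1n scale1r.
Qed.

End SquareRootSeries.

(** * Division and square roots of units in the coinvariant algebra *)

Section EndomorphismAlgebra.

Variable K : numFieldType.
Local Notation End := (sl3_hom (big K) (big K)).
Local Notation X := (endX K).
Local Notation Y := (endY K).

Lemma endYX p : Y (X p) = X (Y p).
Proof. by rewrite !(endXE, endYE) yop_xop. Qed.
Lemma endXX p : X (X p) = X (Y p) - Y (Y p).
Proof. by rewrite !(endXE, endYE) xop_xop. Qed.
Lemma endYYY p : Y (Y (Y p)) = 0.
Proof. by rewrite !(endXE, endYE) yop3. Qed.

Lemma homD M N (f : @sl3_hom K M N) u v : f (u + v) = f u + f v.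
Proof. exact: linearD. Qed.
Lemma homB M N (f : @sl3_hom K M N) u v : f (u - v) = f u - f v.
Proof. exact: linearB. Qed.
Lemma homN M N (f : @sl3_hom K M N) u : f (- u) = - f u.
Proof. exact: linearN. Qed.

Lemma hom_sum M N (f : @sl3_hom K M N) (I : Type) (r : seq I) (p : pred I) (u : I -> M) :
  f (\sum_(i <- r | p i) u i) = \sum_(i <- r | p i) f (u i).
Proof. exact: linear_sum. Qed.

Lemma sum_homE M N (I : Type) (r : seq I) (p : pred I) (f : I -> @sl3_hom K M N) u :
  (\sum_(i <- r | p i) f i) u = \sum_(i <- r | p i) f i u.
Proof. by apply: (big_morph (fun g : sl3_hom M N => g u)). Qed.

(** A quotient of c_z by c_y for y <= z. For example Y - X divides Y^2 by X, since X(Y - X) = Y^2.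
    It is determined only up to the annihilator of c_y. *)
Definition gam (z y : ix) : End :=
  match z, y with
  | z, I1 => chom K z
  | Is, Is | It, It | Ist, Ist | Its, Its | Iw, Iw => idhom _
  | Ist, Is => Y - X | Ist, It => Y | Its, Is => X | Its, It => X - Y
  | Iw, Is => X \oh Y | Iw, It => X \oh X | Iw, Ist => X | Iw, Its => Y
  | _, _ => 0
  end.

Let rel := (endYX, endXX, endYYY).
Let addE (f g : End) p : (f + g) p = f p + g p. Proof. by []. Qed.
Let oppE (f : End) p : (- f) p = - f p. Proof. by []. Qed.

Lemma gamP z y p : ix_le y z -> chom K y (gam z y p) = chom K z p.
Proof.
case: y; case: z => //= _; rewrite ?(addE, oppE) /= ?(homD, homB, homN, hom0);
  do 4?rewrite ?rel ?(homD, homB, homN, hom0);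
  by first [done | rewrite subr0 | rewrite opprB addrCA subrr addr0].
Qed.

Lemma gam_id z p : gam z z p = p.
Proof. by case: z. Qed.

(* The ideal generated by X and Y in the endomorphism algebra. *)
Definition nilpotent_part (n : End) : Prop :=
  exists b1 b2 : End, forall p, n p = X (b1 p) + Y (b2 p).

Lemma nilpotent_part_lin c n m : nilpotent_part n -> nilpotent_part m ->
  nilpotent_part (c *: n + m).
Proof.
move=> [a1 [a2 an]] [b1 [b2 bm]]; exists (c *: a1 + b1), (c *: a2 + b2) => p.
rewrite addE -[(c *: n) p]/(c *: n p) an bm.
rewrite -[(c *: a1 + b1) p]/(c *: a1 p + b1 p) -[(c *: a2 + b2) p]/(c *: a2 p + b2 p).
by rewrite !hom_linear scalerDr addrACA.
Qed.

Lemma nilpotent_part_sum (I : Type) (r : seq I) (P : pred I) (f : I -> End) :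
  (forall i, P i -> nilpotent_part (f i)) -> nilpotent_part (\sum_(i <- r | P i) f i).
Proof.
move=> nf; apply: big_ind => // [|f1 f2 n1 n2].
  by exists 0, 0 => p; rewrite !hom0 addr0.
by rewrite -[f1]scale1r; apply: nilpotent_part_lin.
Qed.

Lemma nilpotent_part_comp n (a : End) : nilpotent_part n -> nilpotent_part (n \oh a).
Proof. by move=> [b1 [b2 nE]]; exists (b1 \oh a), (b2 \oh a) => p; exact: nE. Qed.

Lemma gam_nilpotent z y : z != y -> nilpotent_part (gam z y).
Proof.
have n0 : nilpotent_part 0 by exists 0, 0 => p; rewrite -[(0 : End) p]/(0 : big K) !hom0 addr0.
have nX : nilpotent_part X.
  by exists (idhom _), 0 => p; rewrite -[(0 : End) p]/(0 : big K) !hom0 addr0.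
have nY : nilpotent_part Y.
  by exists 0, (idhom _) => p; rewrite -[(0 : End) p]/(0 : big K) !hom0 add0r.
have nYX : nilpotent_part (Y - X).
  by rewrite addrC -scaleN1r; apply: nilpotent_part_lin.
have nXY : nilpotent_part (X - Y).
  by rewrite addrC -scaleN1r; apply: nilpotent_part_lin.
have nC := nilpotent_part_comp.
by case: z; case: y; rewrite ?ix_eqE // => _; rewrite /gam /chom;
  first [exact: n0 | exact: nX | exact: nY | exact: nYX | exact: nXY
        | exact: (nC _ _ nX) | exact: (nC _ _ nY) | exact: (nC _ _ (nC _ _ nX))].
Qed.

Section Commutative.

Hypothesis comm : forall (a b : End) p, a (b p) = b (a p).

(* All words of length m in X and Y kill p. *)
Let killed := fix killed (m : nat) (p : big K) : Prop :=
  if m is m'.+1 then killed m' (X p) /\ killed m' (Y p) else p = 0.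

Let killedD m p q : killed m p -> killed m q -> killed m (p + q).
Proof.
elim: m p q => [|m IHm] p q /=; first by move=> -> ->; rewrite addr0.
by move=> [p1 p2] [q1 q2]; rewrite !homD; split; apply: IHm.
Qed.

Let killed4 p : killed 4 p.
Proof.
have XXX q : X (X (X q)) = 0 by rewrite endXX !endYX endXX endYYY subr0 ?endYX subrr.
have XXYY q : X (X (Y (Y q))) = 0 by rewrite endXX !endYYY ?hom0 ?subr0 ?endYYY ?hom0 ?subrr.
have XYYY q : X (Y (Y (Y q))) = 0 by rewrite endYYY hom0.
by rewrite /= ?endYX; do ?split; rewrite ?endYX ?XXX ?XXYY ?XYYY ?endYYY ?hom0.
Qed.

(** The coinvariant algebra is graded with top degree 3, so every product of four elements of the
    ideal generated by X and Y vanishes. *)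
Lemma nilpotent_part4 n p : nilpotent_part n -> n (n (n (n p))) = 0.
Proof.
move=> [b1 [b2 nE]].
have step m q : (forall a : End, killed m.+1 (a q)) -> forall a : End, killed m (a (n q)).
  move=> kq a; rewrite nE homD (comm a X) (comm a Y).
  apply: killedD; first by case: (kq (a \oh b1)).
  by case: (kq (a \oh b2)).
have k4 (a : End) : killed 4 (a p) by apply: killed4.
exact: (step 0 _ (step 1 _ (step 2 _ (step 3 _ k4))) (idhom _)).
Qed.

(* k = s^-1 (1 + n)^(-1/2), by the binomial series. *)
Lemma inverse_square_root (n : End) (s : K) : nilpotent_part n -> s != 0 ->
  exists k : End, forall p, s ^+ 2 *: (k (k p) + n (k (k p))) = p.
Proof.
move=> /nilpotent_part4 n4 s0; pose h : K := 2%:R^-1.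
have h2 : 2%:R * h = 1 by rewrite mulfV ?pnatr_eq0.
pose k : End := s^-1 *: (idhom _ - h *: n + (3%:R * h ^+ 3) *: (n \oh n)
  - (5%:R * h ^+ 4) *: (n \oh n \oh n)).
exists k => p.
have kE q : k q = sqrt_series s h q (n q) (n (n q)) (n (n (n q))) by [].
have nE a b c d : n (sqrt_series s h a b c d) = sqrt_series s h (n a) (n b) (n c) (n d).
  by rewrite /sqrt_series homZ homB !homD homN !homZ.
rewrite (kE (k p)) !kE !nE !n4 ?hom0.
apply: etrans (sqrt_seriesP _ _ _ _ s0 h2); reflexivity.
Qed.

End Commutative.

End EndomorphismAlgebra.

(** * Tilting modules as quotients of the big projective module *)

Section FormNormalization.

Variable K : numFieldType.
Variable B : big K -> big K -> K.
Hypothesis cB : contravariant B.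
Hypothesis symB : forall p q, B p q = B q p.
Hypothesis B1 : B (vgen K I1) (vgen K I1) != 0.

Local Notation v_ := (vgen K).
Local Notation End := (sl3_hom (big K) (big K)).

Let comm := end_comm cB symB B1.
Let M i j := B (chom K i (v_ j)) (v_ j).

Lemma chom_vgen_le i j : ~~ ix_le i j -> chom K i (v_ j) = 0.
Proof. by move=> nle; rewrite chomE; apply: cop_gen_le. Qed.

Let M_le i j : ~~ ix_le i j -> M i j = 0.
Proof. by move=> nle; rewrite /M chom_vgen_le // (form_0l cB). Qed.

Let M_diag i : M i i != 0. Proof. exact: chom_diag. Qed.

Lemma ix_up_ind (P : ix -> Prop) :
  (forall z, (forall y, ix_le z y -> y != z -> P y) -> P z) -> forall z, P z.
Proof.
move=> step; have Pw : P Iw by apply: step => -[]; rewrite ?ix_eqE.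
have Pst : P Ist by apply: step => -[]; rewrite ?ix_eqE.
have Pts : P Its by apply: step => -[]; rewrite ?ix_eqE.
have Ps : P Is by apply: step => -[]; rewrite ?ix_eqE.
have Pt : P It by apply: step => -[]; rewrite ?ix_eqE.
by case=> //; apply: step => -[]; rewrite ?ix_eqE.
Qed.

Lemma comb_chomE (a : ix -> K) p : (\sum_z a z *: chom K z) p = \sum_z a z *: chom K z p.
Proof. by rewrite sum_homE. Qed.

(** The values of the forms B(c_i p, q) on the pairs (v_j, v_j) make a triangular matrix with
    nonzero diagonal, so they match those of [G], and [form_diag] concludes. Triangularity also
    confines the coefficients to the upper set [S]. *)
Lemma forms_span (S : pred ix) (G : big K -> big K -> K) : contravariant G ->
  (forall y z, ix_le y z -> S y -> S z) ->
  (forall z, ~~ S z -> G (v_ z) (v_ z) = 0) ->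
  exists2 a : ix -> K, forall z, ~~ S z -> a z = 0 &
    forall p q, G p q = B (\sum_z a z *: chom K z p) q.
Proof.
move=> cG upS G0.
have [|a aM] := @row_space_solution K ix M (fun j => G (v_ j) (v_ j)).
  move=> k ker; suff k0 : forall z, k z = 0 by rewrite bigop.big1 // => j _; rewrite (k0 j) mulr0.
  elim/ix_up_ind => z k0.
  have := ker z; rewrite (bigD1 z) //= bigop.big1 ?addr0 => [/eqP|j njz].
    by rewrite mulf_eq0 (negPf (M_diag z)) => /eqP.
  by have [le|nle] := boolP (ix_le z j); [rewrite k0 // mulr0|rewrite M_le // mul0r].
exists a => [z|p q].
  elim/ix_order_ind: z => z a0 nS.
  have := aM z; rewrite G0 // (bigD1 z) //= bigop.big1 ?addr0 => [/eqP|j njz].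
    by rewrite mulf_eq0 (negPf (M_diag z)) orbF => /eqP.
  have [le|nlej] := boolP (ix_le j z); last by rewrite M_le // mulr0.
  by rewrite a0 ?mul0r //; apply: contra nS; apply: upS.
apply/eqP; rewrite -subr_eq0 -mulN1r; apply/eqP.
pose D u v := G u v + (-1) * B ((\sum_z a z *: chom K z) u) v.
rewrite -comb_chomE -[LHS]/(D p q); apply: form_diag => [|j].
  apply: contravariant_lin => //.
  exact: (contravariant_hom _ (idhom _) cB).
rewrite /D -aM comb_chomE (form_suml cB); apply/eqP; rewrite mulN1r subr_eq0; apply/eqP.
by apply: eq_bigr => i _; rewrite (form_scalel cB).
Qed.

Lemma comb_chom_vgen (a : ix -> K) x : (forall z, ~~ ix_le x z -> a z = 0) ->
  \sum_z a z *: chom K z (v_ x) = a x *: chom K x (v_ x).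
Proof.
move=> a0; rewrite (bigD1 x) //= bigop.big1 ?addr0 // => j njx.
have [le|nle] := boolP (ix_le j x); last by rewrite chom_vgen_le // scaler0.
rewrite a0 ?scale0r //; apply: contra njx => le'.
by apply/eqP/ix_le_anti; rewrite ?le.
Qed.

Lemma chom_free (a : ix -> K) : (forall p, \sum_z a z *: chom K z p = 0) -> forall z, a z = 0.
Proof.
move=> a0; elim/ix_order_ind => z IH.
have /(congr1 (fun u => B u (v_ z))) := a0 (v_ z).
rewrite (bigD1 z) //= bigop.big1 ?addr0 ?(form_0l cB) => [/eqP|j njz].
  by rewrite (form_scalel cB) mulf_eq0 (negPf (M_diag z)) orbF => /eqP.
have [le|nle] := boolP (ix_le j z); first by rewrite IH // scale0r.
by rewrite chom_vgen_le // scaler0.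
Qed.

(** Going down from the top, c_z p = 0 because c_x divides c_z; once the components above z vanish,
    c_z p is the image of p_z under an injective right multiplication. *)
Lemma chom_ker x p z : chom K x p = 0 -> ix_le x z -> p z = 0.
Proof.
move=> cp0; elim/ix_up_ind: z => z IH le.
have : chom K z p = 0 by rewrite -(gamP p le) comm cp0 hom0.
rewrite chomE cop_top => [|j zj njz]; last first.
  by apply: IH; rewrite ?(ix_le_trans le).
move/(congr1 (fun q : big K => (q : ix -> U K) I1)); rewrite /fmono eqxx => e.
have {}e : shapovalov z (p z) = 0 by exact: e.
by case: z e {le IH} => /=; do ?[move/ur1_eq0|move/ur2_eq0].
Qed.

Hypothesis square_roots : forall c : K, exists s, s ^+ 2 = c.

(** [G] corresponds to a combination of the c_z with z >= x, which is c_x times a unit a_x (1 + n)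
    with n nilpotent. An inverse square root [k] of the unit, moved across by self-adjointness and
    commutativity, absorbs it. *)
Lemma form_normal (G : big K -> big K -> K) (x : ix) : contravariant G ->
  (forall z, ~~ ix_le x z -> G (v_ z) (v_ z) = 0) -> G (v_ x) (v_ x) != 0 ->
  exists k : End, (forall p, exists q, k q = p) /\
    forall p q, G (k p) (k q) = B (chom K x p) q.
Proof.
move=> cG G0 Gx; have [y z|a a0 GE] := forms_span cG _ G0.
  by move=> yz /ix_le_trans; apply.
have Mx : G (v_ x) (v_ x) = a x * M x x.
  by rewrite GE comb_chom_vgen // (form_scalel cB).
have ax : a x != 0 by apply: contra Gx => /eqP ax0; rewrite Mx ax0 mul0r.
have [s ss] := square_roots (a x).
have s0 : s != 0 by apply: contra ax => /eqP s0; rewrite -ss s0 expr0n.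
pose n : End := \sum_(z | z != x) ((a x)^-1 * a z) *: gam K z x.
have nn : nilpotent_part n.
  apply: nilpotent_part_sum => z nzx; rewrite -[_ *: _]addr0; apply: nilpotent_part_lin.
    exact: gam_nilpotent.
  by exists 0, 0 => p; rewrite -[(0 : End) p]/(0 : big K) !hom0 addr0.
have [k kE] := inverse_square_root comm nn s0.
(* Each c_z with z >= x factors as c_x times [gam], and the other coefficients vanish. *)
have nE p : \sum_z a z *: chom K z p = a x *: (chom K x (p + n p)).
  rewrite homD sum_homE hom_sum scalerDr scaler_sumr (bigD1 x) //=; congr (_ + _).
  apply: eq_bigr => z nzx.
  apply: (@etrans _ _ (a x *: chom K x ((a x)^-1 * a z *: gam K z x p))) => //.
  rewrite homZ scalerA mulrA mulfV // mul1r.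
  have [le|nle] := boolP (ix_le x z); first by rewrite gamP.
  by rewrite a0 // !scale0r.
exists k; split=> [p|p q].
  exists (a x *: (k p + n (k p))); rewrite -ss homZ homD (comm k n).
  by rewrite -[RHS](kE p).
rewrite GE nE -(end_selfadjoint cB symB k); congr (B _ _).
rewrite homZ (comm k) homD (comm k n) -[in RHS](kE p) homZ -ss; congr (_ *: chom K x _).
Qed.

End FormNormalization.

(** Inverts the Cartan matrix, of determinant 3. *)
Lemma cartan_solve (K : fieldType) (a b m n m' n' : K) :
  a - m *+ 2 + n = a - m' *+ 2 + n' -> b + m - n *+ 2 = b + m' - n' *+ 2 ->
  m *+ 3 = m' *+ 3 /\ n *+ 3 = n' *+ 3.
Proof.
move=> /eqP; rewrite -subr_eq0 => /eqP E1 /eqP; rewrite -subr_eq0 => /eqP E2.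
split; apply/eqP; rewrite -subr_eq0; apply/eqP.
  have -> : m *+ 3 - m' *+ 3 = - (2%:R * ((a - m *+ 2 + n) - (a - m' *+ 2 + n'))
    + ((b + m - n *+ 2) - (b + m' - n' *+ 2))) by ring.
  by rewrite E1 E2 mulr0 addr0 oppr0.
have -> : n *+ 3 - n' *+ 3 = - (2%:R * ((b + m - n *+ 2) - (b + m' - n' *+ 2))
  + ((a - m *+ 2 + n) - (a - m' *+ 2 + n'))) by ring.
by rewrite E1 E2 mulr0 addr0 oppr0.
Qed.

(** * Monomials of a given weight in the big projective module *)

Section MonomialSpanning.

Variable K : numFieldType.

Definition bmono (z : ix) (i j k : nat) : big K := uext (vgen K z) (umon K i j k).

Lemma bmono_weight z i j k :
  weight_vector (lower (ix_weight K z) (i + j) (j + k)) (bmono z i j k).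
Proof. exact/weight_uext/vgen_weight. Qed.

Lemma hom_uext N (f : sl3_hom (big K) N) p : f p = \sum_z uext (f (vgen K z)) (p z).
Proof.
have fam z : sl3_family (fun y => f (vgen K y)) z.
  have [h1 h2 e1 e2] := vgen_family K z.
  split; rewrite -hom_act ?h1 ?h2 ?e1 ?e2 ?homZ //; case: z {h1 h2 e1 e2} => /=;
    by rewrite ?hom0 ?homZ // ?(homD, homB, homN, homZ, hom_act).
have [g gv gE] := big_hom fam.
by rewrite -gE; congr (hom_fun _ p); apply: big_hom_eq => z; rewrite gv.
Qed.

Lemma uext_lin (N : sl3_module K) (n : N) c u u' :
  uext n (c *: u + u') = c *: uext n u + uext n u'.
Proof. exact: (linearP (uext n)). Qed.

Lemma bmono_ind (P : big K -> Prop) :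
  (forall c p q, P p -> P q -> P (c *: p + q)) -> (forall z i j k, P (bmono z i j k)) ->
  forall p, P p.
Proof.
move=> PD Pb p.
have P0 : P 0 by have := PD (-1) _ _ (Pb I1 0 0 0) (Pb I1 0 0 0); rewrite scaleN1r addNr.
have -> : p = \sum_z uext (vgen K z) (p z) := hom_uext (idhom _) p.
apply: big_ind => // [u v Pu Pv|z _].
  by rewrite -[u]scale1r; apply: PD.
elim/umon_ind: (p z) => [|c u u' Pu Pu'|i j k] /=; [by rewrite linear0 | | exact: Pb].
by rewrite uext_lin; apply: PD.
Qed.

Lemma lower_eq (lam : 'rV[K]_3) m n m' n' :
  same_weight (lower lam m n) (lower lam m' n') -> m = m' /\ n = n'.
Proof.
case/andP; rewrite !wt1_lower !wt2_lower => /eqP E1 /eqP E2.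
have [F1 F2] := cartan_solve E1 E2.
by split; apply/eqP; rewrite -(eqr_nat K) -(@eqr_pMn2r K 3 isT) ?F1 ?F2.
Qed.

Lemma bmono_bound (lam : 'rV[K]_3) : exists N : nat, forall z i j k,
  same_weight (lower (ix_weight K z) (i + j) (j + k)) lam -> [/\ (i < N)%N, (j < N)%N & (k < N)%N].
Proof.
have bz z : exists N : nat, forall i j k,
    same_weight (lower (ix_weight K z) (i + j) (j + k)) lam -> (i + j + k < N)%N.
  have [[m [n mn]]|none] := pselect (exists m n, same_weight (lower (ix_weight K z) m n) lam).
    exists (m + n).+1 => i j k E; rewrite same_weightC in E.
    have [-> ->] := lower_eq (same_weight_trans mn E); lia.
  by exists 0 => i j k E; case: none; exists (i + j)%N, (j + k)%N.
pose N z := projT1 (cid (bz z)).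
exists (\max_z N z) => z i j k E.
have := leq_trans (projT2 (cid (bz z)) i j k E) (@leq_bigmax _ N z) => le; split; lia.
Qed.

End MonomialSpanning.

(** * The surjection from the big projective module to a tilting module *)

Section TiltingQuotient.

Variable K : numFieldType.
Variable B : big K -> big K -> K.
Hypothesis cB : contravariant B.
Hypothesis symB : forall p q, B p q = B q p.
Hypothesis B1 : B (vgen K I1) (vgen K I1) != 0.
Hypothesis square_roots : forall c : K, exists s, s ^+ 2 = c.

Variables (T : sl3_module K) (F : T -> T -> K).
Hypothesis cF : contravariant F.
Hypothesis symF : forall u v, F u v = F v u.
Hypotheses (wT : weight_module T) (aT : acyclic T) (indT : indecomposable T).

(** The homomorphism with v_x |-> w, corrected by [form_normal], has the required form. Its image
    meets its orthogonal complement trivially and together they span [T]; the image is nonzero, so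
    indecomposability kills the complement. *)
Lemma tilting_quotient x (w : T) : singular_vector (ix_weight K x) w -> F w w != 0 ->
  exists pi : sl3_hom (big K) T, (forall t, exists p, pi p = t) /\
    forall p q, F (pi p) (pi q) = B (chom K x p) q.
Proof.
move=> sw Fw; have [f fx f0] := singular_hom wT aT sw.
have cG : contravariant (fun p q => F (f p) (f q)) := contravariant_hom f f cF.
have [z nle||k [kS kE]] := form_normal cB symB B1 square_roots cG (x := x).
- by rewrite f0 // (form_0l cF).
- by rewrite fx.
pose pi := f \oh k; exists pi; split=> //.
have piE p q : F (pi p) (pi q) = B (chom K x p) q := kE p q.
(* If c_x p = 0 then c_x (k p) = 0, so k p has no components at z >= x, and [f] kills the remaining
   generators. *)
have ker p : chom K x p = 0 -> pi p = 0.
  move=> cp; rewrite /= hom_uext bigop.big1 // => z _.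
  have [le|nle] := boolP (ix_le x z); last first.
    rewrite f0 //; elim/umon_ind: (k p z) => [|c u u' E E'|i j l]; first by rewrite linear0.
      by rewrite uext_lin E E' scaler0 addr0.
    rewrite /uext lext_umon; elim: i => [|i /= ->]; last exact: act0.
    elim: j => [|j /= ->]; last exact: act0.
    by elim: l => [|l /= ->] //; apply: act0.
  by rewrite (chom_ker cB symB B1 _ le) ?linear0 // (end_comm cB symB B1) cp hom0.
pose A (v : T) := exists p, pi p = v.
pose A' (v : T) := forall p, F (pi p) v = 0.
have sA : submodule A.
  split=> [|a _ _ [p <-] [q <-]|y _ [p <-]]; first by exists 0; apply: hom0.
    by exists (a *: p + q); rewrite hom_linear.
  by exists (act y p); rewrite hom_act.
have sA' : submodule A'.
  split=> [p|a u v Au Av p|y v Av p]; first exact: (form_0r cF).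
    by rewrite (form_Dr cF) Au Av mulr0 addr0.
  by rewrite symF (form_act cF) symF -hom_act.
have disj v : A v -> A' v -> v = 0.
  move=> [p <-] Ap; apply: ker; apply: (big_nondegenerate cB symB B1) => q.
  by rewrite -piE symF.
(* Orthogonal projection inside one weight space. Only finitely many monomials have weight [lam],
   and the Gram system is solvable because a kernel vector yields an element of the image orthogonal
   to the image, hence 0. *)
have weight_sum lam (v : T) : weight_vector lam v -> exists2 p, weight_vector lam p & A' (v - pi p).
  move=> wv; have [N bN] := bmono_bound lam.
  pose J : finType := (ix * 'I_N * 'I_N * 'I_N)%type.
  pose b (c : J) : big K := let: (z, i, j, l) := c in
    if same_weight (lower (ix_weight K z) (i + j) (j + l)) lam then bmono K z i j l else 0.
  have wb c : weight_vector lam (b c).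
    case: c => -[[z i] j] l /=; case: ifP => [E|_]; last exact: weight_vector0.
    exact: same_weight_vector E (bmono_weight _ _ _ _).
  have orth (u : T) : weight_vector lam u -> (forall c, F (pi (b c)) u = 0) -> A' u.
    move=> wu Fb; elim/bmono_ind => [c p q Fp Fq|z i j l].
      by rewrite hom_linear (form_Dl cF) Fp Fq mulr0 addr0.
    have [E|nE] := boolP (same_weight (lower (ix_weight K z) (i + j) (j + l)) lam).
      have [li lj ll] := bN _ _ _ _ E.
      by have := Fb (z, Ordinal li, Ordinal lj, Ordinal ll); rewrite /b /= E.
    by apply: (form_weight cF _ wu nE); apply/weight_vector_hom/bmono_weight.
  have [|c cE] := @row_space_solution K J (fun i j => F (pi (b i)) (pi (b j)))
      (fun j => F (pi (b j)) v).
    move=> d dE; pose y := \sum_j d j *: b j.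
    have wy : weight_vector lam y by apply: weight_vector_sum => j _; apply: weight_vectorZ.
    have y0 : pi y = 0.
      apply: disj; first by exists y.
      apply: orth => [|i]; first exact: weight_vector_hom.
      rewrite hom_sum (form_sumr cF) -[RHS](dE i); apply: eq_bigr => j _.
      by rewrite homZ (form_scaler cF) mulrC.
    have := form_0l cF v; rewrite -y0 hom_sum (form_suml cF) => E.
    by rewrite -[RHS]E; apply: eq_bigr => j _; rewrite homZ (form_scalel cF) mulrC.
  pose p := \sum_i c i *: b i.
  have wp : weight_vector lam p by apply: weight_vector_sum => j _; apply: weight_vectorZ.
  exists p => //; apply: orth => [|j].
    by apply: weight_vectorD => //; apply/weight_vectorN/weight_vector_hom.
  rewrite (form_addr cF) (form_oppr cF) -cE hom_sum (form_sumr cF); apply/eqP; rewrite subr_eq0.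
  by apply/eqP/eq_bigr => i _; rewrite homZ (form_scaler cF) symF.
have dec v : exists a c, [/\ A a, A' c & v = a + c].
  have [n [b [wb ->]]] := wT v; apply: (big_ind (fun v => exists a c, [/\ A a, A' c & v = a + c])).
  - by exists 0, 0; case: sA => A0 _ _; case: sA' => A'0 _ _; rewrite addr0.
  - move=> _ _ [a [c [Aa Ac ->]]] [a' [c' [Aa' Ac' ->]]]; exists (a + a'), (c + c').
    case: sA => _ AD _; case: sA' => _ A'D _; split; last exact: addrACA.
      by rewrite -[a]scale1r; apply: AD.
    by rewrite -[c]scale1r; apply: A'D.
  - move=> i _; have [lam wl] := wb i; have [p _ Ap] := weight_sum _ _ wl.
    by exists (pi p), (b i - pi p); split=> //; [exists p | rewrite addrC subrK].
have [A0|A0] := indT.2 A A' sA sA' disj dec.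
  have := chom_diag cB B1 x; rewrite -piE [pi _]A0 ?(form_0l cF) ?eqxx //.
  by exists (vgen K x).
move=> t; have [_ [c [[p <-] Ac ->]]] := dec t.
by exists p; rewrite (A0 _ Ac) addr0.
Qed.

End TiltingQuotient.

(** * Homomorphisms between the tilting modules *)

Section HomFactor.

Variables (K : fieldType) (M N P : sl3_module K) (pi : sl3_hom M N).
Hypothesis pi_surj : forall t, exists p, pi p = t.

Lemma hom_factor (h : sl3_hom M P) : (forall p, pi p = 0 -> h p = 0) ->
  exists f : sl3_hom N P, forall p, f (pi p) = h p.
Proof.
move=> ker; pose s t := projT1 (cid (pi_surj t)).
have sK t : pi (s t) = t := projT2 (cid (pi_surj t)).
have hE p q : pi p = pi q -> h p = h q.
  move=> e; have := hom_linear h (-1) p q; rewrite ker => [|//].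
    by rewrite scaleN1r => /esym/eqP; rewrite addrC subr_eq0 => /eqP.
  by rewrite hom_linear e scaleN1r addNr.
have fP : (fun t => h (s t)) \in @is_hom K N P.
  apply/asboolP; split=> [c u v|x v].
    by rewrite -hom_linear; apply: hE; rewrite hom_linear !sK.
  by rewrite -hom_act; apply: hE; rewrite hom_act !sK.
by exists (Sl3Hom fP) => p; apply: hE; rewrite sK.
Qed.

Lemma hom_surj_eq (f g : sl3_hom N P) : (forall p, f (pi p) = g (pi p)) -> f = g.
Proof. by move=> fg; apply/val_inj/funext => t; have [p <-] := pi_surj t; apply: fg. Qed.

End HomFactor.

(** * Anisotropic highest weight vectors *)

Section HighestWeightVector.

Variables (K : numFieldType) (T : sl3_module K) (F : T -> T -> K).
Hypothesis cF : contravariant F.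
Hypothesis symF : forall u v, F u v = F v u.
Hypothesis ndF : forall u, (forall v, F u v = 0) -> u = 0.

Lemma highest_weight_singular lam (v : T) :
  has_highest_weight lam T -> weight_vector lam v -> singular_vector lam v.
Proof.
move=> [_ hw] wv; apply/singular_vectorP; split=> //.
have tr (a b : K) m n : a + 2%:R = a - m%:R *+ 2 + n%:R -> b - 1 = b + m%:R - n%:R *+ 2 -> False.
  move=> E1 E2; have [||E3 _] := @cartan_solve K a b 0 0 (m%:R + 1) n%:R.
  - by rewrite mul0rn subr0 addr0 mulrnDl opprD addrA [RHS]addrAC -E1 addrK.
  - by rewrite mul0rn subr0 addr0 addrA [RHS]addrAC -E2 subrK.
  by move/eqP: E3; rewrite mul0rn eq_sym mulrn_eq0 /= natr1 pnatr_eq0.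
split; apply/eqP/negPn/negP => nz; [have we := weight_e1 wv|have we := weight_e2 wv];
  have [m [n wl]] := hw _ _ nz we; have := weight_vector_same nz we wl;
  rewrite -/(lower lam m n) /same_weight wt1_lower wt2_lower wt1D wt2D
    ?(wt_root01 K).1 ?(wt_root01 K).2 ?(wt_root12 K).1 ?(wt_root12 K).2 => /andP[/eqP E1 /eqP E2].
- exact: tr E1 E2.
- by apply: (tr (wt2 lam) (wt1 lam) n m); rewrite (E1, E2) addrAC.
Qed.

(** Different weight spaces are orthogonal, so the form is nonzero on the highest weight space;
    being symmetric in characteristic 0, it is not alternating there. *)
Lemma highest_weight_anisotropic lam : weight_module T -> has_highest_weight lam T ->
  exists2 w : T, singular_vector lam w & F w w != 0.
Proof.
move=> wT hw; suff [w ww Fw] : exists2 w, weight_vector lam w & F w w != 0.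
  by exists w => //; apply: highest_weight_singular.
have [[v vnz wv] _] := hw.
have [u wu Fvu] : exists2 u, weight_vector lam u & F v u != 0.
  apply: contrapT => none; case/eqP: vnz; apply: ndF => u.
  have [n [b [wb ->]]] := wT u; rewrite (form_sumr cF) bigop.big1 // => i _.
  have [mu wmu] := wb i.
  have [s|ns] := boolP (same_weight mu lam); last first.
    by apply: (form_weight cF wv wmu); rewrite same_weightC.
  apply/eqP; apply: contrapT => /negP nz; apply: none; exists (b i) => //.
  exact: same_weight_vector s wmu.
have [v0|] := eqVneq (F v v) 0; last by exists v.
have [u0|] := eqVneq (F u u) 0; last by exists u.
exists (v + u); first exact: weight_vectorD.
rewrite !(form_addl cF) !(form_addr cF) v0 u0 add0r addr0 [F u v]symF -mulr2n.
by rewrite mulrn_eq0.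
Qed.

End HighestWeightVector.

(** * Up and down maps, and bases of the spaces of homomorphisms *)

Section TiltingFamily.

Variable K : numFieldType.
Variable B : big K -> big K -> K.
Hypothesis cB : contravariant B.
Hypothesis symB : forall p q, B p q = B q p.
Hypothesis B1 : B (vgen K I1) (vgen K I1) != 0.

Variables (I : Type) (o : I -> ix) (T : I -> sl3_module K).
Variable F : forall i, T i -> T i -> K.
Hypothesis cF : forall i, contravariant (@F i).
Hypothesis symF : forall i u v, @F i u v = F v u.
Hypothesis ndF : forall i (u : T i), (forall v, F u v = 0) -> u = 0.
Hypotheses (wT : forall i, weight_module (T i)) (aT : forall i, acyclic (T i)).
Variable pi : forall i, sl3_hom (big K) (T i).
Hypothesis pi_surj : forall i t, exists p, pi i p = t.
Hypothesis piE : forall i p q, F (pi i p) (pi i q) = B (chom K (o i) p) q.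

Local Notation v_ := (vgen K).
Local Notation "x >= y" := (ix_le (o y) (o x)).

Implicit Types x y : I.

Let ndB := big_nondegenerate cB symB B1.
Let comm := end_comm cB symB B1.

(** Both forms are nondegenerate. Thus [T x] is the quotient of [big] by the kernel of c_x,
    isomorphic to c_x [big]. *)
Lemma pi_eq0 x p : pi x p = 0 <-> chom K (o x) p = 0.
Proof.
split=> e; first by apply: ndB => q; rewrite -piE e (form_0l (cF x)).
by apply: ndF => t; have [q <-] := pi_surj t; rewrite piE e (form_0l cB).
Qed.

Lemma pi_eq x p q : pi x p = pi x q <-> chom K (o x) p = chom K (o x) q.
Proof.
by split=> /eqP; rewrite -subr_eq0 -homB => /eqP/pi_eq0; rewrite homB => /eqP;
  rewrite subr_eq0 => /eqP.
Qed.

(** Under [T x] = c_x [big] this is the inclusion in c_y [big], because c_x p = c_y ([gam] p). For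
    incomparable indices the zero map is a placeholder. *)
Lemma up_exists x y : exists f : sl3_hom (T x) (T y),
  x >= y -> forall p, f (pi x p) = pi y (gam K (o x) (o y) p).
Proof.
have [le|] := boolP (x >= y); last by exists 0.
have [p|f fE] := hom_factor (@pi_surj x) (h := pi y \oh gam K (o x) (o y)).
  by move=> /pi_eq0 p0; apply/pi_eq0; rewrite gamP.
by exists f.
Qed.

(** Multiplication by [gam] from c_y [big] to c_x [big]; in terms of the quotients of [big] it is
    the canonical projection. *)
Lemma down_exists x y : exists f : sl3_hom (T y) (T x),
  x >= y -> forall p, f (pi y p) = pi x p.
Proof.
have [le|] := boolP (x >= y); last by exists 0.
have [p|f fE] := hom_factor (@pi_surj y) (h := pi x); last by exists f.
by move=> /pi_eq0 p0; apply/pi_eq0; rewrite -(gamP p le) comm p0 hom0.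
Qed.

Definition up_map x y : sl3_hom (T x) (T y) := projT1 (cid (up_exists x y)).
Definition down_map x y : sl3_hom (T y) (T x) := projT1 (cid (down_exists x y)).

Lemma up_mapE x y p : x >= y -> up_map x y (pi x p) = pi y (gam K (o x) (o y) p).
Proof. by move=> le; apply: (projT2 (cid (up_exists x y))). Qed.
Lemma down_mapE x y p : x >= y -> down_map x y (pi y p) = pi x p.
Proof. by move=> le; apply: (projT2 (cid (down_exists x y))). Qed.

Lemma gam_trans (x y z : ix) p : ix_le y x -> ix_le z y ->
  chom K z (gam K y z (gam K x y p)) = chom K z (gam K x z p).
Proof. by move=> yx zy; rewrite !gamP // (ix_le_trans zy). Qed.

Lemma up_map_comp x y z : x >= y -> y >= z -> up_map y z \oh up_map x y = up_map x z.
Proof.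
move=> xy yz; apply: (hom_surj_eq (@pi_surj x)) => p.
by rewrite /= !up_mapE ?(ix_le_trans yz xy) //; apply/pi_eq; apply: gam_trans.
Qed.

Lemma up_map_id x : up_map x x = idhom (T x).
Proof.
by apply: (hom_surj_eq (@pi_surj x)) => p; rewrite up_mapE ?ix_lexx // gam_id.
Qed.

(** Both sides become B(c_x p, q), thanks to the common normalisation of the forms. Hence the dual
    of an up map is a down map with no scalar correction. *)
Lemma up_down_adjoint x y u v : x >= y -> F (down_map x y u) v = F u (up_map x y v).
Proof.
move=> le; have [[p <-] [q <-]] := (pi_surj u, pi_surj v).
by rewrite down_mapE // up_mapE // !piE -(end_selfadjoint cB symB) comm gamP // comm.
Qed.

(** The form F(h p, pi q) on [big] is contravariant, so [forms_span] writes it with the c_z, each of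
    which is c_y times [gam]; nondegeneracy then recovers [h]. *)
Lemma hom_up_span x y (h : sl3_hom (big K) (T y)) (S : pred ix) :
  (forall z w, ix_le z w -> S z -> S w) -> (forall z, S z -> ix_le (o y) z) ->
  (forall z, ~~ S z -> h (v_ z) = 0 \/ pi y (v_ z) = 0) ->
  exists2 a : ix -> K, forall z, ~~ S z -> a z = 0 &
    forall p, h p = pi y (\sum_z a z *: gam K z (o y) p).
Proof.
move=> upS Sy h0.
have [|z w|z nS|a a0 aE] := @forms_span K B cB B1 S (fun p q => F (h p) (pi y q)).
- exact: (contravariant_hom h (pi y) (cF y)).
- exact: upS.
- by case: (h0 z nS) => ->; rewrite ?(form_0l (cF y)) ?(form_0r (cF y)).
exists a => // p; apply/eqP; rewrite -subr_eq0; apply/eqP/ndF => t; have [q <-] := pi_surj t.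
rewrite (form_addl (cF y)) (form_oppl (cF y)) aE piE; apply/eqP; rewrite subr_eq0; apply/eqP.
congr (B _ q); rewrite hom_sum; apply: eq_bigr => z _; rewrite homZ.
have [Sz|nS] := boolP (S z); first by rewrite gamP // Sy.
by rewrite a0 // !scale0r.
Qed.

(** The multiplicity one property. [m] is the image of v_x under some h given by [hom_up_span], and
    of the terms with z >= x only z = x survives on v_x. *)
Lemma singular_in_T x y (m : T y) : x >= y -> singular_vector (ix_weight K (o x)) m ->
  exists c, m = c *: pi y (gam K (o x) (o y) (v_ (o x))).
Proof.
move=> le sm; have [h <- h0] := singular_hom (@wT y) (@aT y) sm.
have [z w zw|z|z nS|a a0 ->] := @hom_up_span x y h (ix_le (o x)).
- by move=> /ix_le_trans; apply.
- exact: ix_le_trans.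
- by left; apply: h0.
exists (a (o x)); rewrite -homZ; apply/pi_eq; rewrite homZ gamP //.
rewrite -(comb_chom_vgen a0) hom_sum; apply: eq_bigr => z _; rewrite homZ.
have [Sz|nS] := boolP (ix_le (o x) z); last by rewrite a0 // !scale0r.
by rewrite gamP // (ix_le_trans le).
Qed.

Lemma pi_top_neq0 x y : x >= y -> pi y (gam K (o x) (o y) (v_ (o x))) != 0.
Proof.
move=> le; apply/eqP => /pi_eq0; rewrite gamP // => e.
by have := chom_diag cB B1 (o x); rewrite e (form_0l cB) eqxx.
Qed.

Section Lifts.

Variables (Delta : I -> sl3_module K) (iota : forall i, sl3_hom (Delta i) (T i)).
Hypothesis Delta_verma : forall i, is_verma (ix_weight K (o i)) (Delta i).
Hypothesis iota_inj : forall i, injective (iota i).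

Lemma up_map_lift x y : x >= y ->
  up_map x y \oh iota x != 0 /\
  forall h : sl3_hom (Delta x) (T y), exists c, h = c *: (up_map x y \oh iota x).
Proof.
move=> le; have [v sv univ] := Delta_verma x.
have si (N : sl3_module K) (f : sl3_hom (Delta x) N) : singular_vector (ix_weight K (o x)) (f v).
  case: sv => wv ev; split; first exact: weight_vector_hom.
  by move=> n nU; rewrite -hom_act ev // hom0.
have [c cE] := singular_in_T (ix_lexx (o x)) (si _ (iota x)).
have vnz : v != 0.
  apply/eqP => v0; have [f [f0 _]] := univ _ _ (verma_singular (ix_weight K (o x))).
  have E : 0 = verma_gen (ix_weight K (o x)) by rewrite -f0 v0 hom0.
  have /esym := congr1 (fun p : unit -> U K => p tt) E.
  rewrite /verma_gen /fgen eqxx => one0.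
  by case/eqP: (oner_neq0 (U K)); apply: one0.
have cnz : c != 0.
  apply: contra vnz => /eqP c0; apply/eqP/(@iota_inj x).
  by rewrite cE c0 scale0r hom0.
have upE : up_map x y (iota x v) = c *: pi y (gam K (o x) (o y) (v_ (o x))).
  by rewrite cE homZ up_mapE // gam_id.
split.
  apply/eqP => e; have := pi_top_neq0 le; apply/negP; rewrite negbK.
  have := congr1 (fun f : sl3_hom (Delta x) (T y) => f v) e; rewrite /= upE => /eqP.
  by rewrite scaler_eq0 (negPf cnz).
move=> h; have [d dE] := singular_in_T le (si _ h).
exists (d / c); have [f [_ funiq]] := univ _ _ (si _ h).
rewrite -(funiq h) //; apply: funiq.
transitivity ((d / c) *: up_map x y (iota x v)) => //.
by rewrite upE scalerA divfK // dE.
Qed.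

End Lifts.

(** With [hom_free], a basis of [Hom(T x, T y)] indexed by the z above both: the down map to z
    followed by the up map to y. *)
Lemma hom_span x y (f : sl3_hom (T x) (T y)) :
  exists a : ix -> K, forall p,
    f (pi x p) = pi y (\sum_(z | ix_le (o x) z && ix_le (o y) z) a z *: gam K z (o y) p).
Proof.
have pi0 i z : ~~ ix_le (o i) z -> pi i (v_ z) = 0.
  by move=> nle; apply/pi_eq0; apply: chom_vgen_le.
have [z w zw|z|z|a a0 aE] :=
    @hom_up_span x y (f \oh pi x) [pred z | ix_le (o x) z && ix_le (o y) z].
- by move=> /andP[xz yz]; rewrite /= !(ix_le_trans _ zw).
- by case/andP.
- by rewrite /= negb_and => /orP[/pi0|/pi0] e; [left; rewrite e hom0|right].
exists a => p; rewrite -[LHS]/((f \oh pi x) p) aE; congr (pi y _).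
rewrite [RHS]big_mkcond; apply: eq_bigr => z _; case: ifPn => // nS.
by rewrite a0 // scale0r.
Qed.

Lemma hom_free x y (a : ix -> K) :
  (forall p, pi y (\sum_(z | ix_le (o x) z && ix_le (o y) z) a z *: gam K z (o y) p) = 0) ->
  forall z, ix_le (o x) z -> ix_le (o y) z -> a z = 0.
Proof.
move=> e z xz yz; pose b z := if ix_le (o x) z && ix_le (o y) z then a z else 0.
suff : b z = 0 by rewrite /b xz yz.
move: z {xz yz}; apply: (chom_free cB B1) => p.
have /pi_eq0 E := e p; rewrite -[RHS]E hom_sum [RHS]big_mkcond /=.
apply: eq_bigr => z _; rewrite /b.
by case: ifP => [/andP[_ yz]|_]; [rewrite homZ gamP|rewrite scale0r].
Qed.

End TiltingFamily.

(** * The Weyl group *)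

Definition toW (z : ix) : W :=
  match z with I1 => w1 | Is => rs | It => rt | Ist => wst | Its => wts | Iw => w0 end.

Definition img (z : ix) : 'I_3 * 'I_3 * 'I_3 :=
  match z with
  | I1 => (0, 1, 2%:R) | Is => (1, 0, 2%:R) | It => (0, 2%:R, 1)
  | Ist => (2%:R, 0, 1) | Its => (1, 2%:R, 0) | Iw => (2%:R, 1, 0) end.

Lemma toWE z : (toW z 0, toW z 1, toW z 2%:R) = img z.
Proof.
have s0 : rs 0 = 1 by apply: tpermL.
have s1 : rs 1 = 0 by apply: tpermR.
have s2 : rs 2%:R = 2%:R by apply: tpermD.
have t0 : rt 0 = 0 by apply: tpermD.
have t1 : rt 1 = 2%:R by apply: tpermL.
have t2 : rt 2%:R = 1 by apply: tpermR.
by case: z; rewrite /toW /w1 /wst /wts /w0 ?permM ?perm1 ?(s0, s1, s2, t0, t1, t2).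
Qed.

Lemma toW_val z :
  [/\ toW z 0 = (img z).1.1, toW z 1 = (img z).1.2 & toW z 2%:R = (img z).2].
Proof. by rewrite -toWE. Qed.

Lemma toW_inj : injective toW.
Proof.
move=> y z e; have : img y = img z by rewrite -!toWE e.
by case: y {e}; case: z.
Qed.

Lemma toW_bij : bijective toW.
Proof.
apply: inj_card_bij; first exact: toW_inj.
rewrite card_Sn -[(3`!)%N](card_ord 6); apply: (@leq_card _ _ ix_decode) => i j.
by case: i => [[|[|[|[|[|[|//]]]]]] ?]; case: j => [[|[|[|[|[|[|//]]]]]] ?] //= _; apply: val_inj.
Qed.

Definition ofW (w : W) : ix := odflt I1 [pick z | toW z == w].

Lemma ofWK w : toW (ofW w) = w.
Proof.
rewrite /ofW; case: pickP => [z /eqP //|none].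
by have [f fK gK] := toW_bij; have := none (f w); rewrite gK eqxx.
Qed.

Lemma toWK z : ofW (toW z) = z.
Proof. by apply: toW_inj; rewrite ofWK. Qed.

Definition ix_length (z : ix) : nat :=
  match z with I1 => 0 | Is | It => 1 | Ist | Its => 2 | Iw => 3 end.

Lemma weyl_length_toW z : weyl_length (toW z) = ix_length z.
Proof.
pose F (i j : 'I_3) : nat := (i < j)%N && (toW z j < toW z i)%N.
have -> : weyl_length (toW z) = \sum_i \sum_j F i j.
  rewrite (pair_bigA _ F) /weyl_length cardsE -sum1_card big_mkcond.
  by apply: eq_bigr => p _; rewrite unfold_in /F; case: ifP.
have [E0 E1 E2] := toW_val z; rewrite !sum_I3 /F E0 E1 E2.
by case: z {F E0 E1 E2}.
Qed.

(** In S_3 an element of strictly smaller length is Bruhat-smaller, so each edge is checked by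
    lengths alone. *)
Lemma bruhat_ge_ofW x y : bruhat_ge x y -> ix_le (ofW y) (ofW x).
Proof.
move=> /connectP[p]; elim: p x => [x _ ->|z p IHp x /= /andP[/andP[_ xz] zp] yE].
  exact: ix_lexx.
apply: ix_le_trans (IHp z zp yE) _; move: xz; rewrite -{1}(ofWK x) -{1}(ofWK z).
by rewrite !weyl_length_toW; case: (ofW x); case: (ofW z).
Qed.

Lemma dot_toW (K : fieldType) z : dot (toW z) 0 = ix_weight K z.
Proof.
apply/rowP => i; rewrite !mxE add0r; have [E0 E1 E2] := toW_val z.
case: (I3P i) => ->; rewrite ?E0 ?E1 ?E2; case: z {E0 E1 E2} => /=;
  rewrite /lower /sl3_root; do 6!rewrite ?mulmxnE ?mxE /=;
  rewrite -?[((1 %% 3 + 1 %% 3) %% 3)%N]/2%N -?[(1 %% 3)%N]/1%N; ring.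
Qed.

(** * Normal forms in the presented category *)

Section NormalForms.

Variables (K : fieldType) (a b r : K).

Local Notation tm := (term K arrow).
Local Notation u i := (Gen (Up i)).
Local Notation d i := (Gen (Down i)).
Local Notation "p ** q" := (Comp p q) (at level 40, left associativity).
Local Notation "p ~~ q" := (term_eq (relation a b r) p q) (at level 70).

Implicit Types i j k : ix.

Definition Ucan z j : tm (toW z) (toW j) :=
  match z as z', j as j' return tm (toW z') (toW j') with
  | I1, I1 => Id w1 | Is, Is => Id rs | It, It => Id rt
  | Ist, Ist => Id wst | Its, Its => Id wts | Iw, Iw => Id w0
  | Is, I1 => u up7 | It, I1 => u up8
  | Ist, Is => u up3 | Ist, It => u up4 | Its, Is => u up5 | Its, It => u up6
  | Iw, Ist => u up1 | Iw, Its => u up2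
  | Ist, I1 => u up7 ** u up3 | Its, I1 => u up7 ** u up5
  | Iw, Is => u up3 ** u up1 | Iw, It => u up4 ** u up1
  | Iw, I1 => u up7 ** (u up3 ** u up1)
  | _, _ => Zero
  end.

Definition Dcan j z : tm (toW j) (toW z) :=
  match j as j', z as z' return tm (toW j') (toW z') with
  | I1, I1 => Id w1 | Is, Is => Id rs | It, It => Id rt
  | Ist, Ist => Id wst | Its, Its => Id wts | Iw, Iw => Id w0
  | I1, Is => d up7 | I1, It => d up8
  | Is, Ist => d up3 | It, Ist => d up4 | Is, Its => d up5 | It, Its => d up6
  | Ist, Iw => d up1 | Its, Iw => d up2
  | I1, Ist => d up3 ** d up7 | I1, Its => d up5 ** d up7
  | Is, Iw => d up1 ** d up3 | It, Iw => d up1 ** d up4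
  | I1, Iw => d up1 ** (d up3 ** d up7)
  | _, _ => Zero
  end.

Lemma te_congl x y z (p p' : tm y z) (q : tm x y) : p ~~ p' -> p ** q ~~ p' ** q.
Proof. by move=> e; apply: te_comp e (te_refl _ _). Qed.
Lemma te_congr x y z (p : tm y z) (q q' : tm x y) : q ~~ q' -> p ** q ~~ p ** q'.
Proof. exact: te_comp (te_refl _ _). Qed.

Let asl {x y z t : W} (p : tm z t) (q : tm y z) (s : tm x y) : p ** (q ** s) ~~ p ** q ** s :=
  te_compA _ p q s.
Let asr {x y z t : W} (p : tm z t) (q : tm y z) (s : tm x y) : p ** q ** s ~~ p ** (q ** s) :=
  te_sym (te_compA _ p q s).
Let ax {x y} (p q : tm x y) : relation a b r p q -> p ~~ q := @te_rel _ _ _ _ x y p q.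
Let xa {x y} (p q : tm x y) : relation a b r p q -> q ~~ p := fun h => te_sym (ax h).

Lemma Dcan_comp i z y : ix_le i z -> ix_le z y -> Dcan z y ** Dcan i z ~~ Dcan i y.
Proof.
have idl x w (p : tm x w) : Id w ** p ~~ p := te_idl _ p.
have idr x w (p : tm x w) : p ** Id x ~~ p := te_idr _ p.
case: i; case: z => //; case: y => // _ _; rewrite /Dcan;
  first [exact: idl | exact: idr | exact: te_refl | idtac].
- exact: asr.
- exact/xa/rel_2c.
- exact/ax/rel_2d.
- exact: te_trans (asr _ _ _) (te_congr _ (xa (rel_2c _ _ _))).
- exact: te_trans (asl _ _ _) (te_trans (te_congl _ (xa (rel_2a _ _ _))) (asr _ _ _)).
- exact/xa/rel_2a.
- exact/xa/rel_2b.
Qed.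

Lemma Ucan_ge z j : ~~ ix_le j z -> Ucan z j = Zero.
Proof. by case: z; case: j. Qed.

(** Normal forms modulo the relations: d's from [i] to some z above both ends, then u's from z to
    [j], each along one chosen chain. *)
Inductive spanned i j : tm (toW i) (toW j) -> Prop :=
| span_mono z : ix_le i z -> ix_le j z -> spanned (Ucan z j ** Dcan i z)
| span_zero : spanned Zero
| span_add p q : spanned p -> spanned q -> spanned (Add p q)
| span_scale c p : spanned p -> spanned (Scale c p)
| span_eq p q : q ~~ p -> spanned p -> spanned q.

Lemma id_can i : Ucan i i = Id (toW i) /\ Dcan i i = Id (toW i).
Proof. by case: i. Qed.

Lemma span_U z j : ix_le j z -> spanned (Ucan z j).
Proof.
move=> le; apply: span_eq (span_mono (ix_lexx z) le).
by rewrite (id_can z).2; apply/te_sym/te_idr.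
Qed.

Lemma span_D i z : ix_le i z -> spanned (Dcan i z).
Proof.
move=> le; apply: span_eq (span_mono le (ix_lexx z)).
by rewrite (id_can z).1; apply/te_sym/te_idl.
Qed.

Lemma span_comp_D i z j (p : tm (toW z) (toW j)) :
  ix_le i z -> spanned p -> spanned (p ** Dcan i z).
Proof.
move=> le; elim=> {p} [y zy jy||p q _ IHp _ IHq|c p _ IHp|p q e _ IHp].
- apply: span_eq (span_mono (ix_le_trans le zy) jy).
  exact: te_trans (asr _ _ _) (te_congr _ (Dcan_comp le zy)).
- apply: span_eq (span_zero i j).
  apply: te_trans (te_congl _ (te_sym (te_scale0 _ Zero))) _.
  exact: te_trans (te_compZl _ _ _ _) (te_scale0 _ _).
- exact: span_eq (te_compDl _ _ _ _) (span_add IHp IHq).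
- exact: span_eq (te_compZl _ _ _ _) (span_scale c IHp).
- exact: span_eq (te_congl _ e) IHp.
Qed.

Lemma comp_zeror x y z (p : tm y z) : p ** (@Zero _ _ _ x y) ~~ Zero.
Proof.
apply: te_trans (te_congr _ (te_sym (te_scale0 _ Zero))) _.
exact: te_trans (te_compZr _ _ _ _) (te_scale0 _ _).
Qed.

Lemma comp_zerol x y z (q : tm x y) : (@Zero _ _ _ y z) ** q ~~ Zero.
Proof.
apply: te_trans (te_congl _ (te_sym (te_scale0 _ Zero))) _.
exact: te_trans (te_compZl _ _ _ _) (te_scale0 _ _).
Qed.

Lemma span_comp i j k (m : tm (toW j) (toW k)) (p : tm (toW i) (toW j)) :
  (forall z, ix_le j z -> spanned (m ** Ucan z j)) -> spanned p -> spanned (m ** p).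
Proof.
move=> mU; elim=> {p} [z iz jz||p q _ IHp _ IHq|c p _ IHp|p q e _ IHp].
- exact: span_eq (asl _ _ _) (span_comp_D iz (mU z jz)).
- exact: span_eq (comp_zeror _ _) (span_zero i k).
- exact: span_eq (te_compDr _ _ _ _) (span_add IHp IHq).
- exact: span_eq (te_compZr _ _ _ _) (span_scale c IHp).
- exact: span_eq (te_congr _ e) IHp.
Qed.

(** Composition of [m] with a path of u's ending at its source can be straightened. By [span_comp],
    composition with [m] then preserves all normal forms. *)
Definition stable j k (m : tm (toW j) (toW k)) : Prop :=
  forall z, ix_le j z -> spanned (m ** Ucan z j).

Let stable_U j k (m : tm (toW j) (toW k)) : ix_le k j ->
  (forall z, ix_le j z -> m ** Ucan z j ~~ Ucan z k) -> stable m.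
Proof. by move=> kj mU z jz; apply: span_eq (mU z jz) (span_U (ix_le_trans kj jz)). Qed.

Lemma stable_up1 : @stable Iw Ist (u up1).
Proof. by apply: stable_U => // -[] // _; apply: te_idr. Qed.
Lemma stable_up2 : @stable Iw Its (u up2).
Proof. by apply: stable_U => // -[] // _; apply: te_idr. Qed.
Lemma stable_up3 : @stable Ist Is (u up3).
Proof. by apply: stable_U => // -[] // _; [apply: te_idr | apply: te_refl]. Qed.
Lemma stable_up4 : @stable Ist It (u up4).
Proof. by apply: stable_U => // -[] // _; [apply: te_idr | apply: te_refl]. Qed.
Lemma stable_up5 : @stable Its Is (u up5).
Proof. by apply: stable_U => // -[] // _; [apply: te_idr | apply/xa/rel_1a]. Qed.
Lemma stable_up6 : @stable Its It (u up6).
Proof. by apply: stable_U => // -[] // _; [apply: te_idr | apply/xa/rel_1b]. Qed.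
Lemma stable_up7 : @stable Is I1 (u up7).
Proof. by apply: stable_U => // -[] // _; [apply: te_idr | apply: te_refl..]. Qed.
Lemma stable_up8 : @stable It I1 (u up8).
Proof.
apply: stable_U => // -[] // _; [exact: te_idr | exact/xa/rel_1c | exact/ax/rel_1d |].
exact: te_trans (asl _ _ _) (te_trans (te_congl _ (xa (rel_1c _ _ _))) (asr _ _ _)).
Qed.

(* Moving a downward arrow to the right of an upward one. *)
Let push i j k k' l (m : tm (toW j) (toW k)) (n : tm (toW k') (toW j))
    (n' : tm (toW l) (toW k)) (m' : tm (toW k') (toW l)) (p : tm (toW i) (toW k')) c :
  m ** n ~~ Scale c (n' ** m') -> stable n' -> spanned (m' ** p) -> spanned (m ** (n ** p)).
Proof.
move=> e sn' sp; apply: (@span_eq _ _ (Scale c (n' ** (m' ** p)))); last first.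
  by apply: span_scale; apply: span_comp.
apply: te_trans (asl _ _ _) (te_trans (te_congl _ e) _).
exact: te_trans (te_compZl _ _ _ _) (te_scale _ (asr _ _ _)).
Qed.

Let push0 i j k k' (m : tm (toW j) (toW k)) (n : tm (toW k') (toW j)) (p : tm (toW i) (toW k')) :
  m ** n ~~ Zero -> spanned (m ** (n ** p)).
Proof.
move=> e; apply: span_eq (span_zero i k).
exact: te_trans (asl _ _ _) (te_trans (te_congl _ e) (comp_zerol _ _)).
Qed.

Let span_scaled i j z c (p : tm (toW i) (toW j)) : ix_le i z -> ix_le j z ->
  p ~~ Scale c (Ucan z j ** Dcan i z) -> spanned p.
Proof. by move=> iz jz e; apply: span_eq e (span_scale c (span_mono iz jz)). Qed.

Let span_idr j k (m : tm (toW j) (toW k)) : m = Dcan j k -> ix_le j k -> spanned (m ** Id (toW j)).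
Proof. by move=> -> jk; apply: span_eq (te_idr _ _) (span_D jk). Qed.

Let span_null i j (p : tm (toW i) (toW j)) : p ~~ Zero -> spanned p.
Proof. by move=> e; apply: span_eq e (span_zero i j). Qed.

Lemma stable_down1 : @stable Ist Iw (d up1).
Proof. by case=> // _; [exact: (@span_idr Ist Iw) | exact/(@span_null Iw Iw)/ax/rel_3a]. Qed.
Lemma stable_down2 : @stable Its Iw (d up2).
Proof. by case=> // _; [exact: (@span_idr Its Iw) | exact/(@span_null Iw Iw)/ax/rel_3b]. Qed.
Lemma stable_down3 : @stable Is Ist (d up3).
Proof.
case=> // _; first exact: (@span_idr Is Ist).
- exact: (@span_scaled Ist Ist Iw) (ax (rel_4a _ _ _)).
- exact: (@span_scaled Its Ist Iw) (ax (rel_4d _ _ _)).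
- exact: (@push Iw Is Ist Ist Iw) (ax (rel_4a _ _ _)) stable_up1 (stable_down1 (z := Iw) _).
Qed.
Lemma stable_down4 : @stable It Ist (d up4).
Proof.
case=> // _; first exact: (@span_idr It Ist).
- exact/(@span_null Ist Ist)/ax/rel_3c.
- exact: (@span_scaled Its Ist Iw) (ax (rel_4e _ _ _)).
- exact: (@push0 Iw It Ist Ist) (ax (rel_3c _ _ _)).
Qed.
Lemma stable_down5 : @stable Is Its (d up5).
Proof.
case=> // _; first exact: (@span_idr Is Its).
- exact: (@span_scaled Ist Its Iw) (ax (rel_4f _ _ _)).
- exact/(@span_null Its Its)/ax/rel_3d.
- exact: (@push Iw Is Its Ist Iw) (ax (rel_4f _ _ _)) stable_up2 (stable_down1 (z := Iw) _).
Qed.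
Lemma stable_down6 : @stable It Its (d up6).
Proof.
case=> // _; first exact: (@span_idr It Its).
- exact: (@span_scaled Ist Its Iw) (ax (rel_4c _ _ _)).
- exact: (@span_scaled Its Its Iw) (ax (rel_4b _ _ _)).
- exact: (@push Iw It Its Ist Iw) (ax (rel_4c _ _ _)) stable_up2 (stable_down1 (z := Iw) _).
Qed.

Let span4 i j k l m (p : tm (toW l) (toW m)) (q : tm (toW k) (toW l)) (s : tm (toW j) (toW k))
    (t : tm (toW i) (toW j)) c : stable p -> stable q -> spanned (s ** t) ->
  spanned (Scale c (p ** q ** s ** t)).
Proof.
move=> sp sq ss; apply/span_scale/span_eq/(span_comp sp)/(span_comp sq)/ss.
by apply: te_trans (asr _ _ _) (asr _ _ _).
Qed.

Lemma stable_down7 : @stable I1 Is (d up7).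
Proof.
have E := ax (rel_5a a b r).
case=> // _; first exact: (@span_idr I1 Is).
- exact: (@span_scaled Is Is Its) E.
- apply: (@span_eq It Is) (ax (rel_5d _ _ _)) _; apply: span_add; first apply: span_add.
  + exact/span_scale/(@span_mono It Is Ist).
  + exact/span_scale/(@span_mono It Is Its).
  + apply: (@span4 It Its Iw Ist Is) stable_up3 stable_up1 _.
    exact: (@span_eq It Iw _ _ (xa (rel_2b _ _ _)) (@span_D It Iw isT)).
- exact: (@push Ist I1 Is Is Its) E stable_up5 (stable_down5 (z := Ist) _).
- exact: (@push Its I1 Is Is Its) E stable_up5 (stable_down5 (z := Its) _).
- exact: (@push Iw I1 Is Is Its) E stable_up5 (stable_down5 (z := Iw) _).
Qed.

Lemma stable_down8 : @stable I1 It (d up8).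
Proof.
have E := ax (rel_5b a b r).
case=> // _; first exact: (@span_idr I1 It).
- apply: (@span_eq Is It) (ax (rel_5c _ _ _)) _; apply: span_add; first apply: span_add.
  + exact/span_scale/(@span_mono Is It Ist).
  + exact/span_scale/(@span_mono Is It Its).
  + exact: (@span4 Is Ist Iw Its It) stable_up6 stable_up2 (@span_D Is Iw _).
- exact: (@span_scaled It It Ist) E.
(* The chosen chain to 1 passes through s. Relation (1) reroutes it through t, where d_8 u_8 can be
   rewritten. *)
- apply: (@span_eq Ist It) (te_congr _ (ax (rel_1c _ _ _))) _.
  exact: (@push Ist I1 It It Ist) E stable_up4 (stable_down4 (z := Ist) _).
- apply: (@span_eq Its It) (te_congr _ (xa (rel_1d _ _ _))) _.
  exact: (@push Its I1 It It Ist) E stable_up4 (stable_down4 (z := Its) _).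
- apply: (@span_eq Iw It (d up8 ** (u up8 ** (u up4 ** u up1)))).
    apply: te_congr; apply: te_trans (asl _ _ _) (te_trans _ (asr _ _ _)).
    exact/te_congl/ax/rel_1c.
  exact: (@push Iw I1 It It Ist) E stable_up4 (stable_down4 (z := Iw) _).
Qed.

End NormalForms.

(** * From normal forms to a presentation *)

Section PresentationCriterion.

Variables (K : numFieldType) (a b r : K).
Variables (T : W -> sl3_module K) (ev : forall x y, arrow x y -> sl3_hom (T x) (T y)).

Local Notation tm := (term K arrow).
Local Notation "p ** q" := (Comp p q) (at level 40, left associativity).
Local Notation "p ~~ q" := (term_eq (relation a b r) p q) (at level 70).
Local Notation mono i j z := (Ucan K z j ** Dcan K i z).
Local Notation above i j := [pred z | ix_le i z && ix_le j z].

Hypothesis sound : forall x y (p q : tm x y), relation a b r p q -> eval ev p = eval ev q.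
Hypothesis eval_span : forall i j (f : sl3_hom (T (toW i)) (T (toW j))),
  exists c : ix -> K, f = \sum_(z in above i j) c z *: eval ev (mono i j z).
Hypothesis eval_free : forall i j (c : ix -> K),
  \sum_(z in above i j) c z *: eval ev (mono i j z) = 0 -> forall z, z \in above i j -> c z = 0.

Lemma eval_sound x y (p q : tm x y) : p ~~ q -> eval ev p = eval ev q.
Proof.
elim=> {x y p q} /=; try by [exact: sound | move=> *; apply: val_inj].
- by move=> x y p q _ ->.
- by move=> x y p q s _ -> _ ->.
- by move=> x y z p p' q q' _ -> _ ->.
- by move=> x y p p' q q' _ -> _ ->.
- by move=> x y c p p' _ ->.
- by move=> x y p q s; apply: addrA.
- by move=> x y p q; apply: addrC.
- by move=> x y p; apply: add0r.
- by move=> x y p; apply: scale0r.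
- by move=> x y p; apply: scale1r.
- by move=> x y c e p; apply: scalerA.
- by move=> x y c e p; apply: scalerDl.
- by move=> x y c p q; apply: scalerDr.
- by move=> x y z p q q'; apply/val_inj/funext => t; apply: homD.
- by move=> x y z c p q; apply/val_inj/funext => t; apply: homZ.
Qed.

Definition arrow_stable j k (n : up (toW j) (toW k)) : Prop :=
  stable a b r (Gen (Up n)) /\ stable a b r (Gen (Down n)).

(** Case analysis on an arrow requires variable endpoints, so they are generalised along equations;
    these are removed again because equality proofs in [W] are unique. *)
Let up_cast x y j k (ex : x = toW j) (ey : y = toW k) (n : up x y) : up (toW j) (toW k) :=
  ecast t (up (toW j) t) ey (ecast t (up t y) ex n).

Let arrow_stable_cast j0 k0 (n : up (toW j0) (toW k0)) : arrow_stable n ->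
  forall j k (ex : toW j0 = toW j) (ey : toW k0 = toW k), arrow_stable (up_cast ex ey n).
Proof.
move=> sn j k ex ey; have ej := toW_inj ex; have ek := toW_inj ey; subst j k.
by rewrite (eq_axiomK ex) (eq_axiomK ey).
Qed.

Lemma up_stable j k (n : up (toW j) (toW k)) : arrow_stable n.
Proof.
suff H x y (m : up x y) : forall j' k' (ex : x = toW j') (ey : y = toW k'),
    arrow_stable (up_cast ex ey m) by exact: (H _ _ n j k erefl erefl).
case: m.
- exact: (@arrow_stable_cast Iw Ist up1 (conj (stable_up1 a b r) (stable_down1 a b r))).
- exact: (@arrow_stable_cast Iw Its up2 (conj (stable_up2 a b r) (stable_down2 a b r))).
- exact: (@arrow_stable_cast Ist Is up3 (conj (stable_up3 a b r) (stable_down3 a b r))).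
- exact: (@arrow_stable_cast Ist It up4 (conj (stable_up4 a b r) (stable_down4 a b r))).
- exact: (@arrow_stable_cast Its Is up5 (conj (stable_up5 a b r) (stable_down5 a b r))).
- exact: (@arrow_stable_cast Its It up6 (conj (stable_up6 a b r) (stable_down6 a b r))).
- exact: (@arrow_stable_cast Is I1 up7 (conj (stable_up7 a b r) (stable_down7 a b r))).
- exact: (@arrow_stable_cast It I1 up8 (conj (stable_up8 a b r) (stable_down8 a b r))).
Qed.

Let tm_cast x y j k (ex : x = toW j) (ey : y = toW k) (p : tm x y) : tm (toW j) (toW k) :=
  ecast t (tm (toW j) t) ey (ecast t (tm t y) ex p).

(** Induction on a left factor acting on normal forms, which handles composition directly; the right
    factor is finally taken to be the identity. *)
Lemma spanned_all i j (p : tm (toW i) (toW j)) : spanned a b r p.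
Proof.
suff H x y (q : tm x y) : forall l k (ex : x = toW l) (ey : y = toW k) (s : tm (toW i) (toW l)),
    spanned a b r s -> spanned a b r (tm_cast ex ey q ** s).
  have sI : spanned a b r (Id (toW i)).
    by rewrite -(id_can K i).1; apply: span_U; apply: ix_lexx.
  by apply: (span_eq (te_sym (te_idr _ _))); apply: (H _ _ p i j erefl erefl _ sI).
elim: q => {p x y} [x|x y m|x y z p IHp q IHq|x y|x y p IHp q IHq|x y c p IHp] l k ex ey s ss.
- subst x; have ek := toW_inj ey; subst k; rewrite (eq_axiomK ey).
  exact: span_eq (te_idl _ _) ss.
- subst x y; apply: span_comp ss; case: m => m; [exact: (up_stable m).1 | exact: (up_stable m).2].
- have [w ew] : exists w, y = toW w by exists (ofW y); rewrite ofWK.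
  subst x y z; apply: span_eq (te_sym (te_compA _ _ _ _)) _.
  exact: (IHp _ _ erefl erefl _ (IHq _ _ erefl erefl _ ss)).
- subst x y; exact: span_eq (comp_zerol _ _ _ _ _) (span_zero _ _ _ _ _).
- subst x y; apply: span_eq (te_compDl _ _ _ _) (span_add _ _).
    exact: (IHp _ _ erefl erefl _ ss).
  exact: (IHq _ _ erefl erefl _ ss).
- subst x y; apply: span_eq (te_compZl _ _ _ _) (span_scale _ _).
  exact: (IHp _ _ erefl erefl _ ss).
Qed.

Definition normal_form i j (c : ix -> K) (s : seq ix) : tm (toW i) (toW j) :=
  foldr (fun z p => Add (Scale (c z) (mono i j z)) p) Zero s.

Lemma eval_normal_form i j c s :
  eval ev (normal_form i j c s) = \sum_(z <- s) c z *: eval ev (mono i j z).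
Proof. by elim: s => [|z s IHs]; rewrite ?big_nil ?big_cons //= IHs. Qed.

Lemma add_zero x y (p : tm x y) : Add p Zero ~~ p.
Proof. exact: te_trans (te_addC _ _ _) (te_add0 _ _). Qed.

Lemma scale_zero x y (c : K) : Scale c (@Zero _ _ _ x y) ~~ Zero.
Proof.
apply: te_trans (te_scale _ (te_sym (te_scale0 _ Zero))) _.
apply: te_trans (te_scaleA _ _ _ _) _; rewrite mulr0; exact: te_scale0.
Qed.

Lemma normal_formD i j c e s :
  Add (normal_form i j c s) (normal_form i j e s) ~~ normal_form i j (fun z => c z + e z) s.
Proof.
elim: s => [|z s IHs] /=; first exact: te_add0.
apply: te_trans _ (te_add (te_sym (te_scaleDl _ _ _ _)) IHs).
move: (Scale (c z) _) (Scale (e z) _) => p q.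
apply: te_trans (te_sym (te_addA _ _ _ _)) _; apply: te_trans _ (te_addA _ _ _ _).
apply: te_add (te_refl _ _) _; apply: te_trans (te_addA _ _ _ _) _.
apply: te_trans _ (te_sym (te_addA _ _ _ _)).
exact: te_add (te_addC _ _ _) (te_refl _ _).
Qed.

Lemma normal_formZ i j c e s :
  Scale e (normal_form i j c s) ~~ normal_form i j (fun z => e * c z) s.
Proof.
elim: s => [|z s IHs] /=; first exact: scale_zero.
exact: te_trans (te_scaleDr _ _ _ _) (te_add (te_scaleA _ _ _ _) IHs).
Qed.

Lemma normal_form0 i j c s : {in s, forall z, c z = 0} -> normal_form i j c s ~~ Zero.
Proof.
elim: s => [|z s IHs] c0 /=; first exact: te_refl.
rewrite c0 ?mem_head //.
apply: te_trans (te_add (te_scale0 _ _) (IHs _)) (te_add0 _ _).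
by move=> y ys; rewrite c0 // inE ys orbT.
Qed.

Lemma normal_form1 i j z s : uniq s -> z \in s ->
  normal_form i j (fun y => (y == z)%:R) s ~~ mono i j z.
Proof.
elim: s => //= y s IHs /andP[nys us]; rewrite inE => /predU1P[->|zs].
  rewrite eqxx; apply: te_trans (te_add (te_scale1 _ _) (normal_form0 _ _ _)) (add_zero _).
  by move=> x xs; case: eqP => // e; rewrite -e xs in nys.
case: eqP => [e|_]; first by rewrite e zs in nys.
exact: te_trans (te_add (te_scale0 _ _) (IHs us zs)) (te_add0 _ _).
Qed.

Lemma normal_form_exists i j (p : tm (toW i) (toW j)) :
  exists c, p ~~ normal_form i j c (enum (above i j)).
Proof.
elim: (spanned_all p) => {p} [z iz jz||p q _ [c pc] _ [e qe]|e p _ [c pc]|p q qp _ [c pc]].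
- exists (fun y => (y == z)%:R); apply/te_sym/normal_form1; first exact: enum_uniq.
  by rewrite mem_enum inE iz.
- by exists (fun=> 0); apply/te_sym/normal_form0.
- by exists (fun z => c z + e z); apply: te_trans (te_add pc qe) (normal_formD _ _ _ _ _).
- by exists (fun z => e * c z); apply: te_trans (te_scale e pc) (normal_formZ _ _ _ _ _).
- by exists c; apply: te_trans qp pc.
Qed.

Lemma eval_eq0 i j (p : tm (toW i) (toW j)) : eval ev p = 0 -> p ~~ Zero.
Proof.
have [c pc] := normal_form_exists p; rewrite (eval_sound pc) eval_normal_form big_enum => c0.
apply: te_trans pc (normal_form0 _ _ _) => z.
by rewrite mem_enum => zij; apply: eval_free c0 z zij.
Qed.

(** Normal forms span the presented category and evaluate to bases, so evaluation is full and a term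
    that evaluates to 0 has a normal form with zero coefficients. *)
Lemma presentation_criterion : presented_by ev (relation a b r).
Proof.
split=> x y; rewrite -(ofWK x) -(ofWK y).
  move=> f; have [c ->] := eval_span f.
  exists (normal_form _ _ c (enum (above (ofW x) (ofW y)))).
  by rewrite eval_normal_form big_enum.
move=> p q; split=> [e|]; last exact: eval_sound.
have pq0 : Add p (Scale (-1) q) ~~ Zero.
  by apply: eval_eq0; rewrite /= e scaleN1r subrr.
have qq0 : Add (Scale (-1) q) q ~~ Zero.
  by apply: eval_eq0; rewrite /= scaleN1r addNr.
apply: te_trans (te_sym (add_zero p)) _.
apply: te_trans (te_add (te_refl _ p) (te_sym qq0)) _.
by apply: te_trans (te_addA _ _ _ _) _; apply: te_trans (te_add pq0 (te_refl _ q)) (te_add0 _ _).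
Qed.

End PresentationCriterion.

(** * Presentation of the category of tilting modules *)

Section SelfDuality.

Variables (K : numFieldType) (M : sl3_module K) (phi : sl3_iso M (dual_module M)).

Definition iso_form (u v : M) : K := (iso_hom phi u : dual_space M) v.

Lemma iso_form_contravariant : contravariant iso_form.
Proof.
split=> [c u v t|c u v t|x u v].
- by rewrite /iso_form hom_linear.
- by rewrite /iso_form dual_linear.
- by rewrite /iso_form hom_act.
Qed.

Lemma iso_form_nondegenerate u : (forall v, iso_form u v = 0) -> u = 0.
Proof.
move=> u0; rewrite -(iso_homK phi u); have -> : iso_hom phi u = 0.
  by apply/val_inj/funext.
exact: hom0.
Qed.

End SelfDuality.

(** * The relations and the compatibility of the lifts *)

Section Relations.

Variable K : numFieldType.
Variable B : big K -> big K -> K.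
Hypothesis cB : contravariant B.
Hypothesis symB : forall p q, B p q = B q p.
Hypothesis B1 : B (vgen K I1) (vgen K I1) != 0.

Variable T : W -> sl3_module K.
Variable phi : forall w, sl3_iso (T w) (dual_module (T w)).
Hypothesis phi_sym : forall w, symmetric_iso (phi w).
Variable pi : forall w, sl3_hom (big K) (T w).
Hypothesis pi_surj : forall w t, exists p, pi w p = t.
Hypothesis piE : forall w p q,
  iso_form (phi w) (pi w p) (pi w q) = B (chom K (ofW w) p) q.

Let F w := iso_form (phi w).
Let cF w : contravariant (@F w) := iso_form_contravariant (phi w).
Let ndF w (u : T w) : (forall v, F u v = 0) -> u = 0.
Proof. exact: iso_form_nondegenerate. Qed.

Definition up_lift := up_map cB symB B1 cF ndF pi_surj piE.
Definition down_lift := down_map cB symB B1 cF ndF pi_surj piE.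

Lemma dagger_up_lift x y : ix_le (ofW y) (ofW x) ->
  dagger (phi x) (phi y) (up_lift x y) = down_lift x y.
Proof.
move=> le; apply/val_inj/funext => t.
apply: (can_inj (iso_homK (phi x))); rewrite /= iso_invK.
apply/val_inj/funext => v; symmetry.
exact: (up_down_adjoint cB symB B1 cF ndF pi_surj piE t v le).
Qed.

Let ev := @arrow_map K T up_lift phi.

Lemma up_liftE x y z j p : ofW x = z -> ofW y = j -> ix_le j z ->
  up_lift x y (pi x p) = pi y (gam K z j p).
Proof. by move=> <- <- le; apply: up_mapE. Qed.

Lemma down_liftE x y z j p : ofW x = z -> ofW y = j -> ix_le j z ->
  dagger (phi x) (phi y) (up_lift x y) (pi y p) = pi x p.
Proof. by move=> <- <- le; rewrite dagger_up_lift //; apply: down_mapE. Qed.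

Let o1 : ofW w1 = I1 := toWK I1.
Let os : ofW rs = Is := toWK Is.
Let ot : ofW rt = It := toWK It.
Let ost : ofW wst = Ist := toWK Ist.
Let ots : ofW wts = Its := toWK Its.
Let ow : ofW w0 = Iw := toWK Iw.

Let upE p :=
  ((up_liftE p ow ost isT, up_liftE p ow ots isT, up_liftE p ost os isT, up_liftE p ost ot isT),
   (up_liftE p ots os isT, up_liftE p ots ot isT, up_liftE p os o1 isT, up_liftE p ot o1 isT)).
Let downE p :=
  ((down_liftE p ow ost isT, down_liftE p ow ots isT, down_liftE p ost os isT,
    down_liftE p ost ot isT),
   (down_liftE p ots os isT, down_liftE p ots ot isT, down_liftE p os o1 isT,
    down_liftE p ot o1 isT)).

(** After multiplication by the c_w of the target, each relation is an identity in X and Y. For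
    instance d_3 u_3 is Y - X and u_1 d_1 is X on [T(st)], where c_st = Y^2 and Y^3 = 0, so a = -1.
    Likewise d_8 u_7 is X = Y + (X - Y), so b = 1 and r = 0. *)
Lemma relation_sound x y (p q : term K arrow x y) :
  relation (-1) 1 0 p q -> eval ev p = eval ev q.
Proof.
have compE (L M N : sl3_module K) (f : sl3_hom M N) (g : sl3_hom L M) v : (f \oh g) v = f (g v).
  by [].
have scaleE (M N : sl3_module K) c (f : sl3_hom M N) v : (c *: f) v = c *: f v by [].
have addE (M N : sl3_module K) (f g : sl3_hom M N) v : (f + g) v = f v + g v by [].
have zeroE (M N : sl3_module K) v : (0 : sl3_hom M N) v = 0 by [].
pose rel := (endYX, endXX, endYYY).
case=> {x y p q}; rewrite ![eval _ _]/=; apply: (hom_surj_eq (@pi_surj _)) => p;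
  rewrite !(compE, scaleE, addE, zeroE, upE, downE) ?scale0r ?scale1r ?addr0 ?opprK ?scale1r;
  rewrite -?homZ -?homD -?[0 in RHS](hom0 (pi _)).
all: apply/(pi_eq cB symB B1 cF ndF pi_surj piE); rewrite ?(o1, os, ot, ost, ots, ow) /chom /gam /=;
  try by [].
all: do 6?rewrite ?rel ?scaleE ?(homD, homN, homZ, hom0).
all: rewrite ?scaleN1r ?(subr0, sub0r, oppr0) ?subrr ?(subr0, sub0r, oppr0) ?subKr //.
- by rewrite opprK.
- by rewrite addrC subrK.
- by rewrite addrC subrK.
Qed.


Let ge (x y : W) := ix_le (ofW y) (ofW x).

Let up_lift_comp x y z : ge x y -> ge y z -> up_lift y z \oh up_lift x y = up_lift x z.
Proof. exact: up_map_comp. Qed.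

Lemma eval_Ucan i j : ix_le j i -> eval ev (Ucan K i j) = up_lift (toW i) (toW j).
Proof.
have idE x : up_lift x x = idhom (T x) := up_map_id cB symB B1 cF ndF pi_surj piE x.
have comp3 k l m : ix_le l k -> ix_le m l ->
    up_lift (toW l) (toW m) \oh up_lift (toW k) (toW l) = up_lift (toW k) (toW m).
  by move=> lk ml; apply: up_lift_comp; rewrite /ge !toWK.
case: i; case: j => // _; rewrite /Ucan /= ?idE //.
- exact: (comp3 Ist Is I1).
- exact: (comp3 Its Is I1).
- by rewrite (comp3 Iw Ist Is) // (comp3 Iw Is I1).
- exact: (comp3 Iw Ist Is).
- exact: (comp3 Iw Ist It).
Qed.

Lemma eval_Dcan i j p : ix_le i j -> eval ev (Dcan K i j) (pi (toW i) p) = pi (toW j) p.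
Proof.
pose dn k l := dagger (phi (toW l)) (phi (toW k)) (up_lift (toW l) (toW k)).
have dnE k l : ix_le k l -> dn k l (pi (toW k) p) = pi (toW l) p := down_liftE p (toWK l) (toWK k).
have dn2 k l m : ix_le k l -> ix_le l m -> dn l m (dn k l (pi (toW k) p)) = pi (toW m) p.
  by move=> kl lm; rewrite !dnE.
case: i; case: j => // _; try reflexivity.
- exact: (dnE I1 Is).
- exact: (dnE I1 It).
- exact: (dn2 I1 Is Ist).
- exact: (dn2 I1 Is Its).
- by apply: etrans (congr1 _ (dn2 I1 Is Ist _ _)) (dnE Ist Iw _).
- exact: (dnE Is Ist).
- exact: (dnE Is Its).
- exact: (dn2 Is Ist Iw).
- exact: (dnE It Ist).
- exact: (dnE It Its).
- exact: (dn2 It Ist Iw).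
- exact: (dnE Ist Iw).
- exact: (dnE Its Iw).
Qed.

Lemma eval_mono i j z p : ix_le i z -> ix_le j z ->
  eval ev (Comp (Ucan K z j) (Dcan K i z)) (pi (toW i) p) = pi (toW j) (gam K z j p).
Proof.
move=> iz jz; rewrite -[LHS]/(eval ev (Ucan K z j) (eval ev (Dcan K i z) (pi (toW i) p))).
by rewrite eval_Dcan // eval_Ucan // (up_liftE p (toWK z) (toWK j)).
Qed.

Lemma eval_monos i j (c : ix -> K) p :
  (\sum_(z in [pred z | ix_le i z && ix_le j z])
    c z *: eval ev (Comp (Ucan K z j) (Dcan K i z))) (pi (toW i) p) =
  pi (toW j) (\sum_(z | ix_le i z && ix_le j z) c z *: gam K z j p).
Proof.
rewrite sum_homE hom_sum; apply: eq_bigr => z /andP[iz jz]; rewrite homZ -(eval_mono p iz jz).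
by [].
Qed.

Lemma lifts_presentation : presented_by ev (relation (-1) 1 0).
Proof.
apply: presentation_criterion => [x y p q|i j f|i j c c0 z].
- exact: relation_sound.
- have [c fE] := hom_span cB symB B1 cF ndF pi_surj piE f; exists c.
  apply: (hom_surj_eq (@pi_surj _)) => p; rewrite fE !toWK.
  by symmetry; apply: eval_monos.
- rewrite inE => /andP[iz jz].
  have := @hom_free K B cB symB B1 _ _ _ _ cF ndF _ pi_surj piE (toW i) (toW j) c.
  rewrite !toWK; apply=> // p.
  by rewrite -eval_monos c0.
Qed.

Lemma lifts_compatible (Delta : W -> sl3_module K) (iota : forall w, sl3_hom (Delta w) (T w)) :
  (forall w, weight_module (T w)) -> (forall w, acyclic (T w)) ->
  (forall w, is_verma (ix_weight K (ofW w)) (Delta w)) -> (forall w, injective (iota w)) ->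
  compatible_lifts iota up_lift.
Proof.
move=> wT aT vD injI; split=> [x y /bruhat_ge_ofW le|x y h].
  exact: (up_map_lift cB symB B1 cF ndF wT aT pi_surj piE vD injI le).
move=> hc; suff [//] : up_lift x y = h /\ ge x y.
elim: hc => [|z t f _ [<- xz] zt].
  split; last exact: ix_lexx.
  exact: (up_map_id cB symB B1 cF ndF pi_surj piE x).
have zt' : ge z t by apply/bruhat_ge_ofW/connect1.
by split; [rewrite up_lift_comp | apply: ix_le_trans zt' xz].
Qed.

End Relations.

Lemma tilting_presentation (K : numFieldType) (square_roots : forall c : K, exists s, s ^+ 2 = c)
    (Delta T : W -> sl3_module K)
    (Delta_verma : forall w, is_verma (dot w 0) (Delta w))
    (T_tilting : forall w, indecomposable_tilting (dot w 0) (T w))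
    (iota : forall w, sl3_hom (Delta w) (T w))
    (iota_inj : forall w, injective (iota w))
    (phi : forall w, sl3_iso (T w) (dual_module (T w)))
    (phi_sym : forall w, symmetric_iso (phi w)) :
  exists2 g : forall x y, sl3_hom (T x) (T y), compatible_lifts iota g &
    presented_by (arrow_map g phi) (relation (-1) 1 0).
Proof.
pose F w := iso_form (phi w).
have cF w : contravariant (@F w) := iso_form_contravariant (phi w).
have symF w u v : @F w u v = F w v u by apply: phi_sym.
have ndF w := @iso_form_nondegenerate K (T w) (phi w).
have wT w : weight_module (T w) by have [[[]]] := T_tilting w.
have aT w : acyclic (T w) by have [[_ _ fl] _ _] := T_tilting w; apply: acyclic_flag.
have indT w : indecomposable (T w) by have [] := T_tilting w.
have dotE w : dot w 0 = ix_weight K (ofW w) by rewrite -{1}(ofWK w) dot_toW.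
have top w : exists2 t : T w, singular_vector (ix_weight K (ofW w)) t & F w t t != 0.
  have [_ _ hw] := T_tilting w; rewrite -dotE.
  exact: (highest_weight_anisotropic (cF w) (@symF w) (@ndF w) (wT w) hw).
(* The reference form [B] is the form of [T(1)] pulled back along v_1 |-> t1; it is nonzero on v_1
   because t1 is anisotropic. *)
have [t1 st1 t1n] := top w1; rewrite (toWK I1) in st1.
have [f ft _] := singular_hom (@wT w1) (@aT w1) st1.
pose B p q := F w1 (f p) (f q).
have cB : contravariant B := contravariant_hom f f (cF w1).
have symB p q : B p q = B q p by apply: symF.
have B1 : B (vgen K I1) (vgen K I1) != 0 by rewrite /B ft.
have quot w : exists pi : sl3_hom (big K) (T w), (forall t, exists p, pi p = t) /\
    forall p q, F w (pi p) (pi q) = B (chom K (ofW w) p) q.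
  have [t st tn] := top w.
  exact: (tilting_quotient cB symB B1 square_roots (cF w) (@symF w)
    (@wT w) (@aT w) (indT w) st tn).
pose pi w := projT1 (cid (quot w)).
have pi_surj w t : exists p, pi w p = t by case: (projT2 (cid (quot w))) => + _; apply.
have piE w p q : F w (pi w p) (pi w q) = B (chom K (ofW w) p) q.
  by case: (projT2 (cid (quot w))) => _; apply.
exists (up_lift cB symB B1 pi_surj piE); last exact: lifts_presentation.
apply: lifts_compatible => // w; rewrite -dotE; exact: Delta_verma.
Qed.

Theorem theorem3p3 (R : realType)
    (Delta T : W -> sl3_module R[i])
    (Delta_verma : forall w, is_verma (dot w 0) (Delta w))
    (T_tilting : forall w, indecomposable_tilting (dot w 0) (T w))
    (iota : forall w, sl3_hom (Delta w) (T w))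
    (iota_inj : forall w, injective (iota w))
    (phi : forall w, sl3_iso (T w) (dual_module (T w)))
    (phi_sym : forall w, symmetric_iso (phi w)) :
  exists2 g : forall x y, sl3_hom (T x) (T y), compatible_lifts iota g &
    exists a b r : R[i],
      [/\ a != 0, b != 0 & presented_by (arrow_map g phi) (relation a b r)].
Proof.
have square_roots (c : R[i]) : exists s, s ^+ 2 = c by exists (sqrtC c); apply: sqrtCK.
have [g comp pres] := tilting_presentation square_roots Delta_verma T_tilting iota_inj phi_sym.
exists g => //; exists (-1), 1, 0; split=> //; last exact: oner_neq0.
by rewrite oppr_eq0 oner_neq0.
Qed.
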